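(* Assume $\mu(X)=\infty$. The set $\mathrm{Erg}^{\mathrm{III}_1}_2(X,\mathcal{A},\mu):=\{T\in\mathrm{Aut}_2(X,\mathcal{A},\mu):\ T \text{ is ergodic of type } \mathrm{III}_1\}$ is a dense $G_\delta$ subset of $\mathrm{Aut}_2(X,\mathcal{A},\mu)$ endowed with the topology $d_2$.
   Context: $(X,\mathcal{A},\mu)$ is a standard $\sigma$-finite non-atomic measure space. For an invertible nonsingular $T$, $T'=\frac{d\mu\circ T^{-1}}{d\mu}$, $U_Tf=\sqrt{T'}f\circ T^{-1}$. $\mathrm{Aut}_2(X,\mathcal A,\mu)=\{T:\sqrt{T'}-1\in L^2(\mu)\}$ with topology $d_2$: $T_n\to T$ iff $U_{T_n}\to U_T$ weakly and $\|\sqrt{T_n'}-\sqrt{T'}\|_2\to0$. The Maharam extension of $T$ is $\tilde T(x,y)=(Tx,\,y-\log\frac{d\mu\circ T}{d\mu}(x))$ on $X\times\mathbb{R}$, preserving $\tilde\mu(A\times I)=\mu(A)\int_Ie^t\,dt$; $T$ is (ergodic) of type $\mathrm{III}_1$ if its Maharam extension is ergodic. *)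

(* Defs.v *)
From HB Require Import structures.
From mathcomp Require Import all_boot all_order all_algebra.
From mathcomp Require Import all_classical all_reals all_analysis.
Unset Printing Implicit Defensive.
Import Order.TTheory GRing.Theory Num.Theory.
Import numFieldNormedType.Exports.
Local Open Scope classical_set_scope.
Local Open Scope ring_scope.

Section Defs.
Context {d : measure_display} {X : measurableType d} {R : realType}.
Variable mu : {measure set X -> \bar R}.

Definition standard_borel : Prop :=
  exists f : X -> R, injective f /\ measurable_fun setT f /\
    forall A : set X, measurable A -> measurable (f @` A).

Definition nonatomic : Prop :=
  forall A : set X, measurable A -> (0 < mu A)%E ->
    exists B : set X, [/\ measurable B, B `<=` A, (0 < mu B)%E &
                          (0 < mu (A `\` B))%E].

Definition nonsingular_inv (T : X -> X) : Prop :=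
  exists S : X -> X, [/\ cancel T S, cancel S T,
    measurable_fun setT T, measurable_fun setT S &
    forall A : set X, measurable A -> (mu (T @^-1` A) = 0 <-> mu A = 0)].

Definition inv_map (T : X -> X) : X -> X :=
  xget T [set S | cancel T S /\ cancel S T].

Definition is_RN (nu : set X -> \bar R) (w : X -> R) : Prop :=
  [/\ measurable_fun setT w, (forall x, 0 <= w x) &
      forall A : set X, measurable A -> nu A = (\int[mu]_(x in A) (w x)%:E)%E].

Definition RNderiv (nu : set X -> \bar R) : X -> R :=
  xget (fun=> 0) [set w | is_RN nu w].

Definition Tprime (T : X -> X) : X -> R :=
  RNderiv (fun A => mu (T @^-1` A)).

Definition dmuT (T : X -> X) : X -> R :=
  RNderiv (fun A => mu (T @` A)).

Definition L2 (f : X -> R) : Prop :=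
  measurable_fun setT f /\ (\int[mu]_x ((f x) ^+ 2)%:E < +oo)%E.

Definition Aut2 (T : X -> X) : Prop :=
  nonsingular_inv T /\ L2 (fun x => Num.sqrt (Tprime T x) - 1).

(** <U_T f, g> with U_T f = sqrt(T') f o T^-1 *)
Definition UT_coef (T : X -> X) (f g : X -> R) : R :=
  fine (\int[mu]_x (Num.sqrt (Tprime T x) * f (inv_map T x) * g x)%:E)%E.

Definition sqrt_dist (T : X -> X) (h : X -> R) : R :=
  Num.sqrt (fine (\int[mu]_x ((Num.sqrt (Tprime T x) - 1 - h x) ^+ 2)%:E)%E).

Definition d2_index : Type :=
  ({fg : (X -> R) * (X -> R) | L2 fg.1 /\ L2 fg.2} + {h : X -> R | L2 h})%type.

Definition d2_map (T : X -> X) : {ptws d2_index -> R} :=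
  fun i => match i with
           | inl fg => UT_coef T (sval fg).1 (sval fg).2
           | inr h => sqrt_dist T (sval h)
           end.

Definition aut2_type : Type := {T : X -> X | Aut2 T}.

Definition ergodic {d' : measure_display} {Y : measurableType d'}
  (m : set Y -> \bar R) (S : Y -> Y) : Prop :=
  forall A : set Y, measurable A -> S @^-1` A = A -> m A = 0 \/ m (~` A) = 0.

(** Maharam extension and its invariant measure
    mu~(A) = int_X int_R 1_A(x,y) e^y dy dmu(x) *)
Definition maharam (T : X -> X) : X * R -> X * R :=
  fun p => (T p.1, p.2 - ln (dmuT T p.1)).

Definition maharam_measure (A : set (X * R)) : \bar R :=
  (\int[mu]_x \int[lebesgue_measure]_y ((\1_A (x, y) : R) * expR y)%:E)%E.

Definition ergodic_III1 (T : X -> X) : Prop :=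
  ergodic mu T /\ ergodic maharam_measure (maharam T).

End Defs.


HB.instance Definition _ {d : measure_display} {X : measurableType d}
  {R : realType} (mu : {measure set X -> \bar R}) :=
  gen_eqMixin (aut2_type mu).
HB.instance Definition _ {d : measure_display} {X : measurableType d}
  {R : realType} (mu : {measure set X -> \bar R}) :=
  gen_choiceMixin (aut2_type mu).

(** Aut_2 with the d_2 topology: the initial topology making
    T |-> <U_T f, g> (f, g in L^2) and T |-> sqrt(T') - 1 in L^2 continuous. *)
Definition aut2_top {d : measure_display} {X : measurableType d}
  {R : realType} (mu : {measure set X -> \bar R}) :=
  initial_topology (fun T : aut2_type mu => d2_map mu (sval T)).

HB.instance Definition _ {d : measure_display} {X : measurableType d}
  {R : realType} (mu : {measure set X -> \bar R}) :=
  Topological.on (aut2_top mu).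

Definition Erg_III1_2 {d : measure_display} {X : measurableType d}
  {R : realType} (mu : {measure set X -> \bar R}) : set (aut2_top mu) :=
  [set T | ergodic_III1 mu (sval T)].

(* Main.v *)
(* The G_delta part. [T] is ergodic of type III_1 iff its Maharam extension [S] is
   ergodic for [m = mu \x e^t dt]. An invertible measure preserving [S] is
   ergodic iff every balanced difference [m B * 1_A - m A * 1_B], with [A] and [B]
   in a countable pi-system of rectangles, is an L1-limit of coboundaries (when
   [S] is ergodic, a filling scheme moves the mass of the first term onto the
   second along the orbits). For fixed rectangles and precision, this is an open
   condition on [T] in the topology d_2.

   Density. The transformation [T0] is approximated by a tower over an odometer
   of type III_1: the first [N] levels are copies of [X] scaled by [1/N], and going
   up one level is applying [T0]; above them, spacers interpolate so slowly between
   the density of the level [N-1] and the one required by the return to the base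
   that the L2-cost of their derivatives is at most [eps]. Invariant sets of the
   Maharam extension of the tower come from those of the odometer, hence are
   trivial. The tower is then identified with [X] by an isomorphism respecting a
   countable partition, finer than the level sets of step functions close to the
   finitely many test functions of a d_2-neighbourhood of [T0]; the spacers go into
   a cell of infinite measure on which these step functions vanish. *)
Require Import Defs.
From HB Require Import structures.
From mathcomp Require Import all_boot all_order all_algebra.
From mathcomp Require Import all_classical all_reals all_analysis measurable_realfun borel_hierarchy.
From mathcomp Require Import ring lra zify.
Import Order.TTheory GRing.Theory Num.Theory.
Import numFieldNormedType.Exports.
Set Implicit Arguments. Unset Strict Implicit. Unset Printing Implicit Defensive.
Local Open Scope classical_set_scope.
Local Open Scope ring_scope.

(** * Change of variables and densities *)

Import HBNNSimple.

(** Openness. The inverse of the Maharam extension pulls back the product of [A] and a left ray to a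
    set whose fibre over [x] is a left ray, of mass proportional to the square of [U_T 1_A] at [x].
    All [U_T] are isometries, so their weak convergence is strong on [1_A], and these sets vary
    continuously in measure. The extensions preserve one and the same measure, so the continuity
    passes to L1 functions.

    The odometer. Its digits have weights 1/6, 1/3 and 1/2, so that its derivatives involve the
    ratios 2 and 3, and ln 2 and ln 3 generate a dense subgroup of the reals. Read on the three
    cylinders, an invariant set reproduces one and the same invariant set; its proportion in boxes
    is then harmonic for steps 0, ln 2 and ln 3, and a bounded harmonic function of this kind is
    constant.

    The tower. Only one of the first [N] levels, the base, is not entered through [T0], an error of
    order 1/N. Since the spacers are the preimages of the base, and the label [0] kills the test
    functions there, the matrix coefficients of [T0] are reproduced up to the factor [1 - 1/N]. *)

Section integral_nnsfun_comp.
Context d1 d2 (X : measurableType d1) (Y : measurableType d2) (R : realType).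
Variable mu : {measure set X -> \bar R}.
Local Open Scope ereal_scope.

Lemma integral_nnsfun_comp (f : X -> Y) (w : X -> R) (g : {nnsfun Y >-> R}) :
  measurable_fun setT f -> measurable_fun setT w -> (forall x, 0 <= w x)%R ->
  \int[mu]_x ((g (f x))%:E * (w x)%:E) =
  \sum_(r \in range g) r%:E * \int[mu]_(x in f @^-1` (g @^-1` [set r])) (w x)%:E.
Proof.
move=> mf mw w0.
have mfr r : measurable (f @^-1` (g @^-1` [set r])).
  by rewrite -[X in measurable X]setTI; apply: mf => //.
have gE x : (g (f x))%:E * (w x)%:E =
    \sum_(r \in range g) ((r * \1_(g @^-1` [set r]) (f x))%:E * (w x)%:E).
  rewrite {1}fimfunE -fsumEFin// ge0_mule_fsuml// => r.
  by rewrite nnfun_muleindic_ge0.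
under eq_integral do rewrite gE.
rewrite ge0_integral_fsum//; last 2 first.
- move=> r; apply: emeasurable_funM; last exact/measurable_EFinP.
  apply/measurable_EFinP/measurable_funM => //; apply: measurableT_comp => //.
- move=> r x _; apply: mule_ge0; last by rewrite lee_fin.
  by rewrite EFinM nnfun_muleindic_ge0.
apply: eq_fsbigr => r /[!inE] -[y _ <-].
under eq_integral do rewrite EFinM -muleA.
rewrite ge0_integralZl//; last 3 first.
- apply: emeasurable_funM; last exact/measurable_EFinP.
  by apply/measurable_EFinP; apply: measurableT_comp => //.
- by move=> x _; rewrite mule_ge0// lee_fin.
- by rewrite lee_fin.
congr (_ * _); rewrite [RHS]integral_mkcond; apply: eq_integral => x _.
rewrite patchE indicE; case: ifPn; rewrite /= ?inE => h.
  by rewrite mem_set ?mul1e.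
by rewrite memNset ?mul0e//; apply: contraNnot h => h; rewrite inE.
Qed.

End integral_nnsfun_comp.

Section change_of_variables.
Context d1 d2 (X : measurableType d1) (Y : measurableType d2) (R : realType).
Variable mu : {measure set X -> \bar R}.
Variable nu : {measure set Y -> \bar R}.
Local Open Scope ereal_scope.

(** With a weight on each side, one statement serves for densities ([f] the identity), for
    Radon-Nikodym derivatives ([w = 1]) and for measure preserving maps ([w = v = 1]). It is checked
    on simple functions and passes to monotone limits. *)
Lemma ge0_change_of_variables (f : X -> Y) (w : X -> R) (v : Y -> R)
    (h : Y -> \bar R) :
  measurable_fun setT f ->
  measurable_fun setT w -> (forall x, 0 <= w x)%R ->
  measurable_fun setT v -> (forall y, 0 <= v y)%R ->
  (forall A, measurable A ->
    \int[mu]_(x in f @^-1` A) (w x)%:E = \int[nu]_(y in A) (v y)%:E) ->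
  measurable_fun setT h -> (forall y, 0 <= h y) ->
  \int[mu]_x (h (f x) * (w x)%:E) = \int[nu]_y (h y * (v y)%:E).
Proof.
move=> mf mw w0 mv v0 fwv mh h0.
pose g := nnsfun_approx measurableT mh.
have gh y : EFin (g n y) @[n --> \oo] --> h y by exact: cvg_nnsfun_approx.
have nd_g y : {homo (fun n => (g n y)%:E) : m n / (m <= n)%N >-> m <= n}.
  by move=> m n mn; rewrite lee_fin; exact/lefP/nd_nnsfun_approx.
have mono d (T : measurableType d) (m : {measure set T -> \bar R}) (F : T -> Y)
    (W : T -> R) : measurable_fun setT F -> measurable_fun setT W ->
    (forall x, 0 <= W x)%R ->
    \int[m]_x (h (F x) * (W x)%:E) =
    limn (fun n => \int[m]_x ((g n (F x))%:E * (W x)%:E)).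
  move=> mF mW W0; rewrite -monotone_convergence//.
  - apply: eq_integral => x _; apply/esym/cvg_lim => //.
    apply: cvgeZr => //; exact: gh.
  - move=> n; apply: emeasurable_funM; last exact/measurable_EFinP.
    by apply/measurable_EFinP; apply: measurableT_comp => //.
  - by move=> n x _; rewrite mule_ge0// lee_fin.
  - by move=> x _ m' n mn; rewrite lee_wpmul2r// ?lee_fin//; exact: nd_g.
rewrite mono// (mono _ _ _ id)//; congr (limn _); apply/funext => n.
rewrite integral_nnsfun_comp//.
transitivity (\int[nu]_x ((g n (idfun x))%:E * (v x)%:E)); last by [].
rewrite !integral_nnsfun_comp//; last exact: measurable_id.
by apply: eq_fsbigr => r _; rewrite fwv.
Qed.

Lemma measurable_preimage (f : X -> Y) (A : set Y) :
  measurable_fun setT f -> measurable A -> measurable (f @^-1` A).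
Proof. by move=> mf mA; rewrite -[X in measurable X]setTI; exact: mf. Qed.

End change_of_variables.

Section with_density.
Context d (T : measurableType d) (R : realType).
Variables (mu : {measure set T -> \bar R}) (w : T -> R).
Hypotheses (mw : measurable_fun setT w) (w0 : forall x, 0 <= w x).
Local Open Scope ereal_scope.

(** The proofs are arguments so that the measure structure declared below can be inferred from the
    term. *)
Definition with_density of measurable_fun setT w & (forall x, 0 <= w x)%R :=
  fun A : set T => \int[mu]_(x in A) (w x)%:E.
Local Notation wmu := (with_density mw w0).

Let with_density0 : wmu set0 = 0. Proof. exact: integral_set0. Qed.

Let with_density_ge0 A : 0 <= wmu A.
Proof. by apply: integral_ge0 => x _; rewrite lee_fin. Qed.

Let with_density_sigma_additive : semi_sigma_additive wmu.
Proof.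
move=> F mF tF mUF; rewrite /with_density ge0_integral_bigcup//.
- by apply: is_cvg_ereal_nneg_natsum_cond => n _ _; exact: with_density_ge0.
- exact/measurable_EFinP/measurable_funTS.
- by move=> x _; rewrite lee_fin.
Qed.

HB.instance Definition _ := isMeasure.Build _ _ _ wmu
  with_density0 with_density_ge0 with_density_sigma_additive.

Lemma ge0_integral_with_density (h : T -> \bar R) :
  measurable_fun setT h -> (forall x, 0 <= h x) ->
  \int[wmu]_x h x = \int[mu]_x (h x * (w x)%:E).
Proof.
move=> mh h0; rewrite -(@ge0_change_of_variables _ _ _ _ _ wmu mu id (cst 1%R) w h)//.
- by apply: eq_integral => x _; rewrite mule1.
- by move=> A mA; rewrite preimage_id (integral_cst _ _ 1)// mul1e.
Qed.

End with_density.

Section amgm.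
Context d (T : measurableType d) (R : realType).
Variable mu : {measure set T -> \bar R}.
Local Open Scope ereal_scope.

(** A Cauchy-Schwarz inequality with a free weight: [c] is chosen at each use to balance the two
    terms. *)
Lemma integral_norm_mul_le (f g : T -> R) (c : R) :
  measurable_fun setT f -> measurable_fun setT g -> (0 < c)%R ->
  \int[mu]_x `|f x * g x|%:E <=
  (c / 2)%:E * \int[mu]_x (f x ^+ 2)%:E + (c^-1 / 2)%:E * \int[mu]_x (g x ^+ 2)%:E.
Proof.
move=> mf mg c0.
have mf2 : measurable_fun setT (fun x => (f x ^+ 2)%:E).
  by apply/measurable_EFinP; exact: measurable_funX.
have mg2 : measurable_fun setT (fun x => (g x ^+ 2)%:E).
  by apply/measurable_EFinP; exact: measurable_funX.
have c2 : (0 <= c / 2)%R by rewrite divr_ge0// ltW.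
have c2' : (0 <= c^-1 / 2)%R by rewrite divr_ge0// invr_ge0 ltW.
rewrite -!ge0_integralZl//; [|by move=> x _; rewrite lee_fin sqr_ge0..].
rewrite -ge0_integralD//; last 4 first.
- by move=> x _; rewrite mule_ge0// lee_fin// sqr_ge0.
- exact: emeasurable_funM.
- by move=> x _; rewrite mule_ge0// lee_fin// sqr_ge0.
- exact: emeasurable_funM.
apply: ge0_le_integral => //.
- by apply/measurable_EFinP/measurableT_comp => //; exact: measurable_funM.
- by apply: emeasurable_funD; exact: emeasurable_funM.
move=> x _; rewrite -!EFinM -EFinD lee_fin normrM.
have cn0 : c != 0%R by rewrite gt_eqF.
have := sqr_ge0 (c * `|f x| - `|g x|)%R.
rewrite -(real_normK (num_real (f x))) -(real_normK (num_real (g x))).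
set a := `|f x|%R; set b := `|g x|%R => h.
have -> : (c / 2 * a ^+ 2 + c^-1 / 2 * b ^+ 2 = a * b + c^-1 / 2 * (c * a - b) ^+ 2)%R.
  by field.
by rewrite lerDl mulr_ge0.
Qed.

Lemma integral_sqrD_le (f g : T -> R) :
  measurable_fun setT f -> measurable_fun setT g ->
  \int[mu]_x ((f x + g x) ^+ 2)%:E <=
  2%:E * \int[mu]_x (f x ^+ 2)%:E + 2%:E * \int[mu]_x (g x ^+ 2)%:E.
Proof.
move=> mf mg.
have mf2 : measurable_fun setT (fun x => (f x ^+ 2)%:E).
  by apply/measurable_EFinP; exact: measurable_funX.
have mg2 : measurable_fun setT (fun x => (g x ^+ 2)%:E).
  by apply/measurable_EFinP; exact: measurable_funX.
rewrite -!ge0_integralZl//; [|by move=> x _; rewrite lee_fin sqr_ge0..].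
rewrite -ge0_integralD//; last 4 first.
- by move=> x _; rewrite mule_ge0// lee_fin// sqr_ge0.
- exact: emeasurable_funM.
- by move=> x _; rewrite mule_ge0// lee_fin// sqr_ge0.
- exact: emeasurable_funM.
apply: ge0_le_integral => //.
- by move=> x _; rewrite lee_fin sqr_ge0.
- by apply/measurable_EFinP; apply: measurable_funX; exact: measurable_funD.
- by apply: emeasurable_funD; exact: emeasurable_funM.
move=> x _; rewrite -!EFinM -EFinD lee_fin.
have := sqr_ge0 (f x - g x)%R; set a := f x; set b := g x; nra.
Qed.

End amgm.

Section density_uniqueness.
Context d (T : measurableType d) (R : realType).
Variable mu : {sigma_finite_measure set T -> \bar R}.
Local Open Scope ereal_scope.

Lemma sigma_finite_nd : exists W : (set T)^nat,
  [/\ forall n, measurable (W n), forall n, mu (W n) < +oo,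
      nondecreasing_seq W & \bigcup_n W n = setT].
Proof.
have /sigma_finiteP[F [FT ndF F1]] := sigma_finiteT mu.
by exists F; split => // n; have [] := F1 n.
Qed.

(** On [D n], of finite measure and where [v] is at most [n], the density [v] is integrable, so
    uniqueness applies there; the sets [D n] exhaust the space. *)
Lemma ae_eq_density (v w : T -> R) :
  measurable_fun setT v -> measurable_fun setT w ->
  (forall x, 0 <= v x)%R -> (forall x, 0 <= w x)%R ->
  (forall A, measurable A -> \int[mu]_(x in A) (v x)%:E = \int[mu]_(x in A) (w x)%:E) ->
  {ae mu, forall x, v x = w x}.
Proof.
move=> mv mw v0 w0 vw.
have [W [mW Wfin ndW WT]] := sigma_finite_nd.
pose D n := W n `&` [set x | v x <= n%:R]%R.
have mD n : measurable (D n).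
  apply: measurableI => //; rewrite -[X in measurable X]setTI.
  exact: measurable_fun_le.
have aeD n : ae_eq mu (D n) (EFin \o v) (EFin \o w).
  apply: integral_ae_eq => //.
  - apply: (@measurable_bounded_integrable) => //.
    + by rewrite (le_lt_trans _ (Wfin n))// le_measure ?inE//; exact: subIsetl.
    + exact: measurable_funTS.
    + exists n%:R; split => // M nM x [_ /= vn].
      by rewrite ger0_norm// (le_trans vn)// ltW.
  - exact/measurable_EFinP/measurable_funTS.
  - by move=> E _ mE; exact: vw.
have : {ae mu, forall x, forall n, D n x -> (EFin \o v) x = (EFin \o w) x}.
  by apply: ae_foralln => n; exact: aeD.
apply: filterS => x h.
have [n _ Wx] : (\bigcup_n W n) x by rewrite WT.
pose m := maxn n (Num.truncn (v x)).+1.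
have /h : D m x.
  split.
    by move: (ndW n m (leq_maxl _ _)) => /subsetPset; apply.
  rewrite /= (@le_trans _ _ (Num.truncn (v x)).+1%:R)//.
    by rewrite ltW// truncnS_gt.
  by rewrite ler_nat leq_maxr.
by move=> -[].
Qed.

End density_uniqueness.

(** * Nonsingular maps and their Maharam extensions *)

Section real_measurability.
Context d (T : measurableType d) (R : realType).

Lemma measurable_fun_sqrt (f : T -> R) :
  measurable_fun setT f -> measurable_fun setT (fun x => Num.sqrt (f x)).
Proof.
move=> mf; apply: (@measurableT_comp _ _ _ _ _ _ (@Num.sqrt R)) => //.
by apply: nondecreasing_measurable => // x y *; apply: ler_wsqrtr.
Qed.

Lemma measurable_fun_inv (f : T -> R) : (forall x, 0 <= f x) ->
  measurable_fun setT f -> measurable_fun setT (fun x => (f x)^-1).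
Proof.
move=> f0 mf; rewrite (_ : (fun _ => _) = (fun x => powR (f x) (-1))).
  exact: measurableT_comp (measurable_powR _) mf.
by apply/funext => x; rewrite powR_inv1.
Qed.

End real_measurability.

Section canonical_lebesgue.
Variable R : realType.
Local Open Scope ereal_scope.

(* [lebesgue_measure] lives on [measurableTypeR R], whose display differs from
   that of the canonical structure on [R] used in products. *)
Definition leb : set R -> \bar R := @lebesgue_measure R.

Let leb0 : leb set0 = 0. Proof. exact: measure0. Qed.
Let leb_ge0 A : 0 <= leb A. Proof. exact: measure_ge0. Qed.
Let leb_sigma_additive : semi_sigma_additive leb.
Proof. exact: (@measure_semi_sigma_additive _ _ _ (@lebesgue_measure R)). Qed.
HB.instance Definition _ :=
  isMeasure.Build _ _ _ leb leb0 leb_ge0 leb_sigma_additive.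

Let leb_sigma_finite : sigma_finite setT leb.
Proof. exact: (sigma_finiteT (@lebesgue_measure R)). Qed.
HB.instance Definition _ := @Measure_isSigmaFinite.Build _ _ _ leb leb_sigma_finite.

Lemma ge0_integral_leb (h : R -> \bar R) :
  measurable_fun setT h -> (forall x, 0 <= h x) ->
  \int[leb]_x h x = \int[@lebesgue_measure R]_x h x.
Proof.
move=> mh h0.
have E : forall A : set (measurableTypeR R), measurable A ->
    \int[leb]_(x in (id : R -> measurableTypeR R) @^-1` A) (1%R)%:E =
    \int[@lebesgue_measure R]_(y in A) (1%R)%:E.
  by move=> A mA; rewrite (integral_cst _ _ 1)// (integral_cst _ _ 1)// mul1e.
have := @ge0_change_of_variables _ _ _ _ _ leb (@lebesgue_measure R) id (cst 1%R)
  (cst 1%R) h (@measurable_id _ _ _) (measurable_cst _) (fun=> ler01) (measurable_cst _) (fun=> ler01) E mh h0.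
rewrite (eq_integral _ _ (fun x _ => mule1 (h x))).
by move=> ->; apply: eq_integral => x _; rewrite mule1.
Qed.

Lemma lebesgue_measure_affine (a b : R) (A : set R) : (0 < a)%R -> measurable A ->
  leb A = a%:E * leb ((fun x => a * x + b)%R @^-1` A).
Proof.
move=> a0 mA.
have mf : measurable_fun setT ((fun x : R => a * x + b)%R : measurableTypeR R -> measurableTypeR R).
  have : measurable_fun setT (fun x : R => a * x + b)%R.
    by apply: measurable_funD => //; exact: measurable_funM.
  by [].
pose f : {mfun measurableTypeR R >-> measurableTypeR R} :=
  HB.pack (fun x : R => a * x + b)%R (isMeasurableFun.Build _ _ _ _ _ mf).
pose a' : {nonneg R} := NngNum (ltW a0).
pose nu0 : {measure set (measurableTypeR R) -> \bar R} :=
  mscale a' (pushforward (@lebesgue_measure R) f).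
pose nu := nu0 mf.
rewrite (_ : a%:E * _ = nu A)//.
apply: (lebesgue_measure_unique (mu := nu)) => //.
move=> _ [[x y] _ /= <-].
rewrite lebesgue_measure_itv/= /nu0 /mscale/= /pushforward/=.
rewrite [X in lebesgue_measure X](_ : _ = `]((x - b) / a)%R, ((y - b) / a)%R]%classic); last first.
  apply/seteqP; split=> z /=; rewrite !in_itv/=.
    by rewrite ltr_pdivrMr// ler_pdivlMr// (mulrC z) ltrBlDr lerBrDr.
  by rewrite ltr_pdivrMr// ler_pdivlMr// (mulrC z) ltrBlDr lerBrDr.
rewrite lebesgue_measure_itv/= !lte_fin ltr_pM2r ?invr_gt0// ltrD2r.
case: ifPn => _; last by rewrite mule0.
rewrite -!EFinB -EFinM; congr _%:E; field; exact: lt0r_neq0.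
Qed.

Lemma ge0_integral_affine (a b : R) (h : R -> \bar R) : (0 < a)%R ->
  measurable_fun setT h -> (forall x, 0 <= h x) ->
  \int[leb]_x h x = a%:E * \int[leb]_x h (a * x + b)%R.
Proof.
move=> a0 mh h0.
have mf : measurable_fun setT (fun x : R => a * x + b)%R.
  by apply: measurable_funD => //; exact: measurable_funM.
have E : forall A : set R, measurable A ->
    \int[leb]_(x in (fun x => a * x + b)%R @^-1` A) (cst a x)%:E =
    \int[leb]_(y in A) (cst 1%R y)%:E.
  move=> A mA; rewrite (integral_cst _ _ a%:E)//; last exact: measurable_preimage.
  by rewrite (integral_cst _ _ 1)// mul1e [RHS](lebesgue_measure_affine b a0).
have := @ge0_change_of_variables _ _ _ _ _ leb leb (fun x => a * x + b)%R (cst a)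
  (cst 1%R) h mf (measurable_cst _) (fun=> ltW a0) (measurable_cst _) (fun=> ler01) E mh h0.
rewrite [X in _ = X -> _](_ : _ = \int[leb]_x h x); last first.
  by apply: eq_integral => x _; rewrite mule1.
move=> <-; rewrite -ge0_integralZl//.
- by apply: eq_integral => x _; rewrite muleC.
- exact: measurableT_comp.
- by rewrite lee_fin ltW.
Qed.

End canonical_lebesgue.
Arguments leb {R}.

(** * The measure e^t dt on the line *)

Section exp_measure.
Context (R : realType).
Local Open Scope ereal_scope.

Definition exp_measure : set R -> \bar R :=
  @with_density _ R R leb _ (@measurable_expR R) (@expR_ge0 R).
HB.instance Definition _ := Measure.on exp_measure.

(** Left rays have finite mass; this is why all the rectangles used below have left rays as second
    factor. *)
Lemma exp_measureNyc (s : R) : exp_measure `]-oo, s] = (expR s)%:E.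
Proof.
rewrite /exp_measure /with_density integral_mkcond ge0_integral_leb; last 2 first.
- apply/(measurable_restrictT _ _).1 => //.
  by apply/measurable_EFinP; apply: measurable_funTS; exact: measurable_expR.
- by move=> x; rewrite patchE; case: ifP => // _; rewrite lee_fin expR_ge0.
rewrite -integral_mkcond -[s]opprK ge0_integration_by_substitutionNy; last 2 first.
- exact/continuous_subspaceT/continuous_expR.
- by move=> x _; exact: expR_ge0.
rewrite (@ge0_continuous_FTC2y _ _ (fun x => - expR (- x))%R _ 0%R).
- by rewrite opprK -EFinB sub0r opprK.
- by move=> x _; exact: expR_ge0.
- apply/continuous_subspaceT => x; apply: continuous_comp; first exact: continuousN.
  exact: continuous_expR.
- rewrite -oppr0; apply: cvgN; exact: cvgr_expR.
- by move=> x _; exact: ex_derive.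
- apply: cvgN; apply: cvg_at_right_filter; apply: continuous_comp; first exact: continuousN.
  exact: continuous_expR.
- move=> x _; rewrite derive1E derive_val/=.
  by rewrite mulrN1 opprK.
Qed.

Let exp_measure_sigma_finite : sigma_finite setT exp_measure.
Proof.
exists (fun n : nat => `]-oo, n%:R]%classic).
  apply/esym/seteqP; split => // x _; exists (Num.truncn x).+1 => //=.
  by rewrite in_itv/= ltW// truncnS_gt.
by move=> n; split => //; rewrite exp_measureNyc ltry.
Qed.

HB.instance Definition _ :=
  @Measure_isSigmaFinite.Build _ _ _ exp_measure exp_measure_sigma_finite.

Lemma ge0_integral_exp_measure (h : R -> \bar R) :
  measurable_fun setT h -> (forall x, 0 <= h x) ->
  \int[exp_measure]_y h y = \int[leb]_y (h y * (expR y)%:E).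
Proof.
by move=> mh h0; rewrite /exp_measure ge0_integral_with_density.
Qed.

Lemma exp_measure_shift (c : R) (A : set R) : measurable A ->
  exp_measure ((fun y => y - c)%R @^-1` A) = (expR c)%:E * exp_measure A.
Proof.
move=> mA.
have mc : measurable ((fun y : R => y - c)%R @^-1` A).
  by apply: measurable_preimage => //; exact: measurable_funB.
have E (B : set R) : measurable B ->
    exp_measure B = \int[leb]_y (\1_B y * expR y)%:E.
  move=> mB; rewrite -[LHS]mul1e -(integral_cst _ _ 1)//.
  rewrite (integral_mkcond B) ge0_integral_exp_measure.
  - apply: eq_integral => y _; rewrite patchE indicE.
    by case: ifP; rewrite ?mul1e ?mul1r ?mul0e ?mul0r.
  - apply/(measurable_restrictT _ _).1 => //.
  - by move=> y; rewrite patchE; case: ifP => // _; rewrite lee_fin.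
have mI (B : set R) : measurable B ->
    measurable_fun setT (fun y : R => (\1_B y * expR y)%:E).
  by move=> mB; apply/measurable_EFinP/measurable_funM.
rewrite !E// (ge0_integral_affine c ltr01 (mI _ mc)); last first.
  by move=> x; rewrite lee_fin mulr_ge0// expR_ge0.
have p0 : forall y : R, setT y -> 0 <= (\1_A y * expR y)%:E.
  by move=> y _; rewrite lee_fin mulr_ge0// expR_ge0.
have c0 : 0 <= (expR c)%:E by rewrite lee_fin expR_ge0.
rewrite mul1e -(ge0_integralZl _ measurableT (mI _ mA) p0 c0).
apply: eq_integral => y _; rewrite mul1r expRD !indicE.
rewrite (_ : (y + c)%R \in _ = (y \in A)).
  by rewrite -EFinM mulrA mulrC.
by apply/idP/idP; rewrite !inE/= addrK.
Qed.

End exp_measure.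
Arguments exp_measure {R}.

Section aut2.
Context d (X : measurableType d) (R : realType).
Variable mu : {sigma_finite_measure set X -> \bar R}.
Hypothesis muT : mu setT = +oo%E.
Local Open Scope ereal_scope.

Lemma inv_mapP (T : X -> X) : nonsingular_inv mu T ->
  [/\ cancel T (inv_map T), cancel (inv_map T) T, measurable_fun setT T &
      measurable_fun setT (inv_map T)].
Proof.
move=> [S [TS ST mT mS _]].
have [ST' TS'] : cancel T (inv_map T) /\ cancel (inv_map T) T.
  by rewrite /inv_map; case: xgetP => [y ->//|/(_ S)]; case.
split => //; rewrite (_ : inv_map T = S)//.
by apply/funext => x; rewrite -[RHS]ST' ST.
Qed.

(** If there were no derivative, [Tprime] would be the default value [0], and [sqrt 0 - 1 = -1] is
    not square integrable for an infinite measure. Membership in [Aut2] thus forces the derivative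
    to exist. *)
Lemma Tprime_RN (T : X -> X) : Aut2 mu T ->
  is_RN mu (fun A => mu (T @^-1` A)) (Tprime mu T).
Proof.
move=> [_ [_]]; rewrite /Tprime /RNderiv; case: xgetP => [y ->//|_].
under eq_integral do rewrite sqrtr0 sub0r sqrrN expr1n.
by rewrite (integral_cst _ _ 1)// mul1e [X in X < _]muT ltxx.
Qed.

Lemma Tprime_ge0 (T : X -> X) : Aut2 mu T -> forall x, (0 <= Tprime mu T x)%R.
Proof. by move=> /Tprime_RN []. Qed.

Lemma measurable_Tprime (T : X -> X) : Aut2 mu T -> measurable_fun setT (Tprime mu T).
Proof. by move=> /Tprime_RN []. Qed.

Lemma ge0_integral_comp_Tprime (T : X -> X) (h : X -> \bar R) : Aut2 mu T ->
  measurable_fun setT h -> (forall x, 0 <= h x) ->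
  \int[mu]_x h (T x) = \int[mu]_x (h x * (Tprime mu T x)%:E).
Proof.
move=> aT mh h0; have [_ _ mT _] := inv_mapP aT.1; have [mT' T'0 T'E] := Tprime_RN aT.
rewrite -(@ge0_change_of_variables _ _ _ _ _ mu mu T (cst 1%R) _ h)//.
  by apply: eq_integral => x _; rewrite mule1.
move=> A mA; rewrite -T'E// (integral_cst _ _ 1) ?mul1e//.
exact: measurable_preimage.
Qed.

Lemma Tprime_gt0 (T : X -> X) : Aut2 mu T -> {ae mu, forall x, (0 < Tprime mu T x)%R}.
Proof.
move=> aT; have [mT' T'0 T'E] := Tprime_RN aT.
have mZ : measurable [set x | Tprime mu T x = 0%R].
  rewrite [X in measurable X](_ : _ = Tprime mu T @^-1` [set 0%R])//.
  exact: measurable_preimage.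
have Z0 : mu [set x | Tprime mu T x = 0%R] = 0.
  have [S [_ _ _ _ nsT]] := aT.1; apply: (nsT _ mZ).1; apply: etrans (T'E _ mZ) _.
  by apply: integral0_eq => x /= ->.
exists [set x | Tprime mu T x = 0%R]; split => // x /= /negP.
by rewrite -leNgt => T'x; apply/eqP; rewrite eq_le T'x T'0.
Qed.

(** This expresses the cocycle of the Maharam extension through [Tprime], the quantity that the
    topology controls. It holds by the change of variables along [T], as [Tprime] is positive almost
    everywhere. *)
Lemma dmuT_RN (T : X -> X) : Aut2 mu T ->
  is_RN mu (fun A => mu (T @` A)) (fun x => (Tprime mu T (T x))^-1)%R.
Proof.
move=> aT; have [TS ST mT mS] := inv_mapP aT.1; have [mT' T'0 T'E] := Tprime_RN aT.
split.
- apply: measurable_fun_inv => //; exact: measurableT_comp.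
- by move=> x; rewrite invr_ge0.
move=> A mA; rewrite (_ : T @` A = inv_map T @^-1` A); last first.
  by apply/seteqP; split => [_ [x Ax <-]/=|y/= Ay]; [rewrite TS|exists (inv_map T y)].
have mSA : measurable (inv_map T @^-1` A) by exact: measurable_preimage.
pose h z := (\1_(inv_map T @^-1` A) z * (Tprime mu T z)^-1)%:E.
transitivity (\int[mu]_x h (T x)); last first.
  rewrite [RHS]integral_mkcond; apply: eq_integral => x _.
  rewrite /h patchE indicE; case: ifPn => xA.
    by rewrite mem_set ?mul1r//= TS; rewrite inE in xA.
  by rewrite memNset ?mul0r//= TS; move: xA; rewrite notin_setE.
have mh : measurable_fun setT h.
  apply/measurable_EFinP/measurable_funM => //; exact: measurable_fun_inv.
rewrite ge0_integral_comp_Tprime//; last first.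
  by move=> x; rewrite lee_fin mulr_ge0// invr_ge0.
rewrite -[LHS]mul1e -(integral_cst _ _ 1)// integral_mkcond.
apply: ae_eq_integral => //.
- exact/(measurable_restrictT _ _).1.
- by apply: emeasurable_funM => //; exact/measurable_EFinP.
move: (Tprime_gt0 aT); apply: filterS => x T'x _.
rewrite patchE /h indicE; case: ifPn => _; last by rewrite mul0r mul0e.
by rewrite mul1r -EFinM mulVf// gt_eqF.
Qed.

Lemma dmuT_is_RN (T : X -> X) : Aut2 mu T ->
  is_RN mu (fun A => mu (T @` A)) (dmuT mu T).
Proof.
move=> /dmuT_RN RNT; rewrite /dmuT /RNderiv; case: xgetP => [y ->//|].
by move=> /(_ _ RNT).
Qed.

Lemma dmuTE (T : X -> X) : Aut2 mu T ->
  {ae mu, forall x, dmuT mu T x = (Tprime mu T (T x))^-1}%R.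
Proof.
move=> aT; have [m1 p1 e1] := dmuT_is_RN aT; have [m2 p2 e2] := dmuT_RN aT.
by apply: ae_eq_density => // A mA; rewrite -e1// -e2.
Qed.

Lemma ae_comp_nonsingular (T : X -> X) (P : X -> Prop) : nonsingular_inv mu T ->
  {ae mu, forall x, P x} -> {ae mu, forall x, P (T x)}.
Proof.
move=> [S [_ _ mT _ nsT]] [N [mN N0 PN]]; exists (T @^-1` N); split.
- exact: measurable_preimage.
- exact/nsT.
- by move=> x /= nP; apply: PN.
Qed.

Lemma dmuT_gt0 (T : X -> X) : Aut2 mu T -> {ae mu, forall x, (0 < dmuT mu T x)%R}.
Proof.
move=> aT; have := ae_comp_nonsingular aT.1 (Tprime_gt0 aT).
by apply: filterS2 (dmuTE aT) => x ->; rewrite invr_gt0.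
Qed.

End aut2.

Section maharam.
Context d (X : measurableType d) (R : realType).
Variable mu : {sigma_finite_measure set X -> \bar R}.
Hypothesis muT : mu setT = +oo%E.
Local Open Scope ereal_scope.
Notation m := (mu \x (@exp_measure R)).

Lemma maharam_measureE (A : set (X * R)) : measurable A ->
  maharam_measure mu A = m A.
Proof.
move=> mA; rewrite /maharam_measure /product_measure1; apply: eq_integral => x _.
have mxA : measurable (xsection A x) by exact: measurable_xsection.
rewrite /= /exp_measure /with_density [RHS]integral_mkcond ge0_integral_leb.
- apply: eq_integral => y _; rewrite patchE mem_xsection indicE.
  by case: ifP => _; rewrite ?mul1r ?mul0r.
- apply/(measurable_restrictT _ _).1 => //.
  by apply/measurable_EFinP; exact: measurable_funTS.
- by move=> y; rewrite patchE; case: ifP => // _; rewrite lee_fin expR_ge0.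
Qed.

Definition maharam_inv (T : X -> X) : X * R -> X * R :=
  fun p => (inv_map T p.1, p.2 + ln (dmuT mu T (inv_map T p.1)))%R.

Lemma maharamK (T : X -> X) : nonsingular_inv mu T ->
  cancel (maharam mu T) (maharam_inv T).
Proof. by move=> /inv_mapP[TS ST _ _] [x y]; rewrite /maharam_inv /maharam/= TS subrK. Qed.

Lemma maharam_invK (T : X -> X) : nonsingular_inv mu T ->
  cancel (maharam_inv T) (maharam mu T).
Proof. by move=> /inv_mapP[TS ST _ _] [x y]; rewrite /maharam_inv /maharam/= ST addrK. Qed.

Lemma measurable_maharam (T : X -> X) : Aut2 mu T -> measurable_fun setT (maharam mu T).
Proof.
move=> aT; have [_ _ mT _] := inv_mapP aT.1; have [mD _ _] := dmuT_is_RN muT aT.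
apply: measurable_fun_pair; first exact: measurableT_comp.
apply: measurable_funB => //; apply: measurableT_comp (@measurable_ln R) _.
exact: measurableT_comp.
Qed.

Lemma measurable_maharam_inv (T : X -> X) : Aut2 mu T ->
  measurable_fun setT (maharam_inv T).
Proof.
move=> aT; have [_ _ mT mS] := inv_mapP aT.1; have [mD _ _] := dmuT_is_RN muT aT.
apply: measurable_fun_pair; first exact: measurableT_comp.
apply: measurable_funD => //; apply: measurableT_comp (@measurable_ln R) _.
apply: (measurableT_comp mD); exact: measurableT_comp.
Qed.

(** By uniqueness of product measures, rectangles suffice. Over [x] the fibre is translated by
    [ln (dmuT mu T x)], which multiplies its mass by [dmuT mu T x]; integrated over the preimage of
    [B], this density gives [mu B]. *)
Lemma maharam_preserves (T : X -> X) (A : set (X * R)) : Aut2 mu T -> measurable A ->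
  m (maharam mu T @^-1` A) = m A.
Proof.
move=> aT mA; have [TS ST mT mS] := inv_mapP aT.1; have [mD D0 DE] := dmuT_is_RN muT aT.
pose f : {mfun (X * R)%type >-> (X * R)%type} :=
  HB.pack (maharam mu T) (isMeasurableFun.Build _ _ _ _ _ (measurable_maharam aT)).
pose nu0 : {measure set (X * R)%type -> \bar R} := pushforward m f.
pose nu := nu0 (measurable_maharam aT).
apply/esym; apply: (@product_measure_unique _ _ _ _ _ mu exp_measure nu _ A mA).
move=> B C mB mC; rewrite /nu/= /nu0/= /pushforward /product_measure1/=.
have DB : mu B = \int[mu]_(x in T @^-1` B) (dmuT mu T x)%:E.
  rewrite -DE; last exact: measurable_preimage.
  by rewrite image_preimage// -subTset => x _; exists (inv_map T x).
rewrite DB muleC -ge0_integralZl//; last 3 first.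
- exact: measurable_preimage.
- by apply/measurable_EFinP; exact: measurable_funTS.
- by move=> x _; rewrite lee_fin.
rewrite [RHS]integral_mkcond; apply: ae_eq_integral => //.
- apply: measurable_fun_xsection; rewrite -[X in measurable X]setTI.
  by apply: (measurable_maharam aT) => //; exact: measurableX.
- apply/(measurable_restrictT _ _).1; first exact: measurable_preimage.
  apply: emeasurable_funM => //; apply/measurable_EFinP; exact: measurable_funTS.
move: (dmuT_gt0 muT aT); apply: filterS => x Dx _; rewrite patchE.
case: ifPn => xB.
  rewrite muleC -[X in X%:E * _](lnK Dx) -exp_measure_shift//; congr exp_measure.
  apply/seteqP; split=> y; rewrite xsectionE//=.
    by case.
  by move=> Cy; split => //; rewrite inE in xB.
rewrite (_ : xsection _ _ = set0) ?measure0//; apply/seteqP; split=> y//.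
by rewrite xsectionE/= => -[Bx _]; move: xB; rewrite notin_setE.
Qed.

End maharam.

(** * Ergodicity and coboundaries *)

Section integrable_closure.
Context d (Y : measurableType d) (R : realType).
Variable m : {measure set Y -> \bar R}.
Local Open Scope ereal_scope.

Lemma integrable_indic_lty (A : set Y) : measurable A -> m A < +oo ->
  m.-integrable setT (EFin \o \1_A).
Proof.
move=> mA Afin; apply/integrableP; split; first exact/measurable_EFinP.
rewrite (eq_integral (fun x => (\1_A x)%:E)); last first.
  by move=> t _; rewrite gee0_abs// lee_fin.
by rewrite integral_indic// setIT.
Qed.

Lemma cvge_near_lt (u : (\bar R)^nat) (l c : \bar R) :
  u n @[n --> \oo] --> l -> l < c -> \forall n \near \oo, u n < c.
Proof. by move=> ul /open_ereal_lt' lc; have := ul _ lc. Qed.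

Lemma integral_indicB_cvg0 (A : set Y) (F : (set Y)^nat) :
  measurable A -> (forall n, measurable (F n)) -> m A < +oo ->
  nondecreasing_seq F -> \bigcup_n F n = A ->
  \int[m]_y `|\1_A y - \1_(F n) y|%:E @[n --> \oo] --> 0.
Proof.
move=> mA mF Afin ndF FA.
have FsA n : F n `<=` A by rewrite -FA; exact: bigcup_sup.
rewrite (_ : (fun n => _) = fun n => m (A `\` F n)); last first.
  apply/funext => n; rewrite -[RHS]mul1e -(integral_cst _ _ 1); last exact: measurableD.
  rewrite [RHS]integral_mkcond; apply: eq_integral => y _.
  rewrite patchE !indicE; have := FsA n y.
  have [yF|yF] := pselect (F n y) => FA'.
    rewrite (mem_set yF) (mem_set (FA' yF)) subrr normr0 ifF//.
    by apply/negbTE; rewrite notin_setE => -[].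
  rewrite (memNset yF) subr0.
  have [yA|yA] := pselect (A y).
    by rewrite (mem_set yA) normr1 ifT// inE.
  rewrite (memNset yA) normr0 ifF//.
  by apply/negbTE; rewrite notin_setE => -[].
have := @nonincreasing_cvg_mu _ _ _ m (fun n => A `\` F n).
rewrite (_ : \bigcap_n (A `\` F n) = set0); last first.
  apply/seteqP; split => // y Dy; have [] := Dy 0%N I.
  rewrite -FA => -[n _ Fny] _; by have [] := Dy n I.
rewrite measure0; apply => //.
- by rewrite (le_lt_trans _ Afin)// le_measure ?inE//; exact: measurableD.
- by move=> n; exact: measurableD.
- by move=> i j ij; rewrite subsetEset; apply: setDS; rewrite -subsetEset; exact: ndF.
Qed.

Variables (G : set (set Y)) (W : (set Y)^nat) (K : set (Y -> R)).
Hypotheses (mG : @measurable _ Y = <<s G >>) (GI : setI_closed G).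
Hypotheses (GW : forall n, G (W n)) (WT : \bigcup_n W n = setT).
Hypotheses (ndW : nondecreasing_seq W) (Wfin : forall n, m (W n) < +oo).
Hypothesis KG : forall A, G A -> K \1_A.
Hypothesis KD : forall f g, K f -> K g -> K (fun y => f y + g y)%R.
Hypothesis KZ : forall c f, K f -> K (fun y => c * f y)%R.
Hypothesis KL : forall f, measurable_fun setT f -> m.-integrable setT (EFin \o f) ->
  (forall e : R, (0 < e)%R -> exists2 g, K g & \int[m]_y `|f y - g y|%:E <= e%:E) ->
  K f.

Let mW n : measurable (W n).
Proof. by rewrite mG; exact: sub_sigma_algebra. Qed.

Let K_increasing (A : set Y) (F : (set Y)^nat) :
  measurable A -> (forall n, measurable (F n)) -> m A < +oo ->
  nondecreasing_seq F -> \bigcup_n F n = A -> (forall n, K \1_(F n)) -> K \1_A.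
Proof.
move=> mA mF Afin ndF FA KF; apply: KL => //.
  exact: integrable_indic_lty.
move=> e e0; have e0' : (0 < e%:E)%E by rewrite lte_fin.
have [N _ /(_ N (leqnn N))/= h] :=
  cvge_near_lt (integral_indicB_cvg0 mA mF Afin ndF FA) e0'.
by exists (\1_(F N)) => //; exact: ltW.
Qed.

Let K0 : K (cst 0%R).
Proof.
have := KZ 0 (KG (GW 0%N)); rewrite [X in K X](_ : _ = cst 0%R)//.
by apply/funext => y; rewrite mul0r.
Qed.

(** Dynkin's lemma is run inside [W n], where the relative complement is a difference of two
    indicators already in [K]. *)
Let K_indicI (A : set Y) n : measurable A -> K \1_(A `&` W n).
Proof.
move=> mA; have : <<s G >> A by rewrite -mG.
apply: (@dynkin_induction _ Y G (fun A => K \1_(A `&` W n))) => //.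
- by rewrite setTI; exact: KG.
- by move=> B GB; apply: KG; exact: GI.
- move=> B mB KB.
  rewrite [X in K X](_ : _ = fun y => \1_(W n) y + (-1) * \1_(B `&` W n) y)%R.
    by apply: KD; [exact: KG|exact: KZ].
  apply/funext => y; rewrite !indicE !in_setI in_setC.
  by case: (y \in B); case: (y \in W n) => /=; lra.
- move=> F mF tF KF; rewrite setI_bigcupl.
  pose H N := \big[setU/set0]_(i < N) (F i `&` W n).
  have mH N : measurable (H N) by apply: bigsetU_measurable => i _; exact: measurableI.
  apply: (@K_increasing _ H) => //.
  + by apply: bigcup_measurable => i _; exact: measurableI.
  + rewrite (le_lt_trans _ (Wfin n))// le_measure ?inE//.
      by apply: bigcup_measurable => i _; exact: measurableI.
    by apply: bigcup_sub => i _; exact: subIsetr.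
  + by move=> i j ij; rewrite subsetEset; exact: (@subset_bigsetU _ (fun i => F i `&` W n)).
  + apply/seteqP; split => [y [N _]|y [i _ Hy]].
      by rewrite /H -(bigcup_mkord N (fun i => F i `&` W n)) => -[i _ Hy]; exists i.
    by exists i.+1 => //; rewrite /H big_ord_recr/=; right.
  + elim=> [|N IH].
      rewrite /H big_ord0 [X in K X](_ : _ = cst 0%R)//.
      by apply/funext => y; rewrite indicE in_set0.
    rewrite [X in K X](_ : _ = fun y => \1_(H N) y + \1_(F N `&` W n) y)%R.
      exact: KD.
    apply/funext => y; rewrite /H big_ord_recr/= -/(H N) !indicE in_setU.
    have : ~ (y \in H N /\ y \in F N `&` W n).
      rewrite !inE /H -(bigcup_mkord N (fun i => F i `&` W n)) => -[[i /= iN [Fi _]] [FN _]].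
      have : (F i `&` F N) !=set0 by exists y.
      by move/(tF i N I I) => E; rewrite E ltnn in iN.
    by case: (y \in H N); case: (y \in F N `&` W n) => //= h; [case: h|rewrite addr0|rewrite add0r|rewrite addr0].
Qed.

Let K_indic (A : set Y) : measurable A -> m A < +oo -> K \1_A.
Proof.
move=> mA Afin; apply: (@K_increasing _ (fun n => A `&` W n)) => //.
- by move=> n; exact: measurableI.
- by move=> i j ij; rewrite subsetEset; apply: setIS; rewrite -subsetEset; exact: ndW.
- by rewrite -setI_bigcupr WT setIT.
- by move=> n; exact: K_indicI.
Qed.

Import HBSimple.

(** An induction principle for integrable functions: from the indicators of a pi-system, through
    linear combinations and L1-limits. It serves to extend continuity from rectangles to L1. *)
Lemma integrable_closure (f : Y -> R) : measurable_fun setT f ->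
  m.-integrable setT (EFin \o f) -> K f.
Proof.
move=> mf fi; have [g [gi _ gf]] := approximation_sfun_integrable measurableT fi.
apply: KL => // e e0.
have e0' : (0 < e%:E)%E by rewrite lte_fin.
have [N _ /(_ N (leqnn N))/= gN] := cvge_near_lt gf e0'.
exists (g N); last first.
  by apply: ltW; rewrite (eq_integral (fun z => `|(f z)%:E - (g N z)%:E|)).
have Kr r : K (fun y => r * \1_(g N @^-1` [set r]) y)%R.
  (* The level set of [0] may have infinite measure; the others have finite measure by
     integrability. *)
  have [->|r0] := eqVneq r 0%R.
    by rewrite [X in K X](_ : _ = cst 0%R)//; apply/funext => y; rewrite mul0r.
  apply: KZ; apply: K_indic => //.
  have /integrableP[_] := gi N; apply: contraTT; rewrite -!leNgt !leye_eq => /eqP roo.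
  rewrite -leye_eq.
  have : `|r|%:E * m (g N @^-1` [set r]) <= \int[m]_x `|(EFin \o g N) x|.
    rewrite -(integral_cst _ _ `|r|%:E)// [leLHS]integral_mkcond.
    apply: ge0_le_integral => //.
    - by move=> y _; rewrite patchE; case: ifP => // _; rewrite lee_fin.
    - exact/(measurable_restrictT _ _).1.
    - by apply: measurableT_comp => //; exact/measurable_EFinP.
    by move=> y _; rewrite patchE; case: ifPn => [/set_mem/= gy|_]; [rewrite /= gy|exact: abse_ge0].
  by rewrite roo gt0_muley// lte_fin normr_gt0.
have := fimfunE (g N) => gE.
pose t : seq R := finmap.enum_fset (fset_set (range (g N))).
rewrite [X in K X](_ : _ = fun y => \sum_(r <- t) (r * \1_(g N @^-1` [set r]) y))%R.
  elim: t => [|r s IH].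
    by rewrite [X in K X](_ : _ = cst 0%R)//; apply/funext => y; rewrite big_nil.
  rewrite [X in K X](_ : _ = fun y => r * \1_(g N @^-1` [set r]) y +
     \sum_(r <- s) (r * \1_(g N @^-1` [set r]) y))%R; first exact: KD.
  by apply/funext => y; rewrite big_cons.
by apply/funext => y; rewrite gE fsbig_finite.
Qed.

End integrable_closure.

(** * Approximate coboundaries imply ergodicity *)

Section coboundary.
Context d (Y : measurableType d) (R : realType).
Variable m : {measure set Y -> \bar R}.
Variables S V : Y -> Y.
Hypotheses (SK : cancel S V) (VK : cancel V S).
Hypotheses (mS : measurable_fun setT S) (mV : measurable_fun setT V).
Hypothesis mpS : forall A, measurable A -> m (S @^-1` A) = m A.
Local Open Scope ereal_scope.

Definition approx_coboundary (f : Y -> R) := forall e : R, (0 < e)%R ->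
  exists g : Y -> R, [/\ measurable_fun setT g, m.-integrable setT (EFin \o g) &
    \int[m]_y `|f y - g y + g (V y)|%:E <= e%:E].

(** A function of integral zero whose integral over an invariant set compares the proportions of
    that set in [A] and in [B]. *)
Definition balanced_indic (A B : set Y) (y : Y) : R :=
  (fine (m B) * \1_A y - fine (m A) * \1_B y)%R.

Let mpV A : measurable A -> m (V @^-1` A) = m A.
Proof.
move=> mA; rewrite -mpS; last exact: measurable_preimage.
by congr (m _); apply/seteqP; split => y /=; rewrite SK.
Qed.

Lemma ge0_integral_preserving (T : Y -> Y) (h : Y -> \bar R) :
  measurable_fun setT T -> (forall A, measurable A -> m (T @^-1` A) = m A) ->
  measurable_fun setT h -> (forall y, 0 <= h y) ->
  \int[m]_y h (T y) = \int[m]_y h y.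
Proof.
move=> mT mpT mh h0.
rewrite -(eq_integral _ _ (fun y _ => mule1 (h y))).
rewrite -(eq_integral _ _ (fun y _ => mule1 (h (T y)))).
apply: (@ge0_change_of_variables _ _ _ _ _ m m T (cst 1%R) (cst 1%R) h) => //.
move=> A mA; rewrite (integral_cst _ _ 1) ?(integral_cst _ _ 1) ?mpT//.
exact: measurable_preimage.
Qed.

Lemma integrable_preserving (T : Y -> Y) (g : Y -> R) :
  measurable_fun setT T -> (forall A, measurable A -> m (T @^-1` A) = m A) ->
  m.-integrable setT (EFin \o g) -> m.-integrable setT (EFin \o (g \o T)).
Proof.
move=> mT mpT /integrableP[mg gi]; apply/integrableP; split.
  exact: (measurableT_comp mg).
rewrite (@ge0_integral_preserving T (fun y => `|(EFin \o g) y|)%E)//.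
exact: measurableT_comp.
Qed.

Lemma integral_preserving (T : Y -> Y) (g : Y -> R) :
  measurable_fun setT T -> (forall A, measurable A -> m (T @^-1` A) = m A) ->
  m.-integrable setT (EFin \o g) -> \int[m]_y (g (T y))%:E = \int[m]_y (g y)%:E.
Proof.
move=> mT mpT /integrableP[mg gi].
rewrite integralE [RHS]integralE; congr (_ - _).
  rewrite -(@ge0_integral_preserving T (EFin \o g)^\+)//.
    by rewrite -[RHS]/(\int[m]_y ((EFin \o g)^\+ \o T) y) -funepos_comp.
  exact: measurable_funepos.
rewrite -(@ge0_integral_preserving T (EFin \o g)^\-)//.
  by rewrite -[RHS]/(\int[m]_y ((EFin \o g)^\- \o T) y) -funeneg_comp.
exact: measurable_funeneg.
Qed.

(** Over an invariant set [g] and [g \o V] have the same integral, so [f] may be replaced by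
    [f - g + g \o V], whose L1 norm is arbitrarily small. *)
Lemma integral_invariant_coboundary (E : set Y) (f : Y -> R) :
  measurable E -> S @^-1` E = E -> measurable_fun setT f ->
  m.-integrable setT (EFin \o f) -> approx_coboundary f ->
  \int[m]_(y in E) (f y)%:E = 0.
Proof.
move=> mE SE mf fi af.
have VE : V @^-1` E = E by rewrite -{1}SE; apply/seteqP; split => y /=; rewrite VK.
apply/eqP; rewrite -abse_eq0 eq_le abse_ge0 andbT; apply/lee_addgt0Pr => e e0.
rewrite add0e; have [g [mg gi ge]] := af _ e0.
apply: le_trans ge.
have fiE : m.-integrable E (EFin \o f) by apply: integrableS fi.
have giE : m.-integrable E (EFin \o g) by apply: integrableS gi.
have gVi := integrable_preserving mV mpV gi.
have gViE : m.-integrable E (EFin \o (g \o V)) by apply: integrableS gVi.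
have gE : \int[m]_(y in E) (g (V y))%:E = \int[m]_(y in E) (g y)%:E.
  rewrite !(integral_mkcond E).
  rewrite (eq_integral (fun y => ((g \_ E) (V y))%:E)); last first.
    move=> y _; rewrite !patchE [in RHS](_ : (V y \in E) = (y \in E)).
      by case: ifP.
    by rewrite -{2}VE; apply/idP/idP; rewrite !inE.
  rewrite (@integral_preserving V (g \_ E))//.
    by apply: eq_integral => y _; rewrite !patchE; case: ifP.
  rewrite (_ : EFin \o _ = (EFin \o g) \_ E); first exact: (integrable_mkcond (EFin \o g) mE).1.
  by apply/funext => y; rewrite /= !patchE; case: ifP.
have -> : \int[m]_(y in E) (f y)%:E =
    \int[m]_(y in E) (f y - g y + g (V y))%:E.
  rewrite [RHS](eq_integral (fun y => ((EFin \o f) \- (EFin \o g)) y + (EFin \o (g \o V)) y))//.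
  rewrite integralD//; last exact: integrableB.
  rewrite integralB// [X in _ + X]gE subeK//.
  exact: integrable_fin_num.
apply: le_trans (le_abse_integral _ _ _) _ => //.
  apply/measurable_EFinP/measurable_funTS/measurable_funD.
    exact: measurable_funB.
  exact: measurableT_comp.
apply: ge0_subset_integral => //.
by apply: measurableT_comp => //; apply/measurable_EFinP/measurable_funD;
  [exact: measurable_funB|exact: measurableT_comp].
Qed.

Lemma integrable_balanced_indic (A B : set Y) : measurable A -> measurable B ->
  m A < +oo -> m B < +oo ->
  measurable_fun setT (balanced_indic A B) /\
  m.-integrable setT (EFin \o balanced_indic A B).
Proof.
move=> mA mB Afin Bfin; split.
  by apply: measurable_funB; exact: measurable_funM.
have iA := integrable_indic_lty mA Afin; have iB := integrable_indic_lty mB Bfin.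
apply: (integrableB _ (f := fun y => (fine (m B))%:E * (\1_A y)%:E)
   (g := fun y => (fine (m A))%:E * (\1_B y)%:E)) => //; exact: integrableZl.
Qed.

(** An invariant [E] occupies the same proportion [c] of every set of the pi-system, hence of every
    measurable set; this is impossible unless [E] or its complement is null. *)
Lemma ergodic_of_coboundaries (G : set (set Y)) (W : (set Y)^nat) :
  @measurable _ Y = <<s G >> -> setI_closed G -> (forall n, G (W n)) ->
  \bigcup_n W n = setT -> (forall A, G A -> m A < +oo) ->
  (forall A B, G A -> G B -> approx_coboundary (balanced_indic A B)) ->
  ergodic m S.
Proof.
move=> YG GI GW WT Gfin Gc E mE SE.
have mG A : G A -> measurable A by move=> GA; rewrite YG; exact: sub_sigma_algebra.
have fE A : G A -> (m A \is a fin_num) /\ (m (A `&` E) \is a fin_num).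
  move=> GA; have := Gfin _ GA; rewrite -ge0_fin_numE// => Af; split => //.
  rewrite ge0_fin_numE// (le_lt_trans _ (Gfin _ GA))// le_measure ?inE//.
  - by apply: measurableI => //; exact: mG.
  - exact: mG.
have bal A B : G A -> G B -> m B * m (A `&` E) = m A * m (B `&` E).
  move=> GA GB; have [[fA fAE] [fB fBE]] := (fE A GA, fE B GB).
  have [mf fi] := integrable_balanced_indic (mG _ GA) (mG _ GB) (Gfin _ GA) (Gfin _ GB).
  have := integral_invariant_coboundary mE SE mf fi (Gc _ _ GA GB).
  have iA := integrable_indic_lty (mG _ GA) (Gfin _ GA).
  have iB := integrable_indic_lty (mG _ GB) (Gfin _ GB).
  have iA' : m.-integrable E (EFin \o \1_A) by apply: integrableS iA.
  have iB' : m.-integrable E (EFin \o \1_B) by apply: integrableS iB.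
  rewrite (eq_integral ((fun y => (fine (m B))%:E * (EFin \o \1_A) y) \-
     (fun y => (fine (m A))%:E * (EFin \o \1_B) y)))//.
  rewrite integralB//; [|exact: integrableZl..].
  rewrite !integralZl// !integral_indic//; [|exact: mG..].
  rewrite !fineK// => /eqP; rewrite sube_eq ?add0e; first by move=> /eqP.
  - by rewrite fin_numM.
  - by rewrite fin_num_adde_defl// fin_numM.
have [W0|] := pselect (forall n, m (W n) = 0).
  left; apply: measure_negligible => //; rewrite -(setIT E) -WT setI_bigcupr.
  apply: negligible_bigcup => n; exists (W n); split => //; exact: mG.
move=> /existsNP[N /eqP WN0].
have [fN fNE] := fE _ (GW N).
pose c := (fine (m (W N `&` E)) / fine (m (W N)))%R.
have c0 : (0 <= c)%R by rewrite divr_ge0// fine_ge0.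
have WNgt0 : (0 < fine (m (W N)))%R.
  by rewrite fine_gt0// lt0e WN0/= measure_ge0 -ge0_fin_numE.
pose c' : {nonneg R} := NngNum c0.
(* The relation [bal] with the fixed set [W N], of positive measure, gives this on [G]; two measures
   that agree on the pi-system agree everywhere. *)
have cE A : measurable A -> m (A `&` E) = c%:E * m A.
  have mrE A' : mrestr m mE A' = m (A' `&` E) by [].
  move=> mA; rewrite -mrE.
  apply: (@measure_unique _ _ _ G W YG GI GW WT (mrestr m mE) (mscale c' m)) => //.
    move=> B GB; have [fB fBE] := fE _ GB.
    rewrite [LHS]mrE [RHS]/(mscale _ _ _)/=.
    rewrite /mscale/=; have := bal _ _ GB (GW N).
    rewrite -(fineK fB) -(fineK fBE) -(fineK fN) -(fineK fNE) -!EFinM => -[bE].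
    congr _%:E; rewrite /c mulrAC -[LHS](mulKf (lt0r_neq0 WNgt0)) bE.
    by rewrite mulrC (mulrC (fine (m B))).
  move=> k; have [_ fk] := fE _ (GW k).
  by rewrite [X in X < _]mrE -ge0_fin_numE.
have [c00|cn0] := eqVneq c 0%R.
  by left; rewrite -[E]setTI cE// c00 mul0e.
(* The complement of [E] meets [E] in the empty set, so [c] times its measure is [0]. *)
right; have := cE _ (measurableC mE); rewrite setICl measure0 => /esym/eqP.
by rewrite mule_eq0 eqe (negbTE cn0) => /eqP.
Qed.

End coboundary.

Section L1_continuity.
Context d (Y : measurableType d) (R : realType).
Variable m : {measure set Y -> \bar R}.
Context (J : Type) (F : set_system J) {FF : Filter F}.
Variables (V : J -> Y -> Y) (V0 : Y -> Y).
Hypotheses (mV : forall j, measurable_fun setT (V j))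
  (mpV : forall j A, measurable A -> m (V j @^-1` A) = m A).
Hypotheses (mV0 : measurable_fun setT V0)
  (mpV0 : forall A, measurable A -> m (V0 @^-1` A) = m A).
Local Open Scope ereal_scope.

Let mdist (f h : Y -> R) : measurable_fun setT f -> measurable_fun setT h ->
  measurable_fun setT (fun p => `|f p - h p|%:E).
Proof.
by move=> mf mh; apply/measurable_EFinP/measurableT_comp => //; exact: measurable_funB.
Qed.

Let mcomp (f : Y -> R) (T : Y -> Y) : measurable_fun setT f ->
  measurable_fun setT T -> measurable_fun setT (fun y => f (T y)).
Proof. by move=> mf mT; exact: measurableT_comp. Qed.

(** All the maps [V j] preserve [m], so replacing [g] by a function close to it in L1 costs the same
    for every [j]: convergence on the pi-system is enough. *)
Lemma L1_continuity (G : set (set Y)) (W : (set Y)^nat) :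
  @measurable _ Y = <<s G >> -> setI_closed G -> (forall n, G (W n)) ->
  \bigcup_n W n = setT -> nondecreasing_seq W -> (forall A, G A -> m A < +oo) ->
  (forall A, G A -> forall e : R, (0 < e)%R ->
    \forall j \near F, \int[m]_y `|\1_A (V j y) - \1_A (V0 y)|%:E <= e%:E) ->
  forall g, measurable_fun setT g -> m.-integrable setT (EFin \o g) ->
  forall e : R, (0 < e)%R ->
    \forall j \near F, \int[m]_y `|g (V j y) - g (V0 y)|%:E <= e%:E.
Proof.
move=> YG GI GW WT ndW Gfin Gc g mg gi.
pose K : set (Y -> R) := [set g | [/\ measurable_fun setT g,
  m.-integrable setT (EFin \o g) & forall e : R, (0 < e)%R -> \forall j \near F,
  \int[m]_y `|g (V j y) - g (V0 y)|%:E <= e%:E]].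
suff : K g by move=> -[_ _]; exact.
apply: (@integrable_closure _ _ _ m G W K) => //.
- by move=> n; exact: Gfin.
- move=> A GA; have mA : measurable A by rewrite YG; exact: sub_sigma_algebra.
  by split => //; [exact: (integrable_indic_lty mA (Gfin _ GA))|exact: Gc].
- move=> f h [mf fi fc] [mh hi hc]; split.
  + exact: measurable_funD.
  + rewrite (_ : EFin \o _ = (EFin \o f) \+ (EFin \o h))//; exact: integrableD.
  move=> e' e'0; have e20 : (0 < e' / 2)%R by rewrite divr_gt0.
  apply: filterS2 (fc _ e20) (hc _ e20) => j h1 h2.
  rewrite [e']splitr EFinD; apply: le_trans (leeD h1 h2).
  have mf' := mdist (mcomp mf (mV j)) (mcomp mf mV0).
  have mh' := mdist (mcomp mh (mV j)) (mcomp mh mV0).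
  rewrite -ge0_integralD//.
  apply: ge0_le_integral => //.
  + by apply: mdist; apply: measurable_funD; exact: mcomp.
  + exact: emeasurable_funD.
  by move=> p _; rewrite -EFinD lee_fin opprD addrACA; exact: ler_normD.
- move=> c f [mf fi fc]; split.
  + exact: measurable_funM.
  + exact: (integrableZl measurableT c fi).
  move=> e' e'0; have c1 : (0 < `|c| + 1)%R by rewrite ltr_wpDl.
  have ec : (0 < e' / (`|c| + 1))%R by rewrite divr_gt0.
  apply: filterS (fc _ ec) => j h1.
  have mf' := mdist (mcomp mf (mV j)) (mcomp mf mV0).
  rewrite (eq_integral (fun p => `|c|%:E * `|f (V j p) - f (V0 p)|%:E)); last first.
    by move=> p _; rewrite -EFinM -normrM mulrBr.
  rewrite ge0_integralZl//.
  apply: (@le_trans _ _ (`|c|%:E * (e' / (`|c| + 1))%:E)).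
    by rewrite lee_wpmul2l// lee_fin.
  rewrite -EFinM lee_fin mulrA ler_pdivrMr// mulrC ler_wpM2l// ?ltW//.
  by rewrite ltrDl.
- move=> f mf fi fK; split => // e' e'0.
  have e30 : (0 < e' / 3)%R by rewrite divr_gt0.
  have [h [mh hi hc] fh] := fK _ e30.
  apply: filterS (hc _ e30) => j hj.
  have -> : e' = (e' / 3 + e' / 3 + e' / 3)%R by field.
  rewrite !EFinD.
  have mfh := mdist mf mh.
  have fhT (T : Y -> Y) : measurable_fun setT T ->
      (forall A, measurable A -> m (T @^-1` A) = m A) ->
      \int[m]_p `|f (T p) - h (T p)|%:E <= (e' / 3)%:E.
    by move=> mT mpT; rewrite (@ge0_integral_preserving _ _ _ m T (fun p => `|f p - h p|%:E)).
  apply: le_trans (leeD (leeD (fhT _ (mV j) (mpV j)) hj) (fhT _ mV0 mpV0)).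
  have m1 := mdist (mcomp mf (mV j)) (mcomp mh (mV j)).
  have m2 := mdist (mcomp mh (mV j)) (mcomp mh mV0).
  have m3 := mdist (mcomp mf mV0) (mcomp mh mV0).
  rewrite -ge0_integralD// -ge0_integralD//; last 2 first.
  + by move=> p _; rewrite -EFinD lee_fin addr_ge0.
  + exact: emeasurable_funD.
  apply: ge0_le_integral => //.
  + by apply: mdist; exact: mcomp.
  + by do 2 (apply: emeasurable_funD => //).
  move=> p _; rewrite -!EFinD lee_fin.
  set u := f _; set v := f _; set a := h _; set b := h _.
  have -> : (u - v = (u - a) + (a - b) + (b - v))%R by lra.
  by rewrite (le_trans (ler_normD _ _))// [`|v - b|%R]distrC lerD2r ler_normD.
Qed.

End L1_continuity.

(** * The filling scheme: ergodicity implies approximate coboundaries *)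

Section filling.
Context d (Y : measurableType d) (R : realType).
Variable m : {measure set Y -> \bar R}.
Variables S V : Y -> Y.
Hypotheses (SK : cancel S V) (VK : cancel V S).
Hypotheses (mS : measurable_fun setT S) (mV : measurable_fun setT V).
Hypothesis mpS : forall A, measurable A -> m (S @^-1` A) = m A.
Local Open Scope ereal_scope.

Let mpV A : measurable A -> m (V @^-1` A) = m A.
Proof.
move=> mA; rewrite -mpS; last exact: measurable_preimage.
by congr (m _); apply/seteqP; split => y /=; rewrite SK.
Qed.

Definition coboundary (f : Y -> R) := exists g : Y -> R,
  [/\ measurable_fun setT g, m.-integrable setT (EFin \o g) &
      forall y, f y = (g y - g (V y))%R].

Let coboundaryD f g : coboundary f -> coboundary g ->
  coboundary (fun y => f y + g y)%R.
Proof.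
move=> [f' [mf fi fE]] [g' [mg gi gE]]; exists (fun y => f' y + g' y)%R; split.
- exact: measurable_funD.
- rewrite (_ : EFin \o _ = (EFin \o f') \+ (EFin \o g'))//; exact: integrableD.
- by move=> y; rewrite fE gE; lra.
Qed.

Let coboundaryN f : coboundary f -> coboundary (fun y => - f y)%R.
Proof.
move=> [f' [mf fi fE]]; exists (fun y => - f' y)%R; split.
- exact: measurable_funN.
- rewrite (_ : EFin \o _ = (fun y => - (EFin \o f') y))//; exact: integrableN.
- by move=> y; rewrite fE; lra.
Qed.

Let measurable_iter (T : Y -> Y) n : measurable_fun setT T ->
  measurable_fun setT (iter n T).
Proof.
move=> mT; elim: n => [|n IH]; first exact: measurable_id.
exact: (measurableT_comp mT).
Qed.

Let iter_preserving (T : Y -> Y) n : measurable_fun setT T ->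
  (forall A, measurable A -> m (T @^-1` A) = m A) ->
  forall A, measurable A -> m (iter n T @^-1` A) = m A.
Proof.
move=> mT mpT; elim: n => [|n IH] A mA; first by [].
transitivity (m (iter n T @^-1` (T @^-1` A))) => //.
by rewrite IH ?mpT//; exact: measurable_preimage.
Qed.

Let coboundary_iterV n (g : Y -> R) : measurable_fun setT g ->
  m.-integrable setT (EFin \o g) ->
  coboundary (fun y => g y - g (iter n V y))%R.
Proof.
move=> mg gi; elim: n => [|n IH].
  exists (cst 0%R); split => //; first exact: integrable0.
  by move=> y /=; lra.
rewrite (_ : (fun y => _) = (fun y => (g y - g (iter n V y)) +
    (g (iter n V y) - g (iter n V (V y))))%R); last first.
  by apply/funext => y; rewrite -iterSr; lra.
apply: coboundaryD => //; exists (fun y => g (iter n V y)); split => //.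
- by apply: (measurableT_comp mg); exact: measurable_iter.
- apply: (integrable_preserving _ _ gi); first exact: measurable_iter.
  exact: iter_preserving.
Qed.

Let iterSK n : cancel (iter n S) (iter n V).
Proof. by elim: n => [|n IH] y //; rewrite iterSr iterS SK IH. Qed.

Let iterVK n : cancel (iter n V) (iter n S).
Proof. by elim: n => [|n IH] y //; rewrite iterSr iterS VK IH. Qed.

Let coboundary_iterS n (g : Y -> R) : measurable_fun setT g ->
  m.-integrable setT (EFin \o g) ->
  coboundary (fun y => g y - g (iter n S y))%R.
Proof.
move=> mg gi; have mgS : measurable_fun setT (g \o iter n S).
  by apply: (measurableT_comp mg); exact: measurable_iter.
have giS : m.-integrable setT (EFin \o (g \o iter n S)).
  apply: (integrable_preserving _ _ gi); first exact: measurable_iter.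
  exact: iter_preserving.
rewrite (_ : (fun y => _) = (fun y => - ((g \o iter n S) y - (g \o iter n S) (iter n V y))))%R.
  exact/coboundaryN/coboundary_iterV.
by apply/funext => y /=; rewrite iterVK; lra.
Qed.

(* mass moves along [route k], which enumerates the powers of [S] in both
   directions *)
Definition route (k : nat) : Y -> Y := iter k./2 (if odd k then V else S).
Definition route_inv (k : nat) : Y -> Y := iter k./2 (if odd k then S else V).

Let routeK k : cancel (route k) (route_inv k).
Proof. by rewrite /route /route_inv; case: odd. Qed.

Let route_invK k : cancel (route_inv k) (route k).
Proof. by rewrite /route /route_inv; case: odd. Qed.

Let measurable_route k : measurable_fun setT (route k).
Proof. by rewrite /route; case: odd; exact: measurable_iter. Qed.

Let measurable_route_inv k : measurable_fun setT (route_inv k).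
Proof. by rewrite /route_inv; case: odd; exact: measurable_iter. Qed.

Let route_preserving k A : measurable A -> m (route k @^-1` A) = m A.
Proof. by rewrite /route; case: odd; apply: iter_preserving. Qed.

Let coboundary_route k (g : Y -> R) : measurable_fun setT g ->
  m.-integrable setT (EFin \o g) ->
  coboundary (fun y => g y - g (route k y))%R.
Proof.
by rewrite /route; case: odd; [exact: coboundary_iterV|exact: coboundary_iterS].
Qed.

Variables a0 b0 : Y -> R.
Hypotheses (ma0 : measurable_fun setT a0) (mb0 : measurable_fun setT b0).
Hypotheses (a0_ge0 : forall y, (0 <= a0 y)%R) (b0_ge0 : forall y, (0 <= b0 y)%R).
Hypotheses (ia0 : m.-integrable setT (EFin \o a0)) (ib0 : m.-integrable setT (EFin \o b0)).
Hypothesis ab0 : \int[m]_y (a0 y)%:E = \int[m]_y (b0 y)%:E.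

(** The mass arriving at [y] at step [k]: as much as the source still has and [y] still lacks. *)
Definition moved (a b : Y -> R) k (y : Y) : R := Num.min (a (route_inv k y)) (b y).

(** The supply and the demand left after [k] steps; each point loses the part of its supply that
    arrives at its image under [route k]. *)
Fixpoint filling (k : nat) : (Y -> R) * (Y -> R) := match k with
  | 0 => (a0, b0)
  | k.+1 => let: (a, b) := filling k in
      ((fun y => a y - moved a b k (route k y))%R, (fun y => b y - moved a b k y)%R)
  end.

Let a_ k := (filling k).1.
Let b_ k := (filling k).2.
Let m_ k := moved (a_ k) (b_ k) k.

Let aS k : a_ k.+1 = (fun y => a_ k y - m_ k (route k y))%R.
Proof. by rewrite /a_ /m_ /a_ /b_ /=; case: filling. Qed.

Let bS k : b_ k.+1 = (fun y => b_ k y - m_ k y)%R.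
Proof. by rewrite /b_ /m_ /a_ /b_ /=; case: filling. Qed.

Let fill_prop k : [/\ measurable_fun setT (a_ k), measurable_fun setT (b_ k),
  forall y, (0 <= a_ k y)%R & forall y, (0 <= b_ k y)%R].
Proof.
elim: k => [|k [ma mb a_ge0 b_ge0]]; first by split.
have mm : measurable_fun setT (m_ k).
  by apply: measurable_minr => //; exact: measurableT_comp.
rewrite aS bS; split.
- by apply: measurable_funB => //; exact: measurableT_comp.
- exact: measurable_funB.
- by move=> y; rewrite subr_ge0 /m_ /moved routeK ge_min lexx.
- by move=> y; rewrite subr_ge0 /m_ /moved ge_min lexx orbT.
Qed.

Let measurable_m k : measurable_fun setT (m_ k).
Proof.
have [ma mb _ _] := fill_prop k.
by apply: measurable_minr => //; exact: measurableT_comp.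
Qed.

Let m_ge0 k y : (0 <= m_ k y)%R.
Proof. by have [_ _ a1 b1] := fill_prop k; rewrite /m_ /moved le_min a1 b1. Qed.

Let a_noninc y : nonincreasing_seq (fun k => a_ k y).
Proof. by apply/nonincreasing_seqP => k; rewrite aS gerBl. Qed.

Let b_noninc y : nonincreasing_seq (fun k => b_ k y).
Proof. by apply/nonincreasing_seqP => k; rewrite bS gerBl. Qed.

Let dominated_integrable (f g : Y -> R) : measurable_fun setT f ->
  (forall y, (0 <= f y <= g y)%R) -> m.-integrable setT (EFin \o g) ->
  m.-integrable setT (EFin \o f).
Proof.
move=> mf fg; apply: le_integrable => //; first exact/measurable_EFinP.
move=> y _ /=; have /andP[f0 fg'] := fg y.
by rewrite lee_fin ger0_norm// ger0_norm// (le_trans f0).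
Qed.

Let ia k : m.-integrable setT (EFin \o a_ k).
Proof.
have [ma _ a1 _] := fill_prop k; apply: (dominated_integrable ma _ ia0) => y.
by rewrite a1 (a_noninc y (leq0n k)).
Qed.

Let ib k : m.-integrable setT (EFin \o b_ k).
Proof.
have [_ mb _ b1] := fill_prop k; apply: (dominated_integrable mb _ ib0) => y.
by rewrite b1 (b_noninc y (leq0n k)).
Qed.

Let im k : m.-integrable setT (EFin \o m_ k).
Proof.
apply: (dominated_integrable (measurable_m k) _ (ib k)) => y.
by rewrite m_ge0 /m_ /moved ge_min lexx orbT.
Qed.

Let fill_mass k : \int[m]_y (a_ k y)%:E = \int[m]_y (b_ k y)%:E.
Proof.
elim: k => [//|k IH]; rewrite aS bS.
have imr : m.-integrable setT (EFin \o (m_ k \o route k)).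
  exact: (integrable_preserving _ (route_preserving k) (im k)).
transitivity (\int[m]_y ((EFin \o a_ k) \- (EFin \o (m_ k \o route k))) y); first by [].
rewrite integralB// [X in X - _]IH.
rewrite [X in _ - X](_ : _ = \int[m]_y (m_ k y)%:E); last first.
  exact: (integral_preserving _ (route_preserving k) (im k)).
transitivity (\int[m]_y ((EFin \o b_ k) \- (EFin \o m_ k)) y); last by [].
by rewrite integralB.
Qed.

(** Each step moves mass by a power of [S], and the difference between a function and its
    composition with a power of [S] telescopes into a coboundary. *)
Let fill_coboundary k : coboundary (fun y => (a0 y - b0 y) - (a_ k y - b_ k y))%R.
Proof.
elim: k => [|k IH].
  exists (cst 0%R); split => //; first exact: integrable0.
  by move=> y; rewrite /a_ /b_/=; lra.
have := coboundaryD IH (coboundaryN (coboundary_route k (measurable_m k) (im k))).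
congr coboundary; apply/funext => y; rewrite aS bS; lra.
Qed.

Let a' y := limn (fun k => a_ k y).
Let b' y := limn (fun k => b_ k y).

Let cvg_a y : a_ k y @[k --> \oo] --> a' y.
Proof.
apply: nonincreasing_is_cvgn; first exact: a_noninc.
by exists 0%R => _ [k _ <-]; have [_ _ + _] := fill_prop k.
Qed.

Let cvg_b y : b_ k y @[k --> \oo] --> b' y.
Proof.
apply: nonincreasing_is_cvgn; first exact: b_noninc.
by exists 0%R => _ [k _ <-]; have [_ _ _ +] := fill_prop k.
Qed.

Let a'_le k y : (0 <= a' y <= a_ k y)%R.
Proof.
have cv : cvgn (fun k => a_ k y) by apply/cvg_ex; exists (a' y); exact: cvg_a.
apply/andP; split.
  by apply: limr_ge => //; apply: nearW => n; have [_ _ + _] := fill_prop n.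
by apply: nonincreasing_cvgn_ge => //; exact: a_noninc.
Qed.

Let b'_le k y : (0 <= b' y <= b_ k y)%R.
Proof.
have cv : cvgn (fun k => b_ k y) by apply/cvg_ex; exists (b' y); exact: cvg_b.
apply/andP; split.
  by apply: limr_ge => //; apply: nearW => n; have [_ _ _ +] := fill_prop n.
by apply: nonincreasing_cvgn_ge => //; exact: b_noninc.
Qed.

(** Step [k] exhausts either the supply at the source or the demand at [y], whichever is the
    smaller, and both only decrease afterwards. *)
Let a'b' k y : (a' (route_inv k y) = 0 \/ b' y = 0)%R.
Proof.
have /andP[a1 a2] := a'_le k.+1 (route_inv k y).
have /andP[b1 b2] := b'_le k.+1 y.
move: a2 b2; rewrite aS bS route_invK /m_ /moved.
case: (leP (a_ k (route_inv k y)) (b_ k y)) => _; rewrite subrr => h1 h2.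
  by left; apply/eqP; rewrite eq_le h1.
by right; apply/eqP; rewrite eq_le h2.
Qed.

Let measurable_lim (f : nat -> Y -> R) (g : Y -> R) :
  (forall k, measurable_fun setT (f k)) ->
  (forall y, f k y @[k --> \oo] --> g y) -> measurable_fun setT g.
Proof. by move=> mf fg; apply: (measurable_fun_cvg mf) => y _; exact: fg. Qed.

Let measurable_a' : measurable_fun setT a'.
Proof. by apply: (measurable_lim _ cvg_a) => k; have [] := fill_prop k. Qed.

Let measurable_b' : measurable_fun setT b'.
Proof. by apply: (measurable_lim _ cvg_b) => k; have [] := fill_prop k. Qed.

Let mass_cvg0 (f : nat -> Y -> R) (g f0 : Y -> R) :
  (forall k, measurable_fun setT (f k)) -> measurable_fun setT g ->
  (forall k y, (0 <= f k y <= f0 y)%R) -> m.-integrable setT (EFin \o f0) ->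
  (forall y, f k y @[k --> \oo] --> g y) ->
  {ae m, forall y, g y = 0%R} ->
  \int[m]_y (f k y)%:E @[k --> \oo] --> 0.
Proof.
move=> mf mg f0P if0 fg g0.
have <- : \int[m]_y (g y)%:E = 0.
  rewrite (ae_eq_integral (cst 0))//; first exact: integral0.
    exact/measurable_EFinP.
  by move: g0; apply: filterS => y -> _.
apply: (@dominated_cvg _ _ _ m setT measurableT (fun k y => (f k y)%:E) _ (EFin \o f0)) => //.
- by move=> k; exact/measurable_EFinP.
- by move=> y _; apply: cvg_EFin; [exact: nearW|exact: fg].
- move=> k y _ /=; have /andP[h1 h2] := f0P k y.
  by rewrite lee_fin ger0_norm.
Qed.

(** The points whose orbit meets [a' > 0] form an invariant set. If it is null, [a'] vanishes almost
    everywhere; otherwise almost every orbit meets [a' > 0], and [b'] vanishes by [a'b']. The masses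
    left on both sides are equal, so both tend to [0]. *)
Lemma filling_approx_coboundary : ergodic m S ->
  approx_coboundary m V (fun y => a0 y - b0 y)%R.
Proof.
move=> ergS.
pose P := [set y | exists k, (0 < a' (route k y))%R].
have P0 : (\int[m]_y (b_ k y)%:E @[k --> \oo] --> 0).
  have mP : measurable P.
    rewrite [X in measurable X](_ : _ = \bigcup_k [set y | (0 < a' (route k y))%R]); last first.
      by apply/seteqP; split => [y [k ?]|y [k _ ?]]; [exists k|exists k].
    apply: bigcup_measurable => k _; rewrite -[X in measurable X]setTI.
    by apply: measurable_fun_ltr => //; exact: measurableT_comp.
  have PE y : P y <-> (exists n, (0 < a' (iter n S y))%R) \/ (exists n, (0 < a' (iter n V y))%R).
    split=> [[k]|[[n Hn]|[n Hn]]].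
    - rewrite /route; case: odd => h; [right|left]; by exists k./2.
    - by exists n.*2; rewrite /route odd_double doubleK.
    - by exists n.*2.+1; rewrite /route/= odd_double/= uphalf_double.
  have SP : S @^-1` P = P.
    apply/seteqP; split => y; rewrite /= PE => -[[n]|[[|n]]] h; apply/PE.
    - by left; exists n.+1; rewrite iterSr.
    - by left; exists 1%N.
    - by right; exists n; move: h; rewrite iterSr SK.
    - case: n h => [h|n h]; last by left; exists n; rewrite -iterSr.
      by right; exists 1%N; rewrite /= SK.
    - by right; exists 1%N; rewrite /= SK.
    - by right; exists n.+2; rewrite iterSr SK.
  have [P0|PC0] := ergS P mP SP.
    rewrite (_ : (fun k => _) = (fun k => \int[m]_y (a_ k y)%:E)); last first.
      by apply/funext => k; rewrite fill_mass.
    apply: (mass_cvg0 _ measurable_a' _ ia0 cvg_a).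
    - by move=> k; have [] := fill_prop k.
    - by move=> k y; have [_ _ -> _] := fill_prop k; rewrite (a_noninc y (leq0n k)).
    exists P; split => // y /= /eqP a'y; exists 0%N; rewrite /route/= lt0r a'y.
    by have /andP[] := a'_le 0 y.
  apply: (mass_cvg0 _ measurable_b' _ ib0 cvg_b).
  - by move=> k; have [] := fill_prop k.
  - by move=> k y; have [_ _ _ ->] := fill_prop k; rewrite (b_noninc y (leq0n k)).
  exists (~` P); split => //; first exact: measurableC.
  move=> y /= b'y /PE [] [n an]; apply: b'y.
  (* The source is [iter n S y]: routes of odd index apply [V], so route [2n+1] leads from it to
     [y]. *)
  - have := a'b' n.*2.+1 y; rewrite /route_inv/= odd_double/= uphalf_double => -[a0'|//].
    by rewrite a0' ltxx in an.
  - have := a'b' n.*2 y; rewrite /route_inv/= odd_double/= doubleK => -[a0'|//].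
    by rewrite a0' ltxx in an.
move=> e e0; have e20 : 0 < (e / 2)%:E by rewrite lte_fin divr_gt0.
have [k _ /(_ k (leqnn k))/= bk] := cvge_near_lt P0 e20.
have [g [mg gi gE]] := fill_coboundary k.
exists g; split => //.
have [ma mb a1 b1] := fill_prop k.
apply: (@le_trans _ _ (\int[m]_y ((a_ k y)%:E + (b_ k y)%:E))).
  apply: ge0_le_integral => //.
  - apply/measurable_EFinP/measurableT_comp => //; apply: measurable_funD.
      by apply: measurable_funB => //; exact: measurable_funB.
    exact: measurableT_comp.
  - by apply: emeasurable_funD; exact/measurable_EFinP.
  move=> y _; rewrite -EFinD lee_fin.
  have -> : (a0 y - b0 y - g y + g (V y) = a_ k y - b_ k y)%R by have := gE y; lra.
  by rewrite (le_trans (ler_normB _ _))// !ger0_norm.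
rewrite ge0_integralD//; last 4 first.
- by move=> y _; rewrite lee_fin.
- exact/measurable_EFinP.
- by move=> y _; rewrite lee_fin.
- exact/measurable_EFinP.
rewrite fill_mass [e in leRHS]splitr EFinD leeD// ltW//.
Qed.

End filling.

Section filling_indic.
Context d (Y : measurableType d) (R : realType).
Variable m : {measure set Y -> \bar R}.
Variables S V : Y -> Y.
Hypotheses (SK : cancel S V) (VK : cancel V S).
Hypotheses (mS : measurable_fun setT S) (mV : measurable_fun setT V).
Hypothesis mpS : forall A, measurable A -> m (S @^-1` A) = m A.
Local Open Scope ereal_scope.

Lemma approx_coboundary_of_ergodic (A B : set Y) : measurable A -> measurable B ->
  m A < +oo -> m B < +oo -> ergodic m S -> approx_coboundary m V (balanced_indic m A B).
Proof.
move=> mA mB Afin Bfin ergS.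
have iA := integrable_indic_lty mA Afin; have iB := integrable_indic_lty mB Bfin.
apply: (@filling_approx_coboundary _ _ _ m S V SK VK mS mV mpS
  (fun y => fine (m B) * \1_A y)%R (fun y => fine (m A) * \1_B y)%R) => //.
- exact: measurable_funM.
- exact: measurable_funM.
- exact: (integrableZl measurableT (fine (m B)) iA).
- exact: (integrableZl measurableT (fine (m A)) iB).
under eq_integral do rewrite EFinM.
under [in RHS]eq_integral do rewrite EFinM.
rewrite (integralZl measurableT iA) (integralZl measurableT iB).
by rewrite !integral_indic// !setIT !fineK ?ge0_fin_numE// muleC.
Qed.

End filling_indic.

(** * Ergodicity of type III_1 is a G_delta condition *)

Section rational_rectangles.
Context d (X : measurableType d) (R : realType).
Variables (phi : X -> R) (W : (set X)^nat).
Hypothesis mphi : measurable_fun setT phi.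
Hypothesis phiE : forall A, measurable A ->
  exists2 B, measurable B & A = phi @^-1` B.
Hypotheses (mW : forall n, measurable (W n)) (ndW : nondecreasing_seq W).
Hypothesis WT : \bigcup_n W n = setT.

(** [phi] codes the standard space by reals, so its rational sublevel sets generate the
    sigma-algebra of [X]; [W] and the left rays are there to make the measure finite. *)
Definition rat_rect (i : rat * nat * rat) : set (X * R) :=
  (W i.1.2 `&` [set x | phi x <= ratr i.1.1]) `*` [set y | y <= ratr i.2].

Lemma measurable_rat_rect i : measurable (rat_rect i).
Proof.
apply: measurableX; last first.
  rewrite [X in measurable X](_ : _ = `]-oo, ratr i.2]%classic)//.
apply: measurableI => //; rewrite -[X in measurable X]setTI.
exact: measurable_fun_ler.
Qed.

Lemma setI_closed_rat_rect : setI_closed (range rat_rect).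
Proof.
move=> _ _ [[[q n] p] _ <-] [[[q' n'] p'] _ <-].
exists (Order.min q q', minn n n', Order.min p p') => //.
have mn : W (minn n n') = W n `&` W n'.
  have [nn'|n'n] := leqP n n'.
    by apply/esym/setIidPl; rewrite -subsetEset; exact: ndW.
  by apply/esym/setIidPr; rewrite -subsetEset; exact/ndW/ltnW.
have ratm (a b : rat) (x : R) : (x <= ratr (Order.min a b)) = (x <= ratr a) && (x <= ratr b).
  by case: (leP a b) => ab; apply/idP/andP => [h|[]//]; split => //;
    apply: (le_trans h); rewrite ler_rat// ltW.
apply/seteqP; split => -[x y] /=; rewrite /rat_rect/= mn !ratm.
  by move=> [[[? ?] /andP[? ?]] /andP[? ?]].
by move=> [[[? ?] ?] [[? ?] ?]]; do !split => //; exact/andP.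
Qed.

Lemma measurable_prod_rat_rect :
  @measurable _ (X * R)%type = <<s range rat_rect >>.
Proof.
apply/seteqP; split; last first.
  apply: smallest_sub; first exact: sigma_algebra_measurable.
  by move=> _ [i _ <-]; exact: measurable_rat_rect.
(* The same set with the generated sigma-algebra: it is enough that both coordinates are measurable
   from [Z], since the identity is their pairing. *)
pose Z : measurableType _ := g_sigma_algebraType (range rat_rect).
have mrect i : @measurable _ Z (rat_rect i) by apply: sub_sigma_algebra; exists i.
have rayP (x y : R) : x < y -> exists q : rat, x <= ratr q /\ ratr q < y.
  by move=> /rat_in_itvoo[q]; rewrite in_itv/= => /andP[/ltW ? ?]; exists q.
have big (x : R) : exists q : rat, x <= ratr q.
  have /rayP[q [xq _]] : x < x + 1 by rewrite ltrDl.
  by exists q.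
have msnd : @measurable_fun _ _ Z R setT (fun z : X * R => z.2).
  apply: (@measurability _ _ Z R setT _ (@RGenInftyO.G R)).
    exact: RGenInftyO.measurableE.
  move=> _ [_ [x ->] <-]; rewrite setTI.
  (* A condition on the second coordinate alone is a countable union of rectangles whose bounds on
     the first one exhaust [X]. *)
  rewrite [X in measurable X](_ : _ = \bigcup_n \bigcup_q \bigcup_p
      (if ratr p < x then rat_rect (q, n, p) else set0)); last first.
    apply/seteqP; split => [[u y]|[u y]] /=.
      rewrite in_itv/= => yx; have [p [yp px]] := rayP _ _ yx.
      have [q uq] := big (phi u).
      have [n _ Wu] : (\bigcup_n W n) u by rewrite WT.
      by exists n => //; exists q => //; exists p => //; rewrite px.
    move=> [n _ [q _ [p _]]]; case: ifPn => // px [_ /= yp].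
    by rewrite in_itv/= (le_lt_trans yp).
  apply: bigcupT_measurable => n; apply: bigcupT_measurable_rat => q.
  by apply: bigcupT_measurable_rat => p; case: ifP.
have mphi1 : @measurable_fun _ _ Z R setT (fun z : X * R => phi z.1).
  apply: (@measurability _ _ Z R setT _ (@RGenInftyO.G R)).
    exact: RGenInftyO.measurableE.
  move=> _ [_ [x ->] <-]; rewrite setTI.
  rewrite [X in measurable X](_ : _ = \bigcup_n \bigcup_p \bigcup_q
      (if ratr q < x then rat_rect (q, n, p) else set0)); last first.
    apply/seteqP; split => [[u y]|[u y]] /=.
      rewrite in_itv/= => ux; have [q [uq qx]] := rayP _ _ ux.
      have [p yp] := big y.
      have [n _ Wu] : (\bigcup_n W n) u by rewrite WT.
      by exists n => //; exists p => //; exists q => //; rewrite qx.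
    move=> [n _ [p _ [q _]]]; case: ifPn => // qx [[_ /= uq] _].
    by rewrite in_itv/= (le_lt_trans uq).
  apply: bigcupT_measurable => n; apply: bigcupT_measurable_rat => q.
  by apply: bigcupT_measurable_rat => p; case: ifP.
have mfst : @measurable_fun _ _ Z X setT (fun z : X * R => z.1).
  move=> _ A mA; have [B mB ->] := phiE mA.
  exact: (mphi1 measurableT B mB).
move=> A mA.
have := @measurable_fun_pair _ _ _ Z X R _ _ mfst msnd measurableT A mA.
by rewrite setTI [X in measurable X -> _](_ : _ = A)//; apply/seteqP; split => -[].
Qed.

Lemma rat_rect_cover : exists g : nat -> rat * nat * rat,
  nondecreasing_seq (rat_rect \o g) /\ \bigcup_n rat_rect (g n) = setT.
Proof.
exists (fun n => (n%:R, n, n%:R)); split.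
  move=> i j ij; rewrite subsetEset => -[x y] [[Wx xi] yi]; split; first split.
  - by move: (ndW ij); rewrite subsetEset; apply.
  - by apply: le_trans xi _; rewrite ler_rat ler_nat.
  - by apply: le_trans yi _; rewrite ler_rat ler_nat.
apply/seteqP; split => // -[x y] _.
have [n _ Wx] : (\bigcup_n W n) x by rewrite WT.
pose k := maxn n (maxn (Num.truncn (phi x)).+1 (Num.truncn y).+1).
exists k => //; split; first split.
- by move: (ndW (leq_maxl n _ : n <= k)%N); rewrite subsetEset; apply.
- rewrite /= ratr_nat ltW// (lt_le_trans (truncnS_gt _))// ler_nat.
  by rewrite leq_max leq_max leqnn orbT.
- rewrite /= ratr_nat ltW// (lt_le_trans (truncnS_gt _))// ler_nat.
  by rewrite !leq_max leqnn !orbT.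
Qed.

End rational_rectangles.

(** * Continuity of the Maharam extension in the topology d_2 *)

Section d2_continuity.
Context d (X : measurableType d) (R : realType).
Variable mu : {sigma_finite_measure set X -> \bar R}.
Hypothesis muT : mu setT = +oo%E.
Local Open Scope ereal_scope.

Lemma d2_map_continuous (i : d2_index mu) :
  continuous (fun T : aut2_top mu => d2_map mu (sval T) i : R).
Proof.
move=> T; apply: (@cvg_comp _ _ _ (fun T : aut2_top mu => d2_map mu (sval T))
  (fun F : {ptws d2_index mu -> R} => F i) (nbhs T) (nbhs (d2_map mu (sval T)))).
  exact: (@initial_continuous (aut2_type mu) {ptws d2_index mu -> R}
    (fun T => d2_map mu (sval T)) T).
exact: (@proj_continuous {classic (d2_index mu)} (fun _ => R : topologicalType) i).
Qed.

Definition UT_indic (T : X -> X) (A : set X) (x : X) : R :=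
  (Num.sqrt (Tprime mu T x) * \1_A (inv_map T x))%R.

Lemma measurable_UT_indic T A : Aut2 mu T -> measurable A ->
  measurable_fun setT (UT_indic T A).
Proof.
move=> aT mA; have [_ _ mT mS] := inv_mapP aT.1.
apply: measurable_funM; first exact/measurable_fun_sqrt/measurable_Tprime.
exact: measurableT_comp.
Qed.

Lemma UT_indic_ge0 T A x : (0 <= UT_indic T A x)%R.
Proof. by rewrite mulr_ge0// sqrtr_ge0. Qed.

Lemma UT_indic_sqr T A x : Aut2 mu T ->
  (UT_indic T A x ^+ 2 = \1_A (inv_map T x) * Tprime mu T x)%R.
Proof.
move=> aT; rewrite exprMn sqr_sqrtr ?Tprime_ge0// mulrC; congr (_ * _)%R.
by rewrite indicE; case: (_ \in _); rewrite ?expr1n ?expr0n.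
Qed.

Lemma integral_UT_indic_sqr T A : Aut2 mu T -> measurable A ->
  \int[mu]_x (UT_indic T A x ^+ 2)%:E = mu A.
Proof.
move=> aT mA; have [TS ST mT mS] := inv_mapP aT.1.
under eq_integral do rewrite UT_indic_sqr// EFinM.
rewrite -(ge0_integral_comp_Tprime muT (h := fun x => (\1_A (inv_map T x))%:E))//.
- by under eq_integral do rewrite TS; rewrite integral_indic// setIT.
- by apply/measurable_EFinP; exact: measurableT_comp.
Qed.

(** Weak convergence without loss of norm is strong: as [U_T] is isometric, the squared distance is
    [2 mu A] minus twice the coefficient of [1_A] against the fixed function [U_T0 1_A]. *)
Lemma near_UT_indic (T0 : aut2_top mu) (A : set X) (e : R) : measurable A ->
  mu A < +oo -> (0 < e)%R ->
  \forall T \near T0,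
    \int[mu]_x ((UT_indic (sval T) A x - UT_indic (sval T0) A x) ^+ 2)%:E <= e%:E.
Proof.
move=> mA Afin e0; have aT0 := svalP T0.
have fA : mu A \is a fin_num by rewrite ge0_fin_numE.
have LA : L2 mu (\1_A : X -> R).
  split => //; rewrite (eq_integral (fun x => (\1_A x)%:E)).
    by rewrite integral_indic// setIT.
  by move=> x _; rewrite indicE; case: (_ \in _); rewrite ?expr1n ?expr0n.
have LU : L2 mu (UT_indic (sval T0) A).
  split; first exact: measurable_UT_indic.
  by rewrite integral_UT_indic_sqr.
pose i : d2_index mu := inl (exist _ (\1_A : X -> R, UT_indic (sval T0) A) (conj LA LU)).
have cT (T : aut2_top mu) : d2_map mu (sval T) i =
    fine (\int[mu]_x (UT_indic (sval T) A x * UT_indic (sval T0) A x)%:E) by [].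
have sq (T : aut2_top mu) :
    \int[mu]_x ((UT_indic (sval T) A x - UT_indic (sval T0) A x) ^+ 2)%:E +
    2%:E * \int[mu]_x (UT_indic (sval T) A x * UT_indic (sval T0) A x)%:E =
    2%:E * mu A.
  have aT := svalP T.
  have m1 := measurable_UT_indic aT mA; have m2 := measurable_UT_indic aT0 mA.
  rewrite -ge0_integralZl//; last 2 first.
  - by apply/measurable_EFinP; exact: measurable_funM.
  - by move=> x _; rewrite lee_fin mulr_ge0// UT_indic_ge0.
  rewrite -ge0_integralD//; last 4 first.
  - by move=> x _; rewrite lee_fin sqr_ge0.
  - by apply/measurable_EFinP/measurable_funX; exact: measurable_funB.
  - by move=> x _; rewrite mule_ge0// lee_fin mulr_ge0// UT_indic_ge0.
  - by apply: emeasurable_funM => //; apply/measurable_EFinP; exact: measurable_funM.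
  rewrite (_ : 2%:E * mu A = mu A + mu A); last first.
    by rewrite -(fineK fA) -EFinM -EFinD mulrDl mul1r.
  rewrite -[X in _ = X + _](integral_UT_indic_sqr aT mA).
  rewrite -[X in _ = _ + X](integral_UT_indic_sqr aT0 mA).
  rewrite -ge0_integralD//; last 4 first.
  - by move=> x _; rewrite lee_fin sqr_ge0.
  - by apply/measurable_EFinP/measurable_funX.
  - by move=> x _; rewrite lee_fin sqr_ge0.
  - by apply/measurable_EFinP/measurable_funX.
  apply: eq_integral => x _; rewrite -EFinM -!EFinD; congr _%:E.
  by rewrite /=; set a := UT_indic _ _ _; set b := UT_indic _ _ _; lra.
have fc (T : aut2_top mu) :
    \int[mu]_x (UT_indic (sval T) A x * UT_indic (sval T0) A x)%:E \is a fin_num.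
  rewrite ge0_fin_numE; last first.
    by apply: integral_ge0 => x _; rewrite lee_fin mulr_ge0// UT_indic_ge0.
  have : 2%:E * \int[mu]_x (UT_indic (sval T) A x * UT_indic (sval T0) A x)%:E <= 2%:E * mu A.
    rewrite -(sq T) leeDr// integral_ge0// => x _; by rewrite lee_fin sqr_ge0.
  rewrite lee_pmul2l// => /le_lt_trans; exact.
have c0 : d2_map mu (sval T0) i = fine (mu A).
  rewrite cT; congr fine; rewrite -(integral_UT_indic_sqr aT0 mA).
  by apply: eq_integral => x _; rewrite expr2.
have := @d2_map_continuous i T0; move=> /cvgrPdist_lt/(_ _ (divr_gt0 e0 (ltr0n R 2))).
apply: filterS => T; rewrite c0 cT => hT.
have := sq T; rewrite -(fineK (fc T)) -(fineK fA) -!EFinM.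
set J := \int[mu]_x _; case: J => [r| |]//= [rE]; rewrite lee_fin.
have := ler_norm (fine (mu A) - fine (\int[mu]_x (UT_indic (sval T) A x * UT_indic (sval T0) A x)%:E))%R.
by lra.
Qed.

End d2_continuity.

Section maharam_continuity.
Context d (X : measurableType d) (R : realType).
Variable mu : {sigma_finite_measure set X -> \bar R}.
Hypothesis muT : mu setT = +oo%E.
Local Open Scope ereal_scope.
Notation m := (mu \x (@exp_measure R)).

(** The left ray of mass [expR s * p]. The case [p = 0] is separate, as [ln 0] is not minus
    infinity. *)
Definition exp_ray (s p : R) : set R :=
  if (0 < p)%R then [set y | y <= s + ln p]%R else set0.

Lemma measurable_exp_ray s p : measurable (exp_ray s p).
Proof.
rewrite /exp_ray; case: ifP => // _.
by rewrite [X in measurable X](_ : _ = `]-oo, (s + ln p)%R]%classic).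
Qed.

Lemma exp_measure_ray s p : (0 <= p)%R -> exp_measure (exp_ray s p) = (expR s * p)%:E.
Proof.
rewrite /exp_ray le_eqVlt => /orP[/eqP <-|p0].
  by rewrite ltxx measure0 mulr0.
by rewrite p0 [LHS](exp_measureNyc (s + ln p)) expRD lnK.
Qed.

Lemma integral_exp_rayB s p q : (0 <= p)%R -> (0 <= q)%R ->
  \int[exp_measure]_y `|\1_(exp_ray s p) y - \1_(exp_ray s q) y|%:E =
  (expR s * `|p - q|)%:E.
Proof.
wlog pq : p q / (p <= q)%R => [wl p0 q0|p0 q0].
  have [pq|/ltW qp] := leP p q; first exact: wl.
  rewrite distrC -wl//; apply: eq_integral => y _; by rewrite distrC.
have sub : exp_ray s p `<=` exp_ray s q.
  rewrite /exp_ray; case: (ltP 0%R p) => [pp|_]; last exact: sub0set.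
  rewrite (lt_le_trans pp pq) => y /= ys.
  by rewrite (le_trans ys)// lerD2l ler_ln// posrE (lt_le_trans pp).
have mp := measurable_exp_ray s p; have mq := measurable_exp_ray s q.
have mI (A : set R) : measurable A -> measurable_fun setT (fun y => (\1_A y : R)%:E).
  by move=> mA; exact/measurable_EFinP.
have mD : measurable_fun setT (fun y => `|\1_(exp_ray s p) y - \1_(exp_ray s q) y : R|%:E).
  by apply/measurable_EFinP/measurableT_comp => //; exact: measurable_funB.
have : \int[exp_measure]_y (\1_(exp_ray s q) y)%:E =
    \int[exp_measure]_y (\1_(exp_ray s p) y)%:E +
    \int[exp_measure]_y `|\1_(exp_ray s p) y - \1_(exp_ray s q) y|%:E.
  rewrite -ge0_integralD//.
  - apply: eq_integral => y _; rewrite -EFinD; congr _%:E; rewrite !indicE.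
    have := sub y; have [yp|yp] := pselect (exp_ray s p y) => h.
      by rewrite (mem_set yp) (mem_set (h yp)) subrr normr0 addr0.
    by rewrite (memNset yp) add0r sub0r normrN ger0_norm.
  - exact: mI.
have iE t : (0 <= t)%R -> \int[exp_measure]_y (\1_(exp_ray s t) y)%:E = (expR s * t)%:E.
  move=> t0; have mt := measurable_exp_ray s t.
  by rewrite integral_indic// setIT; exact: exp_measure_ray.
rewrite !iE//.
case: (\int[_]_y _) => [r| |]; rewrite ?addey ?addeNy//.
by rewrite -EFinD => -[h]; congr _%:E; rewrite distrC ger0_norm ?subr_ge0//; lra.
Qed.

(** The bound on [y] is shifted by the logarithm of [Tprime mu T x], and the condition on the base
    is [\1_A (inv_map T x)]; the product of the two factors is the square of [U_T 1_A]. Distances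
    between such sets thus reduce to differences of squares. *)
Lemma maharam_inv_rayE (T : X -> X) (A : set X) (s : R) : Aut2 mu T ->
  {ae mu, forall x, forall y,
    \1_(A `*` [set y | y <= s]%R) (maharam_inv mu T (x, y)) =
    \1_(exp_ray s (UT_indic mu T A x ^+ 2)) y :> R}.
Proof.
move=> aT; have [TS ST mT mS] := inv_mapP aT.1.
have aeD : {ae mu, forall x, dmuT mu T (inv_map T x) = (Tprime mu T x)^-1%R}.
  have nsS : nonsingular_inv mu (inv_map T).
    have [S [h1 h2 h3 h4 h5]] := aT.1; exists T; split => // A' mA'.
    rewrite -(h5 (inv_map T @^-1` A')); last exact: measurable_preimage.
    by rewrite [X in mu X = 0 <-> _](_ : _ = A')//; apply/seteqP; split => x /=; rewrite TS.
  move: (ae_comp_nonsingular nsS (dmuTE muT aT)); apply: filterS => x.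
  by rewrite ST.
move: (Tprime_gt0 muT aT); apply: filterS2 aeD => x Dx T'0 y.
rewrite UT_indic_sqr// !indicE; congr ((nat_of_bool _)%:R); apply/esym.
have [xA|xA] := pselect (A (inv_map T x)).
  rewrite (mem_set xA) mul1r /exp_ray T'0.
  apply/idP/idP; rewrite !inE /maharam_inv/= Dx lnV ?posrE//.
    by move=> ys; split => //; rewrite lerBlDr.
  by move=> -[_]; rewrite lerBlDr.
rewrite (memNset xA) mul0r /exp_ray ltxx in_set0.
by apply/esym/negbTE; rewrite notin_setE => -[].
Qed.

Lemma maharam_inv_ray_dist (T S : X -> X) (A : set X) (s : R) :
  Aut2 mu T -> Aut2 mu S -> measurable A ->
  \int[m]_p `|\1_(A `*` [set y | y <= s]%R) (maharam_inv mu T p) -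
              \1_(A `*` [set y | y <= s]%R) (maharam_inv mu S p)|%:E =
  (expR s)%:E * \int[mu]_x `|UT_indic mu T A x ^+ 2 - UT_indic mu S A x ^+ 2|%:E.
Proof.
move=> aT aS mA; set B := A `*` _.
have mB : measurable B.
  apply: measurableX => //.
  by rewrite [X in measurable X](_ : _ = `]-oo, s]%classic).
have mf : measurable_fun setT (fun p => `|\1_B (maharam_inv mu T p) -
    \1_B (maharam_inv mu S p) : R|%:E).
  apply/measurable_EFinP/measurableT_comp => //.
  apply: measurable_funB; apply: measurableT_comp => //;
  exact: measurable_maharam_inv.
rewrite fubini_tonelli1//.
have m1 := measurable_UT_indic muT aT mA; have m2 := measurable_UT_indic muT aS mA.
have m12 : measurable_fun setT (fun x => `|UT_indic mu T A x ^+ 2 - UT_indic mu S A x ^+ 2|%:E).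
  apply/measurable_EFinP/measurableT_comp => //.
  by apply: measurable_funB; exact: measurable_funX.
rewrite -ge0_integralZl//.
apply: ae_eq_integral => //.
- exact: measurable_fun_fubini_tonelli_F.
- exact: emeasurable_funM.
move: (maharam_inv_rayE A s aT); apply: filterS2 (maharam_inv_rayE A s aS).
move=> x hS hT _; rewrite /fubini_F -EFinM -integral_exp_rayB ?sqr_ge0//.
by apply: eq_integral => y _; rewrite hS hT.
Qed.

Lemma near_maharam_inv_ray (T0 : aut2_top mu) (A : set X) (s e : R) :
  measurable A -> mu A < +oo -> (0 < e)%R ->
  \forall T \near T0,
  \int[m]_p `|\1_(A `*` [set y | y <= s]%R) (maharam_inv mu (sval T) p) -
              \1_(A `*` [set y | y <= s]%R) (maharam_inv mu (sval T0) p)|%:E <= e%:E.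
Proof.
move=> mA Afin e0; have aT0 := svalP T0.
have fA : mu A \is a fin_num by rewrite ge0_fin_numE.
have a0 : (0 <= fine (mu A))%R by rewrite fine_ge0.
pose e' := (e / expR s)%R; have e'0 : (0 < e')%R by rewrite divr_gt0// expR_gt0.
(* A difference of squares is the product of the difference and the sum. The squared difference is
   made at most [e' / c] and the squared sum is at most [4 mu A], so with the weight [c] each term
   is at most [e' / 2]. *)
pose c := ((4 * fine (mu A) + 1) / e')%R.
have c0 : (0 < c)%R by rewrite divr_gt0// ltr_wpDl// mulr_ge0.
move: (near_UT_indic muT T0 mA Afin (divr_gt0 e'0 c0)); apply: filterS => T hT.
have aT := svalP T.
have m1 := measurable_UT_indic muT aT mA; have m2 := measurable_UT_indic muT aT0 mA.
rewrite maharam_inv_ray_dist//.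
suff : \int[mu]_x `|UT_indic mu (sval T) A x ^+ 2 - UT_indic mu (sval T0) A x ^+ 2|%:E <= e'%:E.
  move=> h; apply: (@le_trans _ _ ((expR s)%:E * e'%:E)).
    by rewrite lee_pmul2l// lte_fin expR_gt0.
  by rewrite -EFinM lee_fin /e' mulrC divfK// gt_eqF// expR_gt0.
under eq_integral do rewrite subr_sqr.
apply: le_trans (@integral_norm_mul_le _ _ _ mu _ _ c _ _ c0) _.
- exact: measurable_funB.
- exact: measurable_funD.
have h2 : \int[mu]_x ((UT_indic mu (sval T) A x + UT_indic mu (sval T0) A x) ^+ 2)%:E
    <= (4 * fine (mu A))%:E.
  apply: le_trans (integral_sqrD_le mu m1 m2) _.
  rewrite !integral_UT_indic_sqr// -(fineK fA) -!EFinM -EFinD lee_fin; lra.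
apply: (@le_trans _ _ ((c / 2)%:E * (e' / c)%:E + (c^-1 / 2)%:E * (4 * fine (mu A))%:E)).
  by apply: leeD; rewrite lee_pmul2l// lte_fin divr_gt0// invr_gt0.
rewrite -!EFinM -EFinD lee_fin.
have -> : (c / 2 * (e' / c) = e' / 2)%R by field; exact: lt0r_neq0.
have ccE : (c * e' = 4 * fine (mu A) + 1)%R by rewrite /c divfK// gt_eqF.
have cV : (c^-1 * (4 * fine (mu A) + 1) = e')%R by rewrite -ccE mulKf// gt_eqF.
have : (0 < c^-1)%R by rewrite invr_gt0.
move: (c^-1)%R cV => ci; nra.
Qed.

Lemma rat_rect_fin (phi : X -> R) (W : (set X)^nat) i :
  measurable_fun setT phi -> (forall n, measurable (W n)) ->
  (forall n, mu (W n) < +oo) -> m (rat_rect phi W i) < +oo.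
Proof.
move=> mphi mW Wfin.
have mWq : measurable (W i.1.2 `&` [set x | phi x <= ratr i.1.1]%R).
  apply: measurableI => //; rewrite -[X in measurable X]setTI.
  exact: measurable_fun_ler.
rewrite /rat_rect product_measure1E//; last first.
  by rewrite [X in measurable X](_ : _ = `]-oo, ratr i.2]%classic).
rewrite lte_mul_pinfty ?ge0_fin_numE//.
  by apply: le_lt_trans (Wfin i.1.2); apply: le_measure; rewrite ?inE.
by rewrite [X in X < _](exp_measureNyc (ratr i.2)) ltry.
Qed.

Lemma near_maharam_inv (T0 : aut2_top mu) (g : X * R -> R) (e : R) :
  @standard_borel d X R ->
  measurable_fun setT g -> m.-integrable setT (EFin \o g) -> (0 < e)%R ->
  \forall T \near T0,
  \int[m]_p `|g (maharam_inv mu (sval T) p) - g (maharam_inv mu (sval T0) p)|%:E <= e%:E.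
Proof.
move=> [phi [phi_inj [mphi phi_img]]] mg gi.
have phiE A : measurable A -> exists2 B, measurable B & A = phi @^-1` B.
  move=> mA; exists (phi @` A); first exact: phi_img.
  by apply/seteqP; split => [x Ax|x [y Ay /phi_inj <-]]//; exists x.
have [W [mW Wfin ndW WT]] := sigma_finite_nd mu.
have [w [ndw wT]] := rat_rect_cover phi ndW WT.
have mWq n (q : rat) : measurable (W n `&` [set x | phi x <= ratr q]%R).
  apply: measurableI => //; rewrite -[X in measurable X]setTI.
  exact: measurable_fun_ler.
have Wqfin n (q : rat) : mu (W n `&` [set x | phi x <= ratr q]%R) < +oo.
  apply: le_lt_trans (Wfin n); apply: le_measure; rewrite ?inE//.
have pres (T : aut2_top mu) (A : set (X * R)) : measurable A ->
    m (maharam_inv mu (sval T) @^-1` A) = m A.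
  have aT := svalP T => mA.
  have mVA : measurable (maharam_inv mu (sval T) @^-1` A).
    by apply: measurable_preimage => //; exact: measurable_maharam_inv.
  apply: etrans (esym (maharam_preserves muT aT mVA)) _.
  by congr (_ _); apply/seteqP; split => p /=; rewrite (maharamK aT.1).
have mV (T : aut2_top mu) := measurable_maharam_inv muT (svalP T).
have Gfin A : range (rat_rect phi W) A -> m A < +oo.
  by move=> [i _ <-]; exact: rat_rect_fin.
have Gc A : range (rat_rect phi W) A -> forall e' : R, (0 < e')%R ->
    \forall T \near T0, \int[m]_p `|(\1_A (maharam_inv mu (sval T) p) : R) -
      \1_A (maharam_inv mu (sval T0) p)|%:E <= e'%:E.
  by move=> [i _ <-] e' e'0; exact: near_maharam_inv_ray.
have H := (@L1_continuity _ _ _ m _ (nbhs T0) _ _ _ mV pres (mV T0) (pres T0)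
  _ _ (measurable_prod_rat_rect mphi phiE mW WT) (@setI_closed_rat_rect _ _ _ phi _ ndW)
  (fun n => ex_intro2 _ _ (w n) I erefl) wT ndw Gfin Gc g mg gi).

move=> e0; exact: H.
Qed.

End maharam_continuity.

Section gdelta.
Context d (X : measurableType d) (R : realType).
Variable mu : {sigma_finite_measure set X -> \bar R}.
Hypothesis muT : mu setT = +oo%E.
Hypothesis sbX : @standard_borel d X R.
Local Open Scope ereal_scope.
Notation m := (mu \x (@exp_measure R)).

(** An invariant set of [T] lifts to the cylinder over it, which is invariant for the extension;
    nullity descends because the line has nonzero [exp_measure]. *)
Lemma ergodic_III1E (T : X -> X) : Aut2 mu T ->
  ergodic_III1 mu T <-> ergodic m (maharam mu T).
Proof.
move=> aT; split=> [[_ eT] A mA TA|eT].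
  by have := eT A mA TA; rewrite !maharam_measureE//; exact: measurableC.
split=> [A mA TA|A mA TA]; last first.
  by rewrite !maharam_measureE//; [exact: eT|exact: measurableC].
have mAR : measurable (A `*` setT : set (X * R)) by exact: measurableX.
have exp0 : @exp_measure R setT != 0.
  apply/eqP => e0; have : exp_measure `]-oo, 0%R]%classic <= @exp_measure R setT.
    by apply: le_measure; rewrite ?inE.
  by rewrite e0 exp_measureNyc expR0 lee_fin ler10.
have mulE (B : set X) : measurable B -> m (B `*` setT) = 0 -> mu B = 0.
  move=> mB; rewrite product_measure1E// => /eqP.
  by rewrite mule_eq0 (negbTE exp0) orbF => /eqP.
have TAR : maharam mu T @^-1` (A `*` setT) = A `*` setT.
  apply/seteqP; split => -[x y] [/= h _]; split => //; move: h.
    by rewrite -{2}TA.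
  by rewrite -{1}TA.
have [h|h] := eT _ mAR TAR; first by left; exact: (mulE _ mA h).
right; apply: (mulE _ (measurableC mA)).
rewrite -h; congr (_ _); apply/seteqP; split => -[x y] /=.
  by move=> [nA _] [].
by move=> h'; split => // Ax; apply: h'.
Qed.

(** One and the same [g] serves near [T0]: the error changes by the L1-distance between [g] composed
    with the two inverses, kept below half of the margin left by the strict inequality. *)
Lemma open_approx_coboundary (f : X * R -> R) (e : R) :
  measurable_fun setT f -> m.-integrable setT (EFin \o f) ->
  open [set T : aut2_top mu | exists g : X * R -> R,
    [/\ measurable_fun setT g, m.-integrable setT (EFin \o g) &
     \int[m]_p `|f p - g p + g (maharam_inv mu (sval T) p)|%:E < e%:E]].
Proof.
move=> mf fi; rewrite openE => T0 [g [mg gi ge]].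
have mcomp (T : aut2_top mu) : measurable_fun setT (fun p => g (maharam_inv mu (sval T) p)).
  apply: (measurableT_comp mg); exact: (measurable_maharam_inv muT (svalP T)).
have mI (T : aut2_top mu) : measurable_fun setT
    (fun p => `|f p - g p + g (maharam_inv mu (sval T) p)|%:E).
  apply/measurable_EFinP/measurableT_comp => //.
  by apply: measurable_funD => //; exact: measurable_funB.
have fin : \int[m]_p `|f p - g p + g (maharam_inv mu (sval T0) p)|%:E \is a fin_num.
  by rewrite ge0_fin_numE ?integral_ge0// (lt_trans ge)// ltry.
pose r := fine (\int[m]_p `|f p - g p + g (maharam_inv mu (sval T0) p)|%:E).
have re : (0 < (e - r) / 2)%R.
  by rewrite divr_gt0// subr_gt0 -lte_fin fineK.
have := @near_maharam_inv _ X R mu muT T0 g _ sbX mg gi re.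
apply: filterS => T hT; exists g; split => //.
have mD : measurable_fun setT (fun p => `|g (maharam_inv mu (sval T) p) -
    g (maharam_inv mu (sval T0) p)|%:E).
  by apply/measurable_EFinP/measurableT_comp => //; exact: measurable_funB.
apply: (@le_lt_trans _ _ (\int[m]_p (`|f p - g p + g (maharam_inv mu (sval T0) p)|%:E +
   `|g (maharam_inv mu (sval T) p) - g (maharam_inv mu (sval T0) p)|%:E))).
  apply: ge0_le_integral => //; first exact: emeasurable_funD.
  move=> p _; rewrite -EFinD lee_fin.
  set a := g p; set b := g _; set c := g _.
  have -> : (f p - a + b = (f p - a + c) + (b - c))%R by lra.
  exact: ler_normD.
rewrite ge0_integralD// -(fineK fin) -/r.
apply: (@le_lt_trans _ _ (r%:E + ((e - r) / 2)%:E)); first exact: leeD.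
by rewrite -EFinD lte_fin; move: re; lra.
Qed.

Lemma Gdelta_Erg_III1 : Gdelta (Erg_III1_2 mu).
Proof.
have [phi [phi_inj [mphi phi_img]]] := sbX.
have phiE A : measurable A -> exists2 B, measurable B & A = phi @^-1` B.
  move=> mA; exists (phi @` A); first exact: phi_img.
  by apply/seteqP; split => [x Ax|x [y Ay /phi_inj <-]]//; exists x.
have [W [mW Wfin ndW WT]] := sigma_finite_nd mu.
have [w [ndw wT]] := rat_rect_cover phi ndW WT.
pose I : Type := ((rat * nat * rat) * (rat * nat * rat) * nat)%type.
have mr i := measurable_rat_rect mphi mW i.
have rfin i := rat_rect_fin i mphi mW Wfin.
pose f (i : I) := balanced_indic m (rat_rect phi W i.1.1) (rat_rect phi W i.1.2).
pose O (i : I) := [set T : aut2_top mu | exists g : X * R -> R,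
    [/\ measurable_fun setT g, m.-integrable setT (EFin \o g) &
     \int[m]_p `|f i p - g p + g (maharam_inv mu (sval T) p)|%:E < (i.2.+1%:R^-1)%:E]].
(* The countable index set is enumerated by codes; an integer that codes nothing imposes no
   condition. *)
exists (fun n => if unpickle n is Some i then O i else setT).
  move=> n; case: unpickle => [i|]; last exact: openT.
  have [mf fi] := integrable_balanced_indic (mr i.1.1) (mr i.1.2) (rfin i.1.1) (rfin i.1.2).
  exact: open_approx_coboundary.
apply/seteqP; split => [T /= eT n _|T hT].
  have aT := svalP T; case: unpickle => [[[i j] k]|//].
  move: eT => /(ergodic_III1E aT) eT.
  (* The precision [1 / (k + 2)] turns the large inequality of [approx_coboundary] into the strict
     one at [1 / (k + 1)]. *)
  have k0 : (0 < (k.+2%:R : R)^-1)%R by rewrite invr_gt0.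
  have [g [mg gi ge]] := approx_coboundary_of_ergodic (maharamK aT.1) (maharam_invK aT.1)
    (measurable_maharam muT aT) (measurable_maharam_inv muT aT)
    (fun A mA => maharam_preserves muT aT mA) (mr i) (mr j) (rfin i) (rfin j) eT k0.
  exists g; split => //; apply: le_lt_trans ge _.
  by rewrite lte_fin ltf_pV2 ?posrE ?ltr0n// ltr_nat.
have aT := svalP T; apply/(ergodic_III1E aT).
have mS := measurable_maharam muT aT; have mV := measurable_maharam_inv muT aT.
have mpS A (mA : measurable A) := maharam_preserves muT aT mA.
refine (@ergodic_of_coboundaries _ _ _ m _ _ (maharamK aT.1) (maharam_invK aT.1)
  mV mpS (range (rat_rect phi W)) (rat_rect phi W \o w)
  (measurable_prod_rat_rect mphi phiE mW WT) (@setI_closed_rat_rect _ _ _ phi _ ndW)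
  (fun n => ex_intro2 _ _ (w n) Logic.I erefl) wT _ _).
  by move=> _ [i _ <-]; exact: rfin.
move=> _ _ [i _ <-] [j _ <-] e e0.
have := hT (pickle ((i, j), Num.truncn e^-1)) Logic.I; rewrite pickleK => -[g [mg gi ge]].
exists g; split => //; apply: ltW; apply: lt_le_trans ge _.
rewrite lee_fin -[leRHS]invrK lef_pV2 ?posrE ?ltr0n ?invr_gt0//.
by rewrite ltW// truncnS_gt.
Qed.

End gdelta.

(** * An odometer of type III_1 *)

Section renormalization.
Context (R : realType).
Local Open Scope ereal_scope.
Notation lam := (@leb R \x @exp_measure R).
Notation box u v t := (`[u%R, v%R[ `*` `]-oo, t%R] : set (R * R)).

Lemma measurable_box (u v t : R) : measurable (box u v t).
Proof. by apply: measurableX. Qed.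

(** The affine map contributes its ratio [a], the translation of the fibre [expR (- s)]. For the
    three cylinders the product is always [6^-1], which makes the renormalized masses comparable. *)
Lemma box_piece (E E' : set (R * R)) (a c s u t : R) :
  measurable E -> measurable E' -> (0 < a)%R -> (u <= 1)%R ->
  {ae leb, forall b : R, (0 <= b < 1)%R -> forall y, E' (b, y) <-> E ((a * b + c)%R, (y - s)%R)} ->
  lam (E `&` box c (a * u + c) t) = (a * expR (- s))%:E * lam (E' `&` box 0 u (t + s)).
Proof.
move=> mE mE' a0 u1 EE'.
have m1 : measurable (E `&` box c (a * u + c) t).
  by apply: measurableI => //; exact: measurable_box.
have m2 : measurable (E' `&` box 0 u (t + s)).
  by apply: measurableI => //; exact: measurable_box.
have s1 := measurable_fun_xsection exp_measure m1.
have s2 := measurable_fun_xsection exp_measure m2.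
apply: etrans (ge0_integral_affine c a0 s1 (fun=> measure_ge0 _ _)) _.
rewrite EFinM -muleA; congr (_ * _).
have e0 : 0 <= (expR (- s))%:E :> \bar R by rewrite lee_fin expR_ge0.
have := @ge0_integralZl _ _ R (@leb R) setT measurableT _ s2 _ (fun _ _ => measure_ge0 _ _) e0.
move=> s2Z; apply: etrans _ s2Z.
apply: ge0_ae_eq_integral => //=.
- apply: (measurableT_comp s1).
  by apply: measurable_funD => //; exact: mulrl_measurable.
- exact: measurable_funeM.
- by move=> b _; rewrite mule_ge0// lee_fin expR_ge0.
apply: filterS EE' => b hb _.
rewrite -exp_measure_shift//; last exact: measurable_xsection.
congr (_ _); apply/seteqP; split => y; rewrite /= /xsection/= !inE/= !in_itv/=.
  move=> [Ey [/andP[l1 l2] yt]].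
  have b0 : (0 <= b)%R by rewrite -(pmulr_rge0 _ a0); move: l1; lra.
  have bu : (b < u)%R by rewrite -(ltr_pM2l a0); move: l2; lra.
  have b01 : (0 <= b < 1)%R by rewrite b0 (lt_le_trans bu).
  rewrite opprK; split; last by rewrite b0 bu lerD2r yt.
  by apply/(hb b01); rewrite addrK.
rewrite opprK => -[Ey [/andP[b0 bu]]]; rewrite lerD2r => yt.
have b01 : (0 <= b < 1)%R by rewrite b0 (lt_le_trans bu).
move/(hb b01): Ey; rewrite addrK; split => //; split => //.
by rewrite lerDr (mulr_ge0 (ltW a0))//= ltrD2r ltr_pM2l.
Qed.


Lemma box_cat (E : set (R * R)) (u v w t : R) : measurable E -> (u <= v)%R -> (v <= w)%R ->
  lam (E `&` box u w t) = lam (E `&` box u v t) + lam (E `&` box v w t).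
Proof.
move=> mE uv vw; rewrite -measureU; last first.
  apply/seteqP; split => -[b y] //= [[_ [+ _]] [_ [+ _]]].
  by rewrite !in_itv/= => /andP[_ bv] /andP[vb _]; move: (lt_le_trans bv vb); rewrite ltxx.
- by apply: measurableI => //; exact: measurable_box.
- by apply: measurableI => //; exact: measurable_box.
congr (lam _); apply/seteqP; split => -[b y] /=; rewrite !in_itv/=.
  move=> [Ey [/andP[ub bw] yt]]; case: (ltP b v) => bv.
    by left; rewrite ub.
  by right; rewrite bw.
move=> [[Ey [/andP[ub bw] yt]]|[Ey [/andP[ub bw] yt]]]; split => //; split => //.
  by rewrite ub (lt_le_trans bw).
by rewrite bw (le_trans uv).
Qed.

Lemma lam_box (x t : R) : (0 <= x)%R -> lam (box 0 x t) = (x * expR t)%:E.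
Proof.
move=> x0; rewrite product_measure1E//= exp_measureNyc EFinM; congr (_ * _).
by rewrite /leb lebesgue_measure_itv/= lte_fin -EFinB subr0; case: ltgtP x0 => // <-.
Qed.

Fact mass_key : unit. Proof. exact: tt. Qed.
(** Locked so that its values remain opaque real numbers in the arithmetic below. *)
Definition mass (E : set (R * R)) (x t : R) : R :=
  locked_with mass_key (fine (lam (E `&` box 0 x t))).

Lemma mass_fine E x t : mass E x t = fine (lam (E `&` box 0 x t)).
Proof. by rewrite /mass unlock. Qed.

Lemma massE (E : set (R * R)) (x t : R) : measurable E -> (0 <= x)%R ->
  lam (E `&` box 0 x t) = (mass E x t)%:E.
Proof.
move=> mE x0; rewrite mass_fine fineK// ge0_fin_numE//.
have : lam (box 0 x t) < +oo by rewrite lam_box// ltry.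
apply: le_lt_trans; apply: le_measure; rewrite ?inE//; last exact: measurable_box.
by apply: measurableI => //; exact: measurable_box.
Qed.

Lemma mass_ge0 (E : set (R * R)) (x t : R) : (0 <= mass E x t)%R.
Proof. by rewrite mass_fine fine_ge0. Qed.

Lemma le_mass (E : set (R * R)) (x s t : R) : measurable E -> (0 <= x)%R -> (s <= t)%R ->
  (mass E x s <= mass E x t)%R.
Proof.
move=> mE x0 st.
have mB u : measurable (E `&` box 0 x u) by apply: measurableI => //; exact: measurable_box.
have sub : E `&` box 0 x s `<=` E `&` box 0 x t.
  move=> [b y] [Eb [h ys]]; split => //; split => //; move: ys; rewrite /= !in_itv/=.
  by move=> /le_trans; apply.
have : lam (E `&` box 0 x s) <= lam (E `&` box 0 x t).
  by apply: le_measure sub; rewrite inE; exact: mB.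
by rewrite (massE s mE x0) (massE t mE x0) lee_fin.
Qed.

Lemma massC (E : set (R * R)) (x t : R) : measurable E -> (0 <= x)%R ->
  (mass (~` E) x t = x * expR t - mass E x t)%R.
Proof.
move=> mE x0; have mE' := measurableC mE.
have mB F : measurable F -> measurable (F `&` box 0 x t).
  by move=> mF; apply: measurableI => //; exact: measurable_box.
have eE : lam (E `&` box 0 x t) + lam (~` E `&` box 0 x t) = (x * expR t)%:E.
  rewrite -(lam_box t x0) -measureU; [|exact: mB..|].
    by rewrite -setIUl setUv setTI.
  by rewrite setIACA setICr set0I.
move: eE; rewrite (massE t mE x0) (massE t mE' x0).
move: (mass E x t) (mass (~` E) x t) => a b [<-].
by rewrite addrAC subrr add0r.
Qed.

(* Along the odometer, an invariant set of the Maharam extension looks the same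
   over the three cylinders of length one, up to the shifts [ln 2] and [ln 3]. *)
Definition renorm (E E' : set (R * R)) : Prop :=
  {ae leb, forall b : R, (0 <= b < 1)%R -> forall y,
    [/\ E' (b, y) <-> E (6^-1 * b + 0, y - 0)%R,
        E' (b, y) <-> E (3^-1 * b + 6^-1, y - ln 2)%R &
        E' (b, y) <-> E (2^-1 * b + 2^-1, y - ln 3)%R]}.

Section renorm_mass.
Variables (E E' : set (R * R)).
Hypotheses (mE : measurable E) (mE' : measurable E') (EE' : renorm E E').

Let piece (a c s u v t : R) : (0 < a)%R -> (u <= 1)%R ->
  {ae leb, forall b : R, (0 <= b < 1)%R -> forall y, E' (b, y) <-> E ((a * b + c)%R, (y - s)%R)} ->
  (0 <= u)%R -> v = (a * u + c)%R -> (a * expR (- s) = 6^-1)%R ->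
  lam (E `&` box c v t) = (6^-1 * mass E' u (t + s))%:E.
Proof.
move=> a0 u1 h u0 -> as6.
by rewrite (@box_piece E E' a c s u t)// massE// as6 EFinM.
Qed.

Let piece1 (u v t : R) : (0 <= u <= 1)%R -> v = (u / 6)%R ->
  lam (E `&` box 0 v t) = (6^-1 * mass E' u t)%:E.
Proof.
move=> /andP[u0 u1] ->; rewrite -[X in mass E' u X]addr0; apply: (@piece 6^-1) => //.
- by have := EE'; rewrite /renorm; apply: filterS => b h b01 y; case: (h b01 y).
- by rewrite addr0 mulrC.
- by rewrite oppr0 expR0 mulr1.
Qed.

Let piece2 (u v t : R) : (0 <= u <= 1)%R -> v = (u / 3 + 6^-1)%R ->
  lam (E `&` box 6^-1 v t) = (6^-1 * mass E' u (t + ln 2))%:E.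
Proof.
move=> /andP[u0 u1] ->; apply: (@piece 3^-1) => //.
- by have := EE'; rewrite /renorm; apply: filterS => b h b01 y; case: (h b01 y).
- by rewrite mulrC.
- by rewrite expRN lnK ?posrE//; lra.
Qed.

Let piece3 (u v t : R) : (0 <= u <= 1)%R -> v = (u / 2 + 2^-1)%R ->
  lam (E `&` box 2^-1 v t) = (6^-1 * mass E' u (t + ln 3))%:E.
Proof.
move=> /andP[u0 u1] ->; apply: (@piece 2^-1) => //.
- by have := EE'; rewrite /renorm; apply: filterS => b h b01 y; case: (h b01 y).
- by rewrite mulrC.
- by rewrite expRN lnK ?posrE//; lra.
Qed.

(** This formula and the next two cut [[0, x[] at 1/6 and 1/2: a full cylinder contributes
    [mass E' 1], shifted, and the last one a part of length [u] of it. *)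
Lemma mass_renorm1 (u t : R) : (0 <= u <= 1)%R -> mass E (u / 6) t = (6^-1 * mass E' u t)%R.
Proof. by move=> u01; rewrite [LHS]mass_fine (piece1 _ u01). Qed.

Lemma mass_renorm2 (u t : R) : (0 <= u <= 1)%R ->
  mass E (u / 3 + 6^-1) t = (6^-1 * (mass E' 1 t + mass E' u (t + ln 2)))%R.
Proof.
move=> u01; have /andP[u0 u1] := u01; rewrite [LHS]mass_fine (@box_cat _ 0 6^-1)//; [|lra..].
by rewrite (@piece1 1)// ?(@piece2 u)// ?lexx ?ler01// -?EFinD/= -?mulrDr//; lra.
Qed.

Lemma mass_renorm3 (u t : R) : (0 <= u <= 1)%R ->
  mass E (u / 2 + 2^-1) t =
    (6^-1 * (mass E' 1 t + mass E' 1 (t + ln 2) + mass E' u (t + ln 3)))%R.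
Proof.
move=> u01; have /andP[u0 u1] := u01; rewrite [LHS]mass_fine (@box_cat _ 0 6^-1)//; [|lra..].
rewrite (@box_cat _ 6^-1 2^-1)//; [|lra..].
rewrite (@piece1 1)// ?(@piece2 1)// ?(@piece3 u)// ?lexx ?ler01//; [|lra..].
move: (mass E' 1 t) (mass E' 1 (t + ln 2)) (mass E' u (t + ln 3)) => a b c.
by rewrite -!EFinD/=; ring.
Qed.

End renorm_mass.

End renormalization.

(** * Bounded harmonic functions with steps ln 2 and ln 3 *)

Section harmonic.
Context (R : realType) (J : Type) (K : set J) (e : J -> R -> R).
Hypothesis e01 : forall j t, K j -> 0 <= e j t <= 1.
Hypothesis avg : forall j, K j -> exists2 j', K j' &
  forall t, 6 * e j t = e j' t + 2 * e j' (t + ln 2) + 3 * e j' (t + ln 3).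

(* An almost maximal increment at [t] is an average of increments one generation
   later, each of which must then be almost maximal too; iterating produces
   arbitrarily long runs of almost maximal consecutive increments, which is
   impossible for a bounded function unless the maximal increment is [<= 0]. *)
Lemma harmonic_nonincreasing (s : R) (j : J) (t : R) : s = ln 2 \/ s = ln 3 ->
  K j -> e j (t + s) <= e j t.
Proof.
move=> s23 Kj; pose S' := [set x | exists i u, K i /\ x = e i (u + s) - e i u].
have supS : has_sup S'.
  split; first by exists (e j (t + s) - e j t), j, t.
  exists 1 => _ [i [u [Ki ->]]].
  by have := e01 u Ki; have := e01 (u + s) Ki; lra.
have leM i u : K i -> e i (u + s) - e i u <= sup S'.
  by move=> Ki; apply: sup_ubound; [case: supS|exists i, u].
rewrite -subr_le0; apply: le_trans (leM _ _ Kj) _; rewrite leNgt; apply/negP => M0.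
pose M := sup S'.
(* The smallest weight of the average is [1/6], so a deficit [h] from the supremum becomes at most
   [6 * h] in each term one generation later. *)
have run n : forall i u (h : R), K i -> M - h < e i (u + s) - e i u ->
    exists2 i', K i' & forall k, (k <= n)%N ->
      M - 6 ^+ n * h < e i' (u + k.+1%:R * s) - e i' (u + k%:R * s).
  elim: n => [|n IH] i u h Ki hi.
    exists i => // k; rewrite leqn0 => /eqP ->.
    by rewrite expr0 !mul1r mul0r addr0.
  have [i1 Ki1 hi1] := IH _ _ _ Ki hi; have [i2 Ki2 i12] := avg Ki1.
  exists i2 => // k; rewrite leq_eqVlt exprS => /orP[/eqP ->|]; last first.
    rewrite ltnS => kn; have := hi1 _ kn; have := i12 (u + k.+1%:R * s); have := i12 (u + k%:R * s).
    have := leM _ (u + k%:R * s + ln 2) Ki2; have := leM _ (u + k%:R * s + ln 3) Ki2.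
    rewrite -/M (addrAC _ (ln 2)) (addrAC _ (ln 3)).
    have -> : u + k%:R * s + s = u + k.+1%:R * s by rewrite -natr1; ring.
    lra.
  (* The run gains an increment at its end: it is the last one shifted by [s], and [s] is itself one
     of the steps of the average. *)
  have := hi1 _ (leqnn n); have := i12 (u + n.+1%:R * s); have := i12 (u + n%:R * s).
  have := leM _ (u + n%:R * s) Ki2.
  have := leM _ (u + n%:R * s + ln 2) Ki2; have := leM _ (u + n%:R * s + ln 3) Ki2.
  have e2 : u + n%:R * s + s = u + n.+1%:R * s by rewrite -natr1; ring.
  have e3 : u + n.+1%:R * s + s = u + n.+2%:R * s by rewrite -[n.+2%:R]natr1; ring.
  have Mh : M - 6 ^+ n * h < M.
    by have := hi1 _ (leqnn n); have := leM _ (u + n%:R * s) Ki1; rewrite e2 -/M; lra.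
  have h0 : 0 < 6 ^+ n * h by move: Mh; lra.
  rewrite -/M -e3 -e2; move: (u + n%:R * s) => p.
  rewrite !(addrAC _ _ s); case: s23 => ->; lra.
(* [n.+1] consecutive increments above [M / 2] add up to more than [1], beyond the range of [e]. *)
pose n := Num.truncn (2 / M).
have n2 : 2 < n.+1%:R * M.
  by rewrite -ltr_pdivrMr// truncnS_gt.
pose h := M / 2 / 6 ^+ n.
have h0 : 0 < h by rewrite !divr_gt0// exprn_gt0.
have [_ [i [u [Ki ->]]] hi] := sup_adherent h0 supS.
have [i' Ki' hi'] := run n _ _ _ Ki hi.
have hM : M - 6 ^+ n * h = M / 2.
  by rewrite /h mulrC divfK ?expf_neq0//; lra.
have climb k : (k <= n.+1)%N -> e i' u + k%:R * (M / 2) <= e i' (u + k%:R * s).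
  elim: k => [|k IH] kn; first by rewrite !mul0r !addr0.
  have := hi' k kn; have := IH (ltnW kn); rewrite hM -[k.+1%:R in X in _ -> _ -> X <= _]natr1.
  by rewrite (mulrDl _ 1 (M / 2)) mul1r; lra.
have := climb _ (leqnn _); have := e01 (u + n.+1%:R * s) Ki'; have := e01 u Ki'.
rewrite mulrA; move: n2; lra.
Qed.

End harmonic.

Section periods.
Context (R : realType) (e : R -> R).
Hypothesis e2 : forall t, e (t + ln 2) = e t.
Hypothesis e3 : forall t, e (t + ln 3) = e t.

Let P : set R := [set s | forall t, e (t + s) = e t].

Let PB a b : P a -> P b -> P (a - b).
Proof. by move=> Pa Pb t; rewrite -(Pb (t + (a - b))) addrA subrK Pa. Qed.

Let PMn a n : P a -> P (a *+ n).
Proof.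
by move=> Pa; elim: n => [|n IH] t; [rewrite mulr0n addr0|rewrite mulrSr addrA Pa IH].
Qed.

Let PN a : P a -> P (- a).
Proof. by move=> Pa t; rewrite -(Pa (t - a)) subrK. Qed.

Let PMz a (n : int) : P a -> P (a *~ n).
Proof.
move=> Pa; case: n => n; first exact: PMn.
by rewrite NegzE mulrNz; exact/PN/PMn.
Qed.

Lemma pow2_neq_pow3 (m n : nat) : (0 < m)%N -> (2 ^ m)%N <> (3 ^ n)%N.
Proof.
by move=> m0 /(congr1 odd); rewrite !oddX/= orbT; case: m m0.
Qed.

(** A group of periods bounded away from [0] is cyclic; [ln 2] and [ln 3] would be multiples of one
    period, and a power of 2 would equal a power of 3. *)
Lemma small_period (eps : R) : 0 < eps -> exists2 s, P s & 0 < s < eps.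
Proof.
move=> eps0; apply: contrapT => none.
have l2 : 0 < ln 2 :> R by rewrite ln_gt0//; lra.
have l3 : 0 < ln 3 :> R by rewrite ln_gt0//; lra.
pose A := [set s | P s /\ 0 < s].
have infA : has_inf A.
  split; first by exists (ln 2); split.
  exists eps => s [Ps s0]; rewrite leNgt; apply/negP => se.
  by apply: none; exists s => //; rewrite s0.
have g0 : 0 < inf A.
  apply: lt_le_trans eps0 _; apply: lb_le_inf; first by case: infA.
  move=> s [Ps s0]; rewrite leNgt; apply/negP => se.
  by apply: none; exists s => //; rewrite s0.
have leA s : A s -> inf A <= s by move=> As; apply: ge_inf => //; case: infA.
(* A period [s] below twice the infimum is enough: a nonzero remainder [r] modulo [s] would give two
   positive periods [r] and [s - r], each at least the infimum. *)
have [s [Ps s0] sg] := inf_adherent g0 infA.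
have mult a : P a -> 0 < a -> exists n : nat, a = s *+ n.
  move=> Pa a0; exists (Num.truncn (a / s)).
  have as0 : 0 <= a / s by rewrite divr_ge0// ltW.
  have := truncn_le (a / s); rewrite as0 ler_pdivlMr// mulr_natl => le1.
  have := truncnS_gt (a / s); rewrite ltr_pdivrMr// mulr_natl mulrSr.
  move: le1; set n := Num.truncn _ => le1 lt2.
  apply: contrapT => /eqP neq.
  have Pr : P (a - s *+ n) by apply: PB => //; exact: PMn.
  have r0 : 0 < a - s *+ n by rewrite subr_gt0 lt_neqAle eq_sym neq le1.
  have Psr : P (s - (a - s *+ n)) by exact: PB.
  have sr0 : 0 < s - (a - s *+ n) by move: lt2; lra.
  have := leA _ (conj Psr sr0); have := leA _ (conj Pr r0); move: sg; lra.
have [m m2] := mult _ e2 l2; have [n n3] := mult _ e3 l3.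
have m0 : (0 < m)%N by case: m m2 => // m2; move: l2; rewrite m2 mulr0n ltxx.
have n0 : (0 < n)%N by case: n n3 => // n3; move: l3; rewrite n3 mulr0n ltxx.
apply: (@pow2_neq_pow3 n m n0); apply/eqP; rewrite -(eqr_nat R) !natrX.
apply/eqP/ln_inj; rewrite ?posrE ?exprn_gt0//.
by rewrite !lnXn// m2 n3 -!mulrnA mulnC.
Qed.

(** A multiple of a small period brings [s] just below [t], where the growth bound costs a factor
    close to [1]. *)
Lemma periodic_constant : (forall t, 0 <= e t) ->
  (forall s t, s <= t -> expR (s - t) * e s <= e t) -> forall s t, e s = e t.
Proof.
move=> e0 ge; suff le s t : e s <= e t by move=> s t; apply/eqP; rewrite eq_le !le.
apply/ler_addgt0Pl => eta eta0; pose eps := eta / (e s + 1).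
have es1 : 0 < e s + 1 by rewrite ltr_wpDl.
have eps0 : 0 < eps by rewrite divr_gt0.
have [p Pp /andP[p0 pe]] := small_period eps0.
pose n := Num.floor ((t - s) / p).
have := floor_le_tmp ((t - s) / p); rewrite -/n ler_pdivlMr// => le1.
have := floorD1_gt ((t - s) / p); rewrite -/n ltr_pdivrMr// intrD mulrDl mul1r => lt2.
have es : e (s + n%:~R * p) = e s by rewrite mulrzl; exact: PMz.
have ut : s + n%:~R * p <= t by move: le1; lra.
have := ge _ _ ut; rewrite es => h.
have := expR_ge1Dx (s + n%:~R * p - t) => ex.
have epsE : eps * (e s + 1) = eta by rewrite /eps divfK// gt_eqF.
have ees : eps * e s <= eta by rewrite -epsE mulrDr mulr1 lerDl ltW.
have : (1 - eps) * e s <= expR (s + n%:~R * p - t) * e s.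
  by apply: ler_wpM2r => //; move: ex lt2 pe; lra.
move: h ees; lra.
Qed.

End periods.

(** * Invariant sets have product masses *)

Section renormalization_class.
Context (R : realType) (J : Type) (K : set J) (C : J -> J) (mass : J -> R -> R -> R).
Hypothesis mass_ge0 : forall E x t, 0 <= mass E x t.
Hypothesis le_mass : forall E s t, K E -> s <= t -> mass E 1 s <= mass E 1 t.
Hypothesis KC : forall E, K E -> K (C E).
Hypothesis massC : forall E x t, K E -> 0 <= x -> mass (C E) x t = x * expR t - mass E x t.
Hypothesis Kren : forall E, K E -> exists2 E', K E' & forall u t, 0 <= u <= 1 ->
  [/\ mass E (u / 6) t = 6^-1 * mass E' u t,
   mass E (u / 3 + 6^-1) t = 6^-1 * (mass E' 1 t + mass E' u (t + ln 2)) &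
   mass E (u / 2 + 2^-1) t =
     6^-1 * (mass E' 1 t + mass E' 1 (t + ln 2) + mass E' u (t + ln 3))].

(** The proportion of [E] in the box over [[0, 1[] below height [t], whose total mass is
    [expR t]. *)
Let e E (t : R) := expR (- t) * mass E 1 t.

Let h11 : 0 <= (1 : R) <= 1. Proof. by rewrite ler01 lexx. Qed.

Let half1 : 1 / 2 + 2^-1 = 1 :> R. Proof. by lra. Qed.

Let e01 E t : K E -> 0 <= e E t <= 1.
Proof.
move=> KE; rewrite /e mulr_ge0 ?expR_ge0 ?mass_ge0//= expRN mulrC ler_pdivrMr ?expR_gt0//.
by rewrite -subr_ge0 -massC.
Qed.

Let avg E : K E -> exists2 E', K E' &
  forall t, 6 * e E t = e E' t + 2 * e E' (t + ln 2) + 3 * e E' (t + ln 3).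
Proof.
move=> KE; have [E' KE' EE'] := Kren KE; exists E' => // t.
have [_ _] := EE' _ t h11; rewrite half1.
rewrite /e => ->; rewrite !opprD !expRD !expRN !lnK ?posrE//.
move: (expR t)^-1 (mass _ _ _) (mass _ _ _) (mass _ _ _) => a b c f.
by field.
Qed.

Let eC E t : K E -> e (C E) t = 1 - e E t.
Proof.
move=> KE; rewrite /e massC//.
by rewrite mul1r mulrBr -expRD addNr expR0.
Qed.

(** The increments are nonpositive for [E] and for its complement, and the two proportions add up to
    [1]. *)
Let e_period E t s : K E -> s = ln 2 \/ s = ln 3 -> e E (t + s) = e E t.
Proof.
move=> KE s23; apply/eqP; rewrite eq_le.
rewrite (harmonic_nonincreasing e01 avg t s23 KE)/=.
have := harmonic_nonincreasing e01 avg t s23 (KC KE); rewrite !eC//.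
by rewrite lerD2l lerN2.
Qed.

Let e_const E s t : K E -> e E s = e E t.
Proof.
move=> KE; apply: (@periodic_constant _ (e E)) => {s t}.
- by move=> t; apply: e_period => //; left.
- by move=> t; apply: e_period => //; right.
- by move=> t; have /andP[] := e01 t KE.
move=> s t st; rewrite /e mulrA -expRD.
have -> : s - t - s = - t by ring.
by apply: ler_wpM2l; [exact: expR_ge0|exact: le_mass].
Qed.

Let mass1E E t : K E -> mass E 1 t = e E 0 * expR t.
Proof.
by move=> KE; rewrite (e_const 0 t KE) /e mulrAC -expRD addNr expR0 mul1r.
Qed.

(** Full cylinders are exact by [mass1E]; only the incomplete one carries an error, which
    renormalization multiplies by the weight 1/6, 1/3 or 1/2 of that cylinder. *)
Let mass_approx n : forall E x t, K E -> 0 <= x <= 1 ->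
  `|mass E x t - e E 0 * x * expR t| <= 2^-1 ^+ n * expR t.
Proof.
elim: n => [|n IH] E x t KE /andP[x0 x1].
  rewrite expr0 mul1r ler_norml.
  have := mass_ge0 E x t; have := mass_ge0 (C E) x t; rewrite massC//.
  have /andP[] := e01 0 KE; move: (e E 0) (mass E x t) (expR t) (expR_gt0 t).
  move=> c m q q0 c0 c1 m1 m0.
  have xq0 : 0 <= x * q by rewrite mulr_ge0// ltW.
  have xq : x * q <= q by rewrite ger_pMl.
  have : 0 <= c * (x * q) <= x * q by rewrite mulr_ge0//= ler_piMl.
  by rewrite mulrA => /andP[h1 h2]; apply/andP; split; lra.
have [E' KE' EE'] := Kren KE.
have eE : e E' 0 = e E 0.
  have [_ _] := EE' _ 0 h11; rewrite half1 !mass1E// !add0r !lnK ?posrE// expR0.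
  move: (e E 0) (e E' 0) => a b; lra.
have q0 := expR_gt0 t.
have l2 : expR (t + ln 2) = expR t * 2 by rewrite expRD lnK// posrE.
have l3 : expR (t + ln 3) = expR t * 3 by rewrite expRD lnK// posrE.
have [x6|x6] := leP x 6^-1.
  have u01 : 0 <= 6 * x <= 1 by apply/andP; split; lra.
  have := IH E' _ t KE' u01.
  have [+ _ _] := EE' _ t u01; have -> : 6 * x / 6 = x by field.
  move=> ->; rewrite eE exprS.
  move: (e E 0) (2^-1 ^+ n) (mass _ _ _) (expR t) => c p m q.
  rewrite !ler_norml => /andP[h1 h2]; apply/andP; split; lra.
have [x2|x2] := leP x 2^-1.
  have u01 : 0 <= 3 * (x - 6^-1) <= 1 by apply/andP; split; lra.
  have := IH E' _ (t + ln 2) KE' u01.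
  have [_ + _] := EE' _ t u01; have -> : 3 * (x - 6^-1) / 3 + 6^-1 = x by field.
  move=> ->; rewrite (mass1E t KE') eE exprS l2.
  move: (e E 0) (2^-1 ^+ n) (mass _ _ _) (expR t) => c p m q.
  rewrite !ler_norml => /andP[h1 h2]; apply/andP; split; lra.
have u01 : 0 <= 2 * (x - 2^-1) <= 1 by apply/andP; split; lra.
have := IH E' _ (t + ln 3) KE' u01.
have [_ _] := EE' _ t u01; have -> : 2 * (x - 2^-1) / 2 + 2^-1 = x by field.
move=> ->; rewrite !(mass1E _ KE') eE exprS l3 l2.
move: (e E 0) (2^-1 ^+ n) (mass _ _ _) (expR t) => c p m q.
rewrite !ler_norml => /andP[h1 h2]; apply/andP; split; lra.
Qed.

Lemma mass_product E x t : K E -> 0 <= x <= 1 -> mass E x t = mass E 1 0 * x * expR t.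
Proof.
move=> KE x01; have -> : mass E 1 0 = e E 0 by rewrite /e oppr0 expR0 mul1r.
 apply/eqP; rewrite -subr_eq0 -normr_le0; apply/ler_addgt0Pl => eps eps0.
rewrite addr0; have [n nP] : exists n : nat, expR t / eps < n.+1%:R.
  by exists (Num.truncn (expR t / eps)); exact: truncnS_gt.
apply: le_trans (mass_approx n _ KE x01) _.
rewrite exprVn mulrC ler_pdivrMr ?exprn_gt0// mulrC -ler_pdivrMr//.
apply: ltW; apply: lt_le_trans nP _; rewrite -natrX ler_nat; exact: ltn_expl.
Qed.

End renormalization_class.

Section renormalizable_null.
Context (R : realType) (K : set (set (R * R))).
Hypothesis mK : forall E, K E -> measurable E.
Hypothesis KC : forall E, K E -> K (~` E).
Hypothesis Kren : forall E, K E -> exists2 E', K E' & renorm E E'.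
Local Open Scope ereal_scope.
Notation lam := (@leb R \x @exp_measure R).
Notation box u v t := (`[u%R, v%R[ `*` `]-oo, t%R] : set (R * R)).
Notation strip := (`[0%R, 1%R[ `*` setT : set (R * R)).

Let mass_prod E x t : K E -> (0 <= x <= 1)%R -> mass E x t = (mass E 1 0 * x * expR t)%R.
Proof.
move=> KE.
move=> x01; have h0 (F : set (R * R)) y u : (0 <= mass F y u)%R by exact: mass_ge0.
have h1 F (u v : R) : K F -> (u <= v)%R -> (mass F 1 u <= mass F 1 v)%R.
  by move=> KF uv; exact: (le_mass (mK KF) ler01 uv).
have h2 F (y u : R) : K F -> (0 <= y)%R -> (mass (~` F) y u = y * expR u - mass F y u)%R.
  by move=> KF y0; exact: (massC u (mK KF) y0).
have h3 F : K F -> exists2 F', K F' & forall u t : R, (0 <= u <= 1 ->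
   [/\ mass F (u / 6) t = 6^-1 * mass F' u t,
   mass F (u / 3 + 6^-1) t = 6^-1 * (mass F' 1 t + mass F' u (t + ln 2)) &
   mass F (u / 2 + 2^-1) t =
     6^-1 * (mass F' 1 t + mass F' 1 (t + ln 2) + mass F' u (t + ln 3))])%R.
  move=> KF; have [F' KF' FF'] := Kren KF; exists F' => // u v u01.
  have e1 := mass_renorm1 (mK KF) (mK KF') FF' v u01.
  have e2 := mass_renorm2 (mK KF) (mK KF') FF' v u01.
  have e3 := mass_renorm3 (mK KF) (mK KF') FF' v u01.
  exact: (And3 e1 e2 e3).
exact: (mass_product h0 h1 KC h2 h3 t KE x01).
Qed.

Let lam_box1 E u t : K E -> (0 <= u <= 1)%R ->
  lam (E `&` box u 1 t) = (mass E 1 0 * ((1 - u) * expR t))%:E.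
Proof.
move=> KE u01; have /andP[u0 u1] := u01.
have := box_cat t (mK KE) u0 u1; rewrite (massE t (mK KE) ler01) (massE t (mK KE) u0).
rewrite (mass_prod t KE u01) mass_prod ?lexx ?ler01//.
move: (mass E 1 0) (lam (E `&` box u 1 t)) => c [l||]//= [h].
by congr _%:E; apply: (@addrI _ (c * u * expR t)%R); rewrite -h; ring.
Qed.

Let lam_box1T u t : (0 <= u <= 1)%R -> lam (box u 1 t) = ((1 - u) * expR t)%:E.
Proof.
move=> /andP[u0 u1].
have := box_cat t (@measurableT _ (R * R)%type) u0 u1; rewrite !setTI !lam_box//.
move: (lam (box u 1 t)) => [l||]//= [h].
by congr _%:E; apply: (@addrI _ (u * expR t)%R); rewrite -h; ring.
Qed.

(** Product masses mean that [E] occupies the same proportion [c] of every box, hence of every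
    measurable part of the strip, including its own complement. *)
Lemma renorm_null E : K E -> lam (E `&` strip) = 0 \/ lam (~` E `&` strip) = 0.
Proof.
move=> KE; have mE := mK KE.
have mS : measurable (strip : set (R * R)) by exact: measurableX.
pose c := mass E 1 0; have c0 : (0 <= c)%R by exact: mass_ge0.
pose c' : {nonneg R} := NngNum c0.
(* With the coding [- x], the rational rectangles cut the strip in sets over [[u, 1[], closed on the
   left as the boxes are. *)
have mphi : measurable_fun setT (fun x : R => - x)%R by exact: measurableT_comp.
have phiE (A : set R) : measurable A ->
    exists2 B, measurable B & A = (fun x : R => - x)%R @^-1` B.
  move=> mA; exists ((fun x : R => - x)%R @^-1` A); first exact: measurable_preimage.
  by apply/seteqP; split => x /=; rewrite opprK.
pose W (n : nat) : set R := setT.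
have mW n : measurable (W n) by exact: measurableT.
have WT : \bigcup_n W n = setT by apply/seteqP; split => // x _; exists 0%N.
have ndW : nondecreasing_seq W by move=> i j ij; rewrite subsetEset.
have [w [ndw wT]] := rat_rect_cover (fun x : R => - x)%R ndW WT.
pose r := rat_rect (fun x : R => - x)%R W.
have rS i : exists u t, (0 <= u <= 1)%R /\ r i `&` strip = box u 1 t.
  exists (Num.min 1 (Num.max 0 (- ratr i.1.1)))%R, (ratr i.2); split.
    by rewrite ge_min le_min le_max !lexx ler01.
  apply/seteqP; split => -[b y] /=; rewrite /r /rat_rect/= !in_itv/=.
    move=> [[[_ bi] yi] [/andP[b0 b1] _]]; split => //.
    by rewrite ge_min ge_max b0 lerNl bi b1 orbT.
  move=> [/andP[+ b1] yi]; rewrite ge_min ge_max => /orP[b1'|/andP[b0 bi]].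
    by move: (lt_le_trans b1 b1'); rewrite ltxx.
  by rewrite b0 b1 -lerNl bi.
have cE A : measurable A -> lam (A `&` (E `&` strip)) = c%:E * lam (A `&` strip).
  move=> mA; have mES : measurable (E `&` strip) by exact: measurableI.
  pose m1 : {measure set (R * R) -> \bar R} := mrestr lam mES.
  pose m2 : {measure set (R * R) -> \bar R} := mscale c' (mrestr lam mS).
  have m12 : m1 A = m2 A.
    apply: (@measure_unique _ _ _ _ (r \o w) (measurable_prod_rat_rect mphi phiE mW WT)
      (@setI_closed_rat_rect _ _ _ _ _ ndW) (fun n => ex_intro2 _ _ (w n) Logic.I erefl) wT
      m1 m2) => //.
      move=> _ [i _ <-]; have [u [t [u01 ruE]]] := rS i.
      rewrite [LHS](_ : _ = lam (E `&` (r i `&` strip))); last first.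
        by rewrite setICA.
      rewrite [RHS](_ : _ = c%:E * lam (r i `&` strip))// ruE lam_box1// lam_box1T//.
    move=> n; have [u [t [u01 ruE]]] := rS (w n).
    rewrite [X in X < _](_ : _ = lam (E `&` (r (w n) `&` strip))).
      by rewrite ruE lam_box1// ltry.
    by rewrite setICA.
  exact: m12.
have [c00|cn0] := eqVneq c 0%R.
  by left; rewrite -[E `&` _]setTI cE// c00 mul0e.
right; have := cE _ (measurableC mE); rewrite setIA setICl set0I measure0 => /esym/eqP.
by rewrite mule_eq0 eqe (negbTE cn0) => /eqP.
Qed.

End renormalizable_null.

Section measurable_glue.
Context d d' (T : measurableType d) (Y : measurableType d').

Lemma measurable_fun_glue (N : T -> nat) (F : nat -> T -> Y) :
  (forall n, measurable [set x | N x = n]) -> (forall n, measurable_fun setT (F n)) ->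
  measurable_fun setT (fun x => F (N x) x).
Proof.
move=> mN mF _ A mA; rewrite setTI.
rewrite [X in measurable X](_ : _ = \bigcup_n ([set x | N x = n] `&` F n @^-1` A)).
  by apply: bigcupT_measurable => n; apply: measurableI => //; exact: measurable_preimage.
apply/seteqP; split => [x Ax|x [n _ [/= <-]]] //; by exists (N x).
Qed.

End measurable_glue.

Lemma measurable_truncn_eq d (T : measurableType d) (R : realType) (f : T -> R) n :
  measurable_fun setT f -> measurable [set x | Num.truncn (f x) = n].
Proof.
move=> mf.
have ge k : measurable [set x | (k <= Num.truncn (f x))%N].
  case: k => [|k]; first by rewrite [X in measurable X](_ : _ = setT)//; exact/seteqP.
  rewrite [X in measurable X](_ : _ = [set x | k.+1%:R <= f x]).
    by rewrite -[X in measurable X]setTI; exact: measurable_fun_ler.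
  apply/seteqP; split => x /= h; last by rewrite truncn_ge_nat// (le_trans _ h).
  have f0 : 0 <= f x.
    by move: (leq_ltn_trans (leq0n k) h); rewrite truncn_gt0; apply: le_trans.
  by rewrite -truncn_ge_nat.
rewrite [X in measurable X](_ : _ = [set x | (n <= Num.truncn (f x))%N] `\`
   [set x | (n.+1 <= Num.truncn (f x))%N]); first exact: measurableD.
apply/seteqP; split => x /=; first by move=> ->; rewrite ltnn.
by move=> [h1 /negP]; rewrite -leqNgt => h2; apply/eqP; rewrite eqn_leq h1 h2.
Qed.

(** * The odometer as a piecewise affine map *)

Section odometer.
Context (R : realType).

(* The odometer on ternary digits of weights 1/6, 1/3 and 1/2: it increments the
   first digit that is not maximal and resets the maximal ones before it. A point
   below [1 - 2^-n] has fewer than [n] leading maximal digits, so that [n] is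
   enough fuel. *)
Fixpoint odo_n (n : nat) (b : R) : R :=
  if n is m.+1 then
    if b < 6^-1 then 2 * b + 6^-1
    else if b < 2^-1 then 3 / 2 * b + 4^-1
    else odo_n m (2 * b - 1) / 6
  else 0.

(** The derivative of [odo_n]; on the last cylinder the chain rule gives the factor [2 / 6]. *)
Fixpoint slope_n (n : nat) (b : R) : R :=
  if n is m.+1 then
    if b < 6^-1 then 2
    else if b < 2^-1 then 3 / 2
    else slope_n m (2 * b - 1) / 3
  else 1.

(** The branches follow the images: the third cylinder goes into [[0, 1/6[], the first one onto
    [[1/6, 1/2[] and the second one onto [[1/2, 1[]. *)
Fixpoint odo_inv_n (n : nat) (c : R) : R :=
  if n is m.+1 then
    if c < 6^-1 then 2^-1 * odo_inv_n m (6 * c) + 2^-1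
    else if c < 2^-1 then (c - 6^-1) / 2
    else 2 / 3 * (c - 4^-1)
  else 0.

(** Enough fuel at distance [b] from the endpoint where the digits accumulate: this integer exceeds
    [b^-1], hence so does 2 to its power. *)
Definition odo_depth (b : R) : nat := (Num.truncn `|b|^-1).+1.

Definition odo (b : R) : R := odo_n (odo_depth (1 - b)) b.
Definition odo_slope (b : R) : R := slope_n (odo_depth (1 - b)) b.
Definition odo_inv (c : R) : R := odo_inv_n (odo_depth c) c.

Lemma odo_n_stable m n b : 0 <= b < 1 - 2^-1 ^+ n -> (n <= m)%N ->
  odo_n m b = odo_n n b /\ slope_n m b = slope_n n b.
Proof.
elim: n m b => [|n IH] m b; first by rewrite expr0 subrr => /andP[b0 /(le_lt_trans b0)]; rewrite ltxx.
case: m => // m /=; move=> /andP[b0]; rewrite exprS => b1 nm; case: ifPn => // b6; case: ifPn => // b2.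
have b01 : 0 <= 2 * b - 1 < 1 - 2^-1 ^+ n.
  by rewrite -leNgt in b2; move: b1 b2; move: (_ ^+ n) => p b1 b2; apply/andP; split; lra.
by have [-> ->] := IH m _ b01 nm.
Qed.

Lemma odo_inv_n_stable m n c : 6^-1 ^+ n <= c < 1 -> (n <= m)%N ->
  odo_inv_n m c = odo_inv_n n c.
Proof.
elim: n m c => [|n IH] [|m] c //=; first by rewrite expr0 => /andP[c0 /(le_lt_trans c0)]; rewrite ltxx.
move=> /andP[c0 c1] nm; case: ifPn => // c6.
rewrite (IH m)//; move: c0; rewrite exprS; move: (_ ^+ n) => p c0; apply/andP; split; lra.
Qed.

Lemma odo_depthP (p : R) (x : R) : 2 <= p -> 0 < x -> p^-1 ^+ odo_depth x < x.
Proof.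
move=> p2 x0; rewrite exprVn -[ltRHS]invrK ltf_pV2 ?posrE ?invr_gt0 ?exprn_gt0//; last lra.
rewrite -[X in X^-1]gtr0_norm//; apply: lt_trans (truncnS_gt _) _; rewrite -/(odo_depth x).
apply: (@lt_le_trans _ _ (2 ^+ odo_depth x)).
  by rewrite -natrX ltr_nat ltn_expl.
by apply: lerXn2r => //; rewrite nnegrE; lra.
Qed.

Lemma odoE n b : 0 <= b < 1 - 2^-1 ^+ n ->
  odo b = odo_n n b /\ odo_slope b = slope_n n b.
Proof.
move=> /andP[b0 bn]; have b1 : b < 1.
  by apply: lt_le_trans bn _; rewrite lerBlDr lerDl exprn_ge0.
have bd : 0 <= b < 1 - 2^-1 ^+ odo_depth (1 - b).
  by rewrite b0/= ltrBrDr -ltrBrDl; apply: odo_depthP => //; rewrite subr_gt0.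
rewrite /odo /odo_slope.
have [nd|/ltnW dn] := leqP n (odo_depth (1 - b)).
  by apply: odo_n_stable => //; rewrite b0.
by have [<- <-] := odo_n_stable bd dn.
Qed.

Lemma odo_invE n c : 6^-1 ^+ n <= c < 1 -> odo_inv c = odo_inv_n n c.
Proof.
move=> /andP[cn c1]; have c0 : 0 < c by apply: lt_le_trans cn; rewrite exprn_gt0.
have cd : 6^-1 ^+ odo_depth c <= c < 1.
  by rewrite c1 andbT ltW//; apply: odo_depthP => //; lra.
rewrite /odo_inv.
have [nd|/ltnW dn] := leqP n (odo_depth c).
  by apply: odo_inv_n_stable => //; rewrite cn.
by rewrite -(odo_inv_n_stable cd dn).
Qed.

Lemma lt1_exp (b : R) : b < 1 -> exists n, b < 1 - 2^-1 ^+ n.+1.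
Proof.
move=> b1; exists (Num.truncn `|1 - b|^-1); rewrite ltrBrDr -ltrBrDl.
by apply: odo_depthP => //; rewrite subr_gt0.
Qed.

Lemma odo1 b : 0 <= b < 6^-1 -> odo b = 2 * b + 6^-1 /\ odo_slope b = 2.
Proof.
move=> /andP[b0 b6]; have [|-> ->]/= := @odoE 1 b; last by rewrite b6.
by rewrite b0 expr1; lra.
Qed.

Lemma odo2 b : 6^-1 <= b < 2^-1 -> odo b = 3 / 2 * b + 4^-1 /\ odo_slope b = 3 / 2.
Proof.
move=> /andP[b6 b2]; have [|-> ->]/= := @odoE 1 b; last by rewrite b2 ltNge b6.
by apply/andP; rewrite expr1; split; lra.
Qed.

(** The self-similarity behind the renormalization: past a maximal first digit, the odometer acts on
    the remaining digits and resets the first. *)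
Lemma odo3 b : 0 <= b < 1 -> odo (2^-1 * b + 2^-1) = odo b / 6 /\
  odo_slope (2^-1 * b + 2^-1) = odo_slope b / 3.
Proof.
move=> /andP[b0 b1]; have [n bn] := lt1_exp b1.
have [|-> ->] := @odoE n.+2 (2^-1 * b + 2^-1).
  move: bn; rewrite (exprS _ n.+1); move: (2^-1 ^+ n.+1) => p bn.
  by apply/andP; split; lra.
have [|-> ->] := @odoE n.+1 b; first by rewrite b0.
have nE m x : odo_n m.+1 x = if x < 6^-1 then 2 * x + 6^-1 else
    if x < 2^-1 then 3 / 2 * x + 4^-1 else odo_n m (2 * x - 1) / 6 by [].
have sE m x : slope_n m.+1 x = if x < 6^-1 then 2 else
    if x < 2^-1 then 3 / 2 else slope_n m (2 * x - 1) / 3 by [].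
rewrite (nE n.+1 (2^-1 * b + 2^-1)) (sE n.+1 (2^-1 * b + 2^-1)) !ifF; last 4 first.
- by apply/negbTE; rewrite -leNgt; lra.
- by apply/negbTE; rewrite -leNgt; lra.
- by apply/negbTE; rewrite -leNgt; lra.
- by apply/negbTE; rewrite -leNgt; lra.
by have -> : 2 * (2^-1 * b + 2^-1) - 1 = b by lra.
Qed.

Lemma odo_bounds b : 0 <= b < 1 ->
  [/\ 0 < odo b, odo b < 1, 0 < odo_slope b & odo_inv (odo b) = b].
Proof.
move=> /andP[b0 b1]; have [n] := lt1_exp b1; move: n.+1 => {}n bn.
(* The explicit lower bound, rather than positivity, tells how much fuel [odo_inv] needs at
   [odo b]. *)
suff [h1 h2 h3 h4] : [/\ 6^-1 ^+ n <= odo b, odo b < 1, 0 < odo_slope b & odo_inv (odo b) = b].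
  by split => //; apply: lt_le_trans h1; rewrite exprn_gt0.
elim: n b b0 b1 bn => [|n IH] b b0 b1 bn.
  by move: bn; rewrite expr0 subrr => /(le_lt_trans b0); rewrite ltxx.
have p1 : 6^-1 ^+ n <= 1 :> R by rewrite exprn_ile1//; lra.
have [b6|b6] := ltP b 6^-1.
  have [|-> ->] := @odo1 b; first by rewrite b0.
  split; [|lra|lra|]; first by rewrite exprS; move: p1; move: (_ ^+ n) => p; lra.
  rewrite (@odo_invE 1)/=; last by rewrite expr1; apply/andP; split; lra.
  by rewrite ifF ?ifT; [field|lra|apply/negbTE; rewrite -leNgt; lra].
have [b2|b2] := ltP b 2^-1.
  have [|-> ->] := @odo2 b; first by rewrite b6.
  split; [|lra|lra|]; first by rewrite exprS; move: p1; move: (_ ^+ n) => p; lra.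
  rewrite (@odo_invE 1)/=; last by rewrite expr1; apply/andP; split; lra.
  by rewrite !ifF; [field|apply/negbTE; rewrite -leNgt; lra|apply/negbTE; rewrite -leNgt; lra].
have b'0 : 0 <= 2 * b - 1 by lra.
have b'1 : 2 * b - 1 < 1 by lra.
have b'n : 2 * b - 1 < 1 - 2^-1 ^+ n by move: bn; rewrite exprS; move: (_ ^+ n) => p; lra.
have [h1 h2 h3 h4] := IH _ b'0 b'1 b'n.
have [|] := @odo3 (2 * b - 1); first by rewrite b'0.
have -> : 2^-1 * (2 * b - 1) + 2^-1 = b by lra.
move=> -> ->; split.
- by rewrite exprS mulrC ler_pM2r.
- lra.
- by rewrite divr_gt0.
have q0 : 0 < odo (2 * b - 1) by apply: lt_le_trans h1; rewrite exprn_gt0.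
rewrite (@odo_invE n.+1); last by rewrite exprS mulrC ler_pM2r// h1/=; lra.
rewrite /= ifT; last lra.
have -> : 6 * (odo (2 * b - 1) / 6) = odo (2 * b - 1) by field.
by rewrite -(@odo_invE n) ?h4 ?h1//; lra.
Qed.

Lemma odo_invK c : 0 < c < 1 -> 0 <= odo_inv c < 1 /\ odo (odo_inv c) = c.
Proof.
move=> /andP[c0 c1].
have : 6^-1 ^+ odo_depth c <= c by rewrite ltW//; apply: odo_depthP => //; lra.
move: (odo_depth c) => n; elim: n c c0 c1 => [|n IH] c c0 c1 cn.
  by move: cn; rewrite expr0 => /(lt_le_trans c1); rewrite ltxx.
rewrite (@odo_invE n.+1) ?cn//=.
have [c6|c6] := ltP c 6^-1.
  have c'n : 6^-1 ^+ n <= 6 * c by move: cn; rewrite exprS; move: (_ ^+ n) => p; lra.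
  have c'0 : 0 < 6 * c by lra.
  have c'1 : 6 * c < 1 by lra.
  have [] := IH _ c'0 c'1 c'n; rewrite (@odo_invE n) ?c'n//.
  move=> /andP[h1 h2] h3; split; first by apply/andP; split; lra.
  by have [|-> _] := @odo3 (odo_inv_n n (6 * c)); [rewrite h1|rewrite h3; field].
have [c2|c2] := ltP c 2^-1.
  split; first by apply/andP; split; lra.
  by have [|-> _] := @odo1 ((c - 6^-1) / 2); [apply/andP; split; lra|field].
split; first by apply/andP; split; lra.
by have [|-> _] := @odo2 (2 / 3 * (c - 4^-1)); [apply/andP; split; lra|field].
Qed.

Let measurable_affine (a c : R) : measurable_fun setT (fun b : R => a * b + c).
Proof. by apply: measurable_funD => //; exact: measurable_funM. Qed.

Let mlt (a : R) : measurable_fun setT (fun b : R => b < a).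
Proof. by apply: measurable_fun_ltr. Qed.

Lemma measurable_odo_n n :
  [/\ measurable_fun setT (odo_n n), measurable_fun setT (slope_n n) &
      measurable_fun setT (odo_inv_n n)].
Proof.
elim: n => [|n [IH1 IH2 IH3]]; first by split; exact: measurable_cst.
split => /=; apply: measurable_fun_ifT => //.
- apply: measurable_fun_ifT => //.
  apply: measurable_funM => //; apply: measurableT_comp => //; exact: measurable_affine.
- apply: measurable_fun_ifT => //.
  apply: measurable_funM => //; apply: measurableT_comp => //; exact: measurable_affine.
- apply: measurable_funD => //; apply: measurable_funM => //.
  by apply: measurableT_comp => //; exact: measurable_funM.
- apply: measurable_fun_ifT => //.
  + by apply: measurable_funM => //; exact: measurable_funD.
  + by apply: measurable_funM => //; exact: measurable_funD.
Qed.

Let measurable_depth (f : R -> R) n : measurable_fun setT f ->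
  measurable [set b | odo_depth (f b) = n].
Proof.
case: n => [|n] mf.
  by rewrite [X in measurable X](_ : _ = set0)//; apply/seteqP; split.
rewrite [X in measurable X](_ : _ = [set b | Num.truncn `|f b|^-1 = n]).
  apply: measurable_truncn_eq; apply: measurable_fun_inv => [b|]; first exact: normr_ge0.
  exact: measurableT_comp.
by apply/seteqP; split => b /=; [case|move=> <-].
Qed.

Let m1B : measurable_fun setT (fun b : R => 1 - b).
Proof. exact: measurable_funB. Qed.

Lemma measurable_odo : measurable_fun setT odo.
Proof.
apply: (@measurable_fun_glue _ _ R R (fun b => odo_depth (1 - b)) odo_n).
  by move=> n; exact: measurable_depth.
by move=> n; have [] := measurable_odo_n n.
Qed.

Lemma measurable_odo_slope : measurable_fun setT odo_slope.
Proof.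
apply: (@measurable_fun_glue _ _ R R (fun b => odo_depth (1 - b)) slope_n).
  by move=> n; exact: measurable_depth.
by move=> n; have [] := measurable_odo_n n.
Qed.

Lemma measurable_odo_inv : measurable_fun setT odo_inv.
Proof.
apply: (@measurable_fun_glue _ _ _ _ odo_depth odo_inv_n).
  by move=> n; exact: (@measurable_depth id).
by move=> n; have [] := measurable_odo_n n.
Qed.

Local Open Scope ereal_scope.

Lemma integral_itv_affine (a c u v u' v' : R) (h : R -> \bar R) : (0 < a)%R ->
  measurable_fun setT h -> (forall x, 0 <= h x) ->
  u' = (a * u + c)%R -> v' = (a * v + c)%R ->
  \int[leb]_(x in `[u', v'[) h x = a%:E * \int[leb]_(x in `[u, v[) h (a * x + c)%R.
Proof.
move=> a0 mh h0 -> ->; rewrite integral_mkcond (ge0_integral_affine c a0); last 2 first.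
- by apply/(measurable_restrictT _ _).1 => //; exact: measurable_funTS.
- by move=> x; rewrite erestrict_ge0.
congr (_ * _); rewrite [RHS]integral_mkcond; apply: eq_integral => x _.
rewrite /patch; congr (if _ then _ else _); apply/idP/idP; rewrite !inE/= !in_itv/=.
  by move=> /andP[]; rewrite lerD2r ltrD2r ler_pM2l// ltr_pM2l// => -> ->.
by rewrite lerD2r ltrD2r ler_pM2l// ltr_pM2l.
Qed.

Lemma integral_itv_cat (u v w : R) (h : R -> \bar R) : measurable_fun setT h ->
  (forall x, 0 <= h x) -> (u <= v)%R -> (v <= w)%R ->
  \int[leb]_(x in `[u, w[) h x = \int[leb]_(x in `[u, v[) h x + \int[leb]_(x in `[v, w[) h x.
Proof.
move=> mh h0 uv vw.
have -> : `[u, w[%classic = `[u, v[%classic `|` `[v, w[%classic.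
  by rewrite -itv_bndbnd_setU// bnd_simp.
rewrite ge0_integral_setU//; first exact: measurable_funTS.
apply/disj_setPS => x []; rewrite /= !in_itv/= => /andP[_ xv] /andP[vx _].
by move: (lt_le_trans xv vx); rewrite ltxx.
Qed.

(** The first two cylinders are mapped affinely onto [[1/6, 1/2[] and [[1/2, 1[]; the part of the
    third one is, by [odo3], a rescaled copy of the previous case. *)
Let cov_n n (h : R -> \bar R) : measurable_fun setT h -> (forall x, 0 <= h x) ->
  \int[leb]_(b in `[0%R, (1 - 2^-1 ^+ n)%R[) (h (odo b) * (odo_slope b)%:E) =
  \int[leb]_(c in `[(6^-1 ^+ n)%R, 1%R[) h c.
Proof.
elim: n h => [|n IH] h mh h0.
  by rewrite !expr0 subrr !set_itvco0 !integral_set0.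
have p01 : (0 < (2^-1 : R) ^+ n <= 1)%R by rewrite exprn_gt0//= exprn_ile1//; lra.
have q01 : (0 < (6^-1 : R) ^+ n <= 1)%R by rewrite exprn_gt0//= exprn_ile1//; lra.
have /andP[p0 p1] := p01; have /andP[q0 q1] := q01.
have mH : measurable_fun setT (fun b => h (odo b) * `|odo_slope b|%:E).
  apply: emeasurable_funM; first exact: (measurableT_comp mh measurable_odo).
  by apply/measurable_EFinP/measurableT_comp => //; exact: measurable_odo_slope.
have H0 b : 0 <= h (odo b) * `|odo_slope b|%:E by rewrite mule_ge0// lee_fin.
(* The absolute value gives a nonnegative integrand on the whole line, as the cutting and rescaling
   lemmas require. *)
have norm (v : R) : (v <= 1)%R -> \int[leb]_(b in `[0%R, v[) (h (odo b) * (odo_slope b)%:E) =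
    \int[leb]_(b in `[0%R, v[) (h (odo b) * `|odo_slope b|%:E).
  move=> v1; apply: eq_integral => b; rewrite inE/= in_itv/= => /andP[b0 bv].
  by have [|_ _ s0 _] := @odo_bounds b; [rewrite b0 (lt_le_trans bv)|rewrite gtr0_norm].
rewrite norm; last by rewrite lerBlDr lerDl exprn_ge0.
rewrite exprS (@integral_itv_cat 0 6^-1)//; [|lra..].
rewrite (@integral_itv_cat 6^-1 2^-1)//; [|lra..].
rewrite [in RHS]exprS [RHS](@integral_itv_cat _ 6^-1)//; [|lra..].
rewrite [X in _ = _ + X](@integral_itv_cat _ 2^-1)//; [|lra..].
rewrite [RHS]addeC -addeA; congr (_ + _); [|congr (_ + _)].
- rewrite [RHS](@integral_itv_affine 2 6^-1 0 6^-1)//; [|lra..].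
  rewrite -ge0_integralZl//; last 1 first.
    by apply: measurable_funTS; exact: (measurableT_comp mh).
  apply: eq_integral => b; rewrite inE/= in_itv/= => b06.
  by have [-> ->] := odo1 b06; rewrite muleC ger0_norm.
- rewrite [RHS](@integral_itv_affine (3 / 2) 4^-1 6^-1 2^-1)//; [|lra..].
  rewrite -ge0_integralZl//; last 1 first.
    by apply: measurable_funTS; exact: (measurableT_comp mh).
  apply: eq_integral => b; rewrite inE/= in_itv/= => b06.
  by have [-> ->] := odo2 b06; rewrite muleC ger0_norm//; lra.
have m6 : measurable_fun setT (fun c : R => h (6^-1 * c + 0)%R) by exact: (measurableT_comp mh).
rewrite (@integral_itv_affine 2^-1 2^-1 0 (1 - 2^-1 ^+ n))//; [|lra..].
rewrite [RHS](@integral_itv_affine 6^-1 0 (6^-1 ^+ n) 1)//; [|lra..].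
rewrite -(IH (fun c => h (6^-1 * c + 0)%R))//.
rewrite [X in _ = X%:E * _](_ : _ = 2^-1 * 3^-1)%R; last lra.
rewrite EFinM -muleA; congr (_ * _).
rewrite -ge0_integralZl//; last 2 first.
- apply: measurable_funTS; apply: emeasurable_funM.
    exact: (measurableT_comp m6 measurable_odo).
  by apply/measurable_EFinP; exact: measurable_odo_slope.
- move=> b; rewrite /= in_itv/= => /andP[b0 bp].
  have [|_ _ s0 _] := @odo_bounds b; first by rewrite b0 (lt_trans bp)// ltrBlDr ltrDl.
  by rewrite mule_ge0// lee_fin ltW.
apply: eq_integral => b; rewrite inE/= in_itv/= => /andP[b0 bp].
have b01 : (0 <= b < 1)%R by rewrite b0 (lt_trans bp)// ltrBlDr ltrDl.
have [-> ->] := odo3 b01; have [_ _ s0 _] := odo_bounds b01.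
rewrite gtr0_norm ?divr_gt0// addr0 (mulrC _ (odo b)) muleCA -EFinM.
by rewrite (mulrC _ (odo_slope b)).
Qed.

(** Both intervals of [cov_n] increase, the first to [[0, 1[], the second to []0, 1[]; the point
    [0], which the odometer misses, is null. *)
Lemma odo_change_of_variables (h : R -> \bar R) : measurable_fun setT h -> (forall x, 0 <= h x) ->
  \int[leb]_(b in `[0%R, 1%R[) (h (odo b) * (odo_slope b)%:E) = \int[leb]_(c in `[0%R, 1%R[) h c.
Proof.
move=> mh h0.
pose A n : set R := `[0%R, (1 - 2^-1 ^+ n)%R[%classic.
pose B n : set R := `[(6^-1 ^+ n)%R, 1%R[%classic.
have p1 n : ((2^-1 : R) ^+ n <= 1)%R by rewrite exprn_ile1//; lra.
have ndA : nondecreasing_seq A.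
  move=> m n mn; rewrite subsetEset => x; rewrite /A/= !in_itv/= => /andP[-> /lt_le_trans]; apply.
  by rewrite lerD2l lerN2; apply: ler_wiXn2l => //; lra.
have ndB : nondecreasing_seq B.
  move=> m n mn; rewrite subsetEset => x; rewrite /B/= !in_itv/= => /andP[+ ->]; rewrite andbT.
  by apply: le_trans; apply: ler_wiXn2l => //; lra.
have UA : \bigcup_n A n = `[0%R, 1%R[%classic.
  apply/seteqP; split => [b [n _]|b]; rewrite /A/= !in_itv/= => /andP[b0 b1].
    by rewrite b0 (lt_le_trans b1)// lerBlDr lerDl exprn_ge0.
  by have [n bn] := lt1_exp b1; exists n.+1 => //; rewrite /A/= in_itv/= b0.
have UB : \bigcup_n B n = `]0%R, 1%R[%classic.
  apply/seteqP; split => [b [n _]|b]; rewrite /B/= !in_itv/= => /andP[b0 b1].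
    by rewrite b1 (lt_le_trans _ b0)// exprn_gt0.
  by exists (odo_depth b) => //; rewrite /B/= in_itv/= b1 ltW//; apply: odo_depthP => //; lra.
pose H b := h (odo b) * `|odo_slope b|%:E.
have mH : measurable_fun setT H.
  apply: emeasurable_funM; first exact: (measurableT_comp mh measurable_odo).
  by apply/measurable_EFinP/measurableT_comp => //; exact: measurable_odo_slope.
have H0 b : 0 <= H b by rewrite mule_ge0// lee_fin.
have HE b : (0 <= b < 1)%R -> h (odo b) * (odo_slope b)%:E = H b.
  by move=> b01; have [_ _ s0 _] := odo_bounds b01; rewrite /H gtr0_norm.
transitivity (\int[leb]_(b in `[0%R, 1%R[) H b).
  by apply: eq_integral => b; rewrite inE/= in_itv/= => /HE.
transitivity (\int[leb]_(c in `]0%R, 1%R[) h c); last first.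
  have toL D : measurable D -> \int[leb]_(c in D) h c = \int[@lebesgue_measure R]_(c in D) h c.
    move=> mD; rewrite integral_mkcond [RHS]integral_mkcond; apply: ge0_integral_leb.
      by apply/(measurable_restrictT _ _).1 => //; exact: measurable_funTS.
    by move=> x; rewrite erestrict_ge0.
  rewrite !toL//; apply: integral_itv_obnd_cbnd; exact: measurable_funTS.
rewrite -UA -UB.
have cA := @ge0_nondecreasing_set_cvg_integral _ _ R A H (@leb R) ndA
  (fun=> measurable_itv _) (fun=> measurable_funTS mH) (fun _ _ _ => H0 _).
have cB := @ge0_nondecreasing_set_cvg_integral _ _ R B h (@leb R) ndB
  (fun=> measurable_itv _) (fun=> measurable_funTS mh) (fun _ _ _ => h0 _).
apply: cvg_unique cA _ => //.
apply: cvg_trans cB; apply: near_eq_cvg; apply: nearW => n.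
rewrite -cov_n//; apply: eq_integral => b; rewrite inE/= in_itv/= => /andP[b0 b1].
by apply: HE; rewrite b0 (lt_le_trans b1)// lerBlDr lerDl exprn_ge0.
Qed.

End odometer.

Section odometer_maharam.
Context (R : realType).
Local Open Scope ereal_scope.
Notation lam := (@leb R \x @exp_measure R).
Notation strip := (`[0%R, 1%R[ `*` setT : set (R * R)).

(** Invariance under the Maharam extension of the odometer, for almost every base point: this is all
    that the trace of an invariant set on the base of a tower satisfies. *)
Definition odo_invariant (E : set (R * R)) : Prop := measurable E /\
  {ae leb, forall b : R, (0 <= b < 1)%R -> forall y : R,
    E (b, y) <-> E (odo b, y - ln (odo_slope b))%R}.

Lemma ae_affine (a c : R) (P : R -> Prop) : (0 < a)%R ->
  {ae leb, forall x, P x} -> {ae leb, forall x : R, P (a * x + c)%R}.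
Proof.
move=> a0 [N [mN N0 PN]]; exists ((fun x => a * x + c)%R @^-1` N); split.
- apply: measurable_preimage => //; apply: measurable_funD => //; exact: measurable_funM.
- have := lebesgue_measure_affine c a0 mN; rewrite N0 => /esym/eqP.
  by rewrite mule_eq0 eqe (gt_eqF a0) => /eqP.
- by move=> x /= nP; exact: PN.
Qed.

Lemma odo_invariantC E : odo_invariant E -> odo_invariant (~` E).
Proof.
move=> [mE EQ]; split; first exact: measurableC.
by apply: filterS EQ => b h b01 y; have [h1 h2] := h b01 y; split => nE Ey; apply: nE; auto.
Qed.

(** [E'] is [E] read on the first cylinder. The odometer carries this cylinder to the second with
    slope 2, and that one to the third with slope 3/2, whence the shifts [ln 2] and [ln 3]. From the
    third it returns to the first as a copy of itself, so [E'] is invariant too. *)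
Lemma odo_invariant_renorm E : odo_invariant E ->
  exists2 E', odo_invariant E' & renorm E E'.
Proof.
move=> [mE EQ]; pose E' : set (R * R) := (fun p => (6^-1 * p.1 + 0, p.2))%R @^-1` E.
have l3 : (ln (3 / 2 : R) = ln 3 - ln 2)%R by rewrite ln_div// posrE.
have ren : renorm E E'.
  have := ae_affine 6^-1 (_ : (0 < 3^-1)%R) EQ; have := ae_affine 0 (_ : (0 < 6^-1)%R) EQ.
  move=> /(_ _)/= h1 /(_ _)/= h2.
  have {}h1 := h1 ltac:(lra); have {}h2 := h2 ltac:(lra).
  apply: filterS2 h1 h2 => b h1 h2 /andP[b0 b1] y.
  have [|o1 s1] := @odo1 R (6^-1 * b + 0)%R; first by apply/andP; split; lra.
  have [|o2 s2] := @odo2 R (3^-1 * b + 6^-1)%R; first by apply/andP; split; lra.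
  have {}h1 : forall y, E (6^-1 * b + 0, y)%R <-> E (3^-1 * b + 6^-1, y - ln 2)%R.
    move=> z; rewrite h1 ?o1 ?s1; last by apply/andP; split; lra.
    by have -> : (2 * (6^-1 * b + 0) + 6^-1 = 3^-1 * b + 6^-1 :> R)%R by lra.
  have {}h2 : forall y, E (3^-1 * b + 6^-1, y)%R <-> E (2^-1 * b + 2^-1, y - ln (3 / 2))%R.
    move=> z; rewrite h2 ?o2 ?s2; last by apply/andP; split; lra.
    by have -> : (3 / 2 * (3^-1 * b + 6^-1) + 4^-1 = 2^-1 * b + 2^-1 :> R)%R by lra.
  split; rewrite /E'/= ?subr0// h1// h2 l3.
  by have -> : (y - ln 2 - (ln 3 - ln 2) = y - ln 3 :> R)%R by lra.
exists E' => //; split.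
  apply: measurable_preimage => //; apply: measurable_fun_pair => //=.
  by apply: measurable_funD => //; exact: measurable_funM.
have h3 := @ae_affine 2^-1 2^-1 _ ltac:(lra) EQ.
have := ren; rewrite /renorm; move: h3; apply: filterS2 => b h3 hr b01 y.
have [_ _ r3] := hr b01 y; rewrite r3 h3; last by move: b01 => /andP[]; lra.
have [_ _ s0 _] := odo_bounds b01.
have [-> ->] := odo3 b01; rewrite lnM ?posrE// lnV ?posrE// /E'/= addr0 mulrC.
by have -> : (y - ln 3 - (ln (odo_slope b) - ln 3) = y - ln (odo_slope b) :> R)%R by lra.
Qed.

Lemma odo_invariant_null E : odo_invariant E ->
  lam (E `&` strip) = 0 \/ lam (~` E `&` strip) = 0.
Proof.
move=> EQ; apply: (@renorm_null R odo_invariant) => //.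
- by move=> F [].
- exact: odo_invariantC.
- exact: odo_invariant_renorm.
Qed.

End odometer_maharam.

(** * Isomorphisms of labelled measure spaces *)

Section ae_measure.
Context d (T : measurableType d) (R : realType) (mu : {measure set T -> \bar R}).
Local Open Scope ereal_scope.

Lemma ae_le_measure (A B : set T) : measurable A -> measurable B ->
  {ae mu, forall x, A x -> B x} -> mu A <= mu B.
Proof.
move=> mA mB AB; have -> : mu A = mu (A `\` B) + mu (A `&` B) by exact: measureDI.
have mAB : measurable (A `\` B) by exact: measurableD.
have -> : mu (A `\` B) = 0.
  apply: (measure_negligible mAB); apply: negligibleS AB => x /= [Ax nBx] h.
  exact/nBx/h.
rewrite add0e; apply: le_measure; rewrite ?inE//; exact: measurableI.
Qed.

Lemma ae_eq_measure (A B : set T) : measurable A -> measurable B ->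
  {ae mu, forall x, A x <-> B x} -> mu A = mu B.
Proof.
move=> mA mB AB; apply/eqP; rewrite eq_le !ae_le_measure//.
  by apply: filterS AB => x [].
by apply: filterS AB => x [].
Qed.

Lemma ae_preimage d' (S : measurableType d') (nu : {measure set S -> \bar R}) (f : T -> S)
    (P : S -> Prop) : measurable_fun setT f ->
  (forall A, measurable A -> mu (f @^-1` A) = nu A) ->
  {ae nu, forall y, P y} -> {ae mu, forall x, P (f x)}.
Proof.
move=> mf fmu [N [mN N0 PN]]; exists (f @^-1` N); split.
- exact: measurable_preimage.
- by rewrite fmu.
- by move=> x /= nP; exact: PN.
Qed.

Lemma pushforward_measure d' (S : measurableType d') (f : T -> S) : measurable_fun setT f ->
  exists nu : {measure set S -> \bar R}, forall B, nu B = mu (f @^-1` B).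
Proof.
by move=> mf; pose nu : {measure set S -> \bar R} := pushforward mu f; exists (nu mf).
Qed.

Lemma measure_label (l : T -> nat) (A : set T) : (forall i, measurable [set x | l x = i]) ->
  measurable A -> mu A = \sum_(i <oo) mu ([set x | l x = i] `&` A).
Proof.
move=> ml mA; pose F i := [set x | l x = i] `&` A.
have -> : A = \bigcup_i F i.
  by apply/seteqP; split => [x Ax|x [i _ []]]//; exists (l x).
have mF i : measurable (F i) by exact: measurableI.
have := @measure_semi_sigma_additive _ _ _ mu F mF _ (bigcupT_measurable _ mF).
have tF : trivIset setT F by move=> i j _ _ [x [[/= <- _] [/= <- _]]].
move=> /(_ tF) c; rewrite -[LHS](cvg_lim _ c)//; congr (limn _); apply/funext => n.
apply: eq_bigr => i _; congr (mu _); rewrite /F; apply/seteqP; split => x [lx].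
  by move=> Ax; split => //; exists i.
by move=> [j _ [_ Ax]]; split.
Qed.

End ae_measure.

Section rays.
Context (R : realType).

Lemma itvNyo_bigcup (a : R) : \bigcup_n `]-oo, a - n.+1%:R^-1]%classic = `]-oo, a[%classic.
Proof.
apply/seteqP; split => x.
  move=> [n _]; rewrite /= !in_itv/= => /le_lt_trans; apply.
  by rewrite ltrBlDr ltrDl invr_gt0.
rewrite /= in_itv/= => xa; exists (Num.truncn (a - x)^-1) => //.
rewrite /= in_itv/= lerBrDl -lerBrDr -[leRHS]invrK lef_pV2 ?posrE ?invr_gt0 ?subr_gt0//.
by rewrite ltW// truncnS_gt.
Qed.

Lemma measure_eq_rays (mu nu : {measure set R -> \bar R}) :
  (forall t : R, (mu `]-oo, t]%classic < +oo)%E) ->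
  (forall t : R, mu `]-oo, t]%classic = nu `]-oo, t]%classic) ->
  forall A, measurable A -> mu A = nu A.
Proof.
move=> fin mn; pose G := range (fun r : R => `]-oo, r]%classic).
have mG : @measurable _ R = <<s G >>.
  apply/seteqP; split; last first.
    apply: smallest_sub; first exact: sigma_algebra_measurable.
    by move=> _ [r _ <-]; exact: measurable_itv.
  have -> : @measurable _ R = <<s @RGenInftyO.G R >> by exact: RGenInftyO.measurableE.
  apply: smallest_sub; first exact: smallest_sigma_algebra.
  move=> _ [r ->]; rewrite -itvNyo_bigcup.
  apply: (@bigcupT_measurable _ (g_sigma_algebraType G)) => n.
  by apply: sub_sigma_algebra; exists (r - n.+1%:R^-1).
apply: (@measure_unique _ R R G (fun n => `]-oo, n%:R : R]%classic) mG).
- move=> _ _ [r _ <-] [s _ <-]; exists (Num.min r s) => //.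
  by apply/seteqP; split => x; rewrite /= !in_itv/= le_min; [move/andP|move=> [-> ->]].
- by move=> n; exists n%:R.
- apply/seteqP; split => // x _; exists (Num.truncn x).+1 => //.
  by rewrite /= in_itv/= ltW// truncnS_gt.
- by move=> _ [r _ <-].
- by move=> n; exact: fin.
Qed.

End rays.

(** * Distribution functions, quantiles and monotone rearrangement *)

Section quantile.
Context (R : realType) (lam : {measure set R -> \bar R}).
Hypothesis ray_fin : forall t : R, (lam `]-oo, t]%classic < +oo)%E.
Hypothesis atomless : forall t : R, lam [set t] = 0%E.

Definition ray_mass (t : R) : R := fine (lam `]-oo, t]%classic).

Lemma ray_massE t : lam `]-oo, t]%classic = (ray_mass t)%:E.
Proof. by rewrite /ray_mass fineK// ge0_fin_numE. Qed.

Lemma ray_mass_ge0 t : 0 <= ray_mass t.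
Proof. exact: fine_ge0. Qed.

Lemma le_ray_mass s t : s <= t -> ray_mass s <= ray_mass t.
Proof.
move=> st; rewrite -lee_fin -!ray_massE; apply: le_measure; rewrite ?inE//.
by move=> x; rewrite /= !in_itv/= => /le_trans; apply.
Qed.

Lemma ray_mass_le_mass t : ((ray_mass t)%:E <= lam setT)%E.
Proof. by rewrite -ray_massE; apply: le_measure; rewrite ?inE. Qed.

Lemma ray_mass_unbounded s : (s%:E < lam setT)%E -> exists t, s <= ray_mass t.
Proof.
move=> sm; apply: contrapT => /forallNP h.
have lt t : ray_mass t < s by have /negP := h t; rewrite -ltNge.
move: sm; apply/negP; rewrite -leNgt.
have -> : setT = \bigcup_n `]-oo, n%:R : R]%classic.
  apply/seteqP; split => // x _; exists (Num.truncn x).+1 => //.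
  by rewrite /= in_itv/= ltW// truncnS_gt.
have nd : nondecreasing_seq (fun n => `]-oo, n%:R : R]%classic).
  move=> m n mn; rewrite subsetEset => x; rewrite /= !in_itv/= => /le_trans; apply.
  by rewrite ler_nat.
have c := nondecreasing_cvg_mu (mu := lam) (fun n => measurable_itv _)
  (bigcupT_measurable _ (fun n => measurable_itv _)) nd.
rewrite -(cvg_lim _ c)//; apply: lime_le; first exact: (cvgP _ c).
by apply: nearW => n /=; rewrite ray_massE lee_fin ltW.
Qed.

Lemma ray_mass_small s : 0 < s -> exists t, ray_mass t < s.
Proof.
move=> s0; apply: contrapT => /forallNP h.
have ge t : s <= ray_mass t by have /negP := h t; rewrite -leNgt.
have nd : nonincreasing_seq (fun n => `]-oo, - n%:R : R]%classic).
  move=> m n mn; rewrite subsetEset => x; rewrite /= !in_itv/= => /le_trans; apply.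
  by rewrite lerN2 ler_nat.
have c := nonincreasing_cvg_mu (mu := lam) (ray_fin _) (fun n => measurable_itv _)
  (bigcapT_measurable (fun n => measurable_itv _)) nd.
have e0 : \bigcap_n `]-oo, - n%:R : R]%classic = set0.
  apply/seteqP; split => // x /(_ (Num.truncn (- x)).+1 Logic.I).
  by rewrite /= in_itv/= lerNr leNgt truncnS_gt.
move: c; rewrite e0 measure0 => c.
have : (s%:E <= 0 :> \bar R)%E.
  rewrite -(cvg_lim _ c)//; apply: lime_ge; first exact: (cvgP _ c).
  by apply: nearW => n /=; rewrite ray_massE lee_fin.
by rewrite lee_fin leNgt s0.
Qed.

Definition in_range (s : R) : bool := (0 < s) && (s%:E < lam setT)%E.

Definition ray_quantile (s : R) : R :=
  if in_range s then inf [set t | s <= ray_mass t] else 0.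

Let has_inf_ray_quantile s : in_range s -> has_inf [set t | s <= ray_mass t].
Proof.
move=> /andP[s0 /ray_mass_unbounded[t st]]; split; first by exists t.
have [u us] := ray_mass_small s0; exists u => v /= sv; rewrite leNgt; apply/negP => vu.
by have := le_trans sv (le_ray_mass (ltW vu)); rewrite leNgt us.
Qed.

Lemma le_ray_mass_ray_quantile s : in_range s -> s <= ray_mass (ray_quantile s).
Proof.
move=> sr; have hi := has_inf_ray_quantile sr; rewrite /ray_quantile sr.
set a := inf _.
pose D (n : nat) : set R := `]-oo, a + n.+1%:R^-1]%classic.
have nd : nonincreasing_seq D.
  move=> m n mn; rewrite subsetEset => x; rewrite /D/= !in_itv/= => /le_trans; apply.
  by rewrite lerD2l lef_pV2 ?posrE ?ltr0n// ler_nat.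
have c := nonincreasing_cvg_mu (mu := lam) (ray_fin _) (fun n => measurable_itv _)
  (bigcapT_measurable (fun n => measurable_itv _)) nd.
have e : \bigcap_n D n = `]-oo, a]%classic.
  apply/seteqP; split => x; last first.
    rewrite /= in_itv/= => xa n _; rewrite /D/= in_itv/= (le_trans xa)// lerDl.
    by rewrite invr_ge0.
  move=> h; rewrite /= in_itv/=; apply/ler_addgt0Pl => eps eps0.
  have := h (Num.truncn eps^-1) Logic.I; rewrite /D/= in_itv/= => /le_trans; apply.
  rewrite addrC lerD2r -[leRHS]invrK lef_pV2 ?posrE ?invr_gt0 ?ltr0n//.
  by rewrite ltW// truncnS_gt.
rewrite -lee_fin -ray_massE -e -(cvg_lim _ c)//; apply: lime_ge; first exact: (cvgP _ c).
apply: nearW => n /=; rewrite ray_massE lee_fin.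
have n0 : 0 < (n.+1%:R^-1 : R) by rewrite invr_gt0.
have [t /= st ta] := inf_adherent n0 hi.
exact: (le_trans st (le_ray_mass (ltW ta))).
Qed.

(** The adjunction between the quantile and the distribution function, from which measurability and
    transport on rays are derived. *)
Lemma ray_quantile_le s t : in_range s -> (ray_quantile s <= t) = (s <= ray_mass t).
Proof.
move=> sr; apply/idP/idP => [qt|st].
  exact: le_trans (le_ray_mass_ray_quantile sr) (le_ray_mass qt).
by rewrite /ray_quantile sr; apply: ge_inf => //; have [] := has_inf_ray_quantile sr.
Qed.

Lemma ray_mass_ray_quantile_lt s : in_range s -> lam `]-oo, ray_quantile s[%classic = s%:E.
Proof.
move=> sr; set a := ray_quantile s.
have aE : lam `]-oo, a[%classic = (ray_mass a)%:E.
  rewrite -ray_massE (_ : `]-oo, a]%classic = `]-oo, a[%classic `|` [set a]); last first.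
    by rewrite setUitv1.
  rewrite measureU//; first by rewrite [X in (_ + X)%E]atomless adde0.
  by apply/seteqP; split => // x [/=]; rewrite in_itv/= => + xa; rewrite xa ltxx.
apply/eqP; rewrite eq_le; apply/andP; split; last by rewrite aE lee_fin le_ray_mass_ray_quantile.
pose D (n : nat) : set R := `]-oo, a - n.+1%:R^-1]%classic.
have nd : nondecreasing_seq D.
  move=> m n mn; rewrite subsetEset => x; rewrite /D/= !in_itv/= => /le_trans; apply.
  by rewrite lerD2l lerN2 lef_pV2 ?posrE ?ltr0n// ler_nat.
have c := nondecreasing_cvg_mu (mu := lam) (fun n => measurable_itv _)
  (bigcupT_measurable _ (fun n => measurable_itv _)) nd.
have e : \bigcup_n D n = `]-oo, a[%classic := itvNyo_bigcup a.
rewrite -e -(cvg_lim _ c)//; apply: lime_le; first exact: (cvgP _ c).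
apply: nearW => n /=; rewrite ray_massE lee_fin leNgt; apply/negP => /ltW.
rewrite -ray_quantile_le// -/a leNgt => /negP; apply.
by rewrite ltrBlDr ltrDl invr_gt0.
Qed.

Lemma ray_mass_ray_quantile s : in_range s -> ray_mass (ray_quantile s) = s.
Proof.
move=> sr; apply: EFin_inj; rewrite -(ray_mass_ray_quantile_lt sr) -ray_massE.
rewrite (_ : `]-oo, ray_quantile s]%classic = `]-oo, ray_quantile s[%classic `|` [set ray_quantile s]).
  rewrite measureU//; first by rewrite [X in (_ + X)%E]atomless adde0.
  by apply/seteqP; split => // x [/=]; rewrite in_itv/= => + xa; rewrite xa ltxx.
by rewrite setUitv1.
Qed.

Lemma measurable_ray_mass : measurable_fun setT ray_mass.
Proof. by apply: nondecreasing_measurable => // x y *; exact: le_ray_mass. Qed.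

Lemma measurable_in_range : measurable [set s | in_range s].
Proof.
rewrite [X in measurable X](_ : _ = [set s | 0 < s] `&` [set s : R | (s%:E < lam setT)%E]).
  apply: measurableI; rewrite -[X in measurable X]setTI.
    exact: measurable_fun_ltr.
  case: (lam setT) => [m||].
  - exact: measurable_fun_ltr.
  - rewrite [X in _ `&` X](_ : _ = setT) ?setIT//.
    by apply/seteqP; split => // s _ /=; rewrite ltry.
  - by rewrite [X in _ `&` X](_ : _ = set0) ?setI0//; apply/seteqP; split.
by apply/seteqP; split => s /=; rewrite /in_range; [move=> /andP[]|move=> [-> ->]].
Qed.

Lemma measurable_ray_quantile : measurable_fun setT ray_quantile.
Proof.
apply: (measurability _ (RGenOInfty.measurableE R)) => _ [_ [r ->] <-].
rewrite setTI [X in measurable X](_ : _ =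
   ([set s | in_range s] `&` [set s | ray_mass r < s]) `|`
   (~` [set s | in_range s] `&` [set _ : R | r < 0])); last first.
  apply/seteqP; split => s /=; rewrite in_itv/= andbT.
    have [sr|sr] := boolP (in_range s).
      by rewrite ltNge ray_quantile_le// -ltNge; left.
    by rewrite /ray_quantile (negbTE sr) => r0; right; split => //; apply/negP.
  move=> [[sr]|[/negP sr]].
    by rewrite ltNge -ray_quantile_le// -ltNge.
  by rewrite /ray_quantile (negbTE sr).
apply: measurableU; apply: measurableI.
- exact: measurable_in_range.
- by rewrite -[X in measurable X]setTI; exact: measurable_fun_ltr.
- by apply: measurableC; exact: measurable_in_range.
- by rewrite -[X in measurable X]setTI; exact: measurable_fun_ltr.
Qed.

Lemma measurable_ray_mass_le s : measurable [set t | ray_mass t <= s].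
Proof.
rewrite -[X in measurable X]setTI; apply: measurable_fun_ler => //; exact: measurable_ray_mass.
Qed.

Lemma lam_ray_mass_lt s : in_range s -> lam [set t | ray_mass t < s] = s%:E.
Proof.
move=> sr; rewrite -(ray_mass_ray_quantile_lt sr); congr (lam _); apply/seteqP.
by split => t /=; rewrite in_itv/= [ray_mass _ < _]ltNge -ray_quantile_le// -ltNge.
Qed.

(** The distribution function of an atomless measure is uniformly distributed: below the total mass
    this comes from the strict version, by squeezing between [s] and [s + e]. *)
Lemma lam_ray_mass_le s : 0 <= s -> (s%:E <= lam setT)%E -> lam [set t | ray_mass t <= s] = s%:E.
Proof.
move=> s0 sm; have mle u := measurable_ray_mass_le u.
have mlt u : measurable [set t | ray_mass t < u].
  by rewrite -[X in measurable X]setTI; apply: measurable_fun_ltr => //; exact: measurable_ray_mass.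
move: sm; rewrite le_eqVlt => /orP[/eqP sm|sm].
  rewrite sm; congr (lam _); apply/seteqP; split => // t _ /=.
  by rewrite -lee_fin sm ray_mass_le_mass.
apply/eqP; rewrite eq_le; apply/andP; split.
  apply/lee_addgt0Pr => e e0; rewrite -EFinD.
  have [se|se] := boolP (in_range (s + e)).
    rewrite -(lam_ray_mass_lt se); apply: le_measure; rewrite ?inE// => t /=.
    by move=> /le_lt_trans; apply; rewrite ltrDl.
  have se0 : 0 < s + e by rewrite ltr_wpDl.
  move: se; rewrite /in_range se0/= -leNgt => mse.
  by apply: le_trans mse; apply: le_measure; rewrite ?inE.
have [->|sn0] := eqVneq s 0; first exact: measure_ge0.
have sr : in_range s by rewrite /in_range sm andbT lt_neqAle eq_sym sn0.
rewrite -[X in (X <= _)%E](lam_ray_mass_lt sr).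
by apply: le_measure; rewrite ?inE// => t /=; exact: ltW.
Qed.

Lemma ray_mass_in_range : {ae lam, forall t, in_range (ray_mass t)}.
Proof.
have m0 : (0%:E <= lam setT)%E by [].
have n0 : lam.-negligible [set t | ray_mass t <= 0].
  by exists [set t | ray_mass t <= 0]; split => //;
    [exact: measurable_ray_mass_le|exact: lam_ray_mass_le].
have nm : lam.-negligible [set t | (lam setT <= (ray_mass t)%:E)%E].
  pose D := [set t | (lam setT <= (ray_mass t)%:E)%E].
  case mE : (lam setT) => [m||]; last 2 first.
  - by exists set0; split => // t /=; rewrite leye_eq.
  - by move: m0; rewrite mE.
  have mD : measurable [set t | m <= ray_mass t].
    by rewrite -[X in measurable X]setTI; apply: measurable_fun_ler => //; exact: measurable_ray_mass.
  exists [set t | m <= ray_mass t]; split => //.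
  have m0' : 0 <= m by rewrite -lee_fin -mE.
  apply/eqP; rewrite eq_le measure_ge0 andbT; apply/lee_addgt0Pr => e e0; rewrite add0e.
  have [me|me] := ltP m e.
    by apply: (@le_trans _ _ (lam setT)); [apply: le_measure; rewrite ?inE|rewrite mE lee_fin ltW].
  have s0 : 0 <= m - e by rewrite subr_ge0.
  have sm : ((m - e)%:E <= lam setT)%E by rewrite mE lee_fin gerBl ltW.
  have := lam_ray_mass_le s0 sm.
  have : lam ([set t | ray_mass t <= m - e] `|` [set t | m <= ray_mass t]) =
      (lam [set t | ray_mass t <= m - e]%R + lam [set t | m <= ray_mass t]%R)%E.
    apply: measureU => //; first exact: measurable_ray_mass_le.
    by apply/seteqP; split => // t /= [h1 h2]; move: (le_trans h2 h1); rewrite leNgt ltrBlDr ltrDl e0.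
  move=> UE E1; have : (lam ([set t | (ray_mass t <= m - e)%R] `|` [set t | (m <= ray_mass t)%R])
     <= m%:E)%E.
    by rewrite -mE; apply: le_measure; rewrite ?inE//; apply: measurableU => //; exact: measurable_ray_mass_le.
  rewrite UE E1; move: (lam [set t | m <= ray_mass t]) => [x||]//; last by move=> _; rewrite leNye.
  by rewrite -EFinD !lee_fin; lra.
rewrite /ae_filter_ringOfSetsType/=.
apply: negligibleS (negligibleU n0 nm) => t /= /negP; rewrite negb_and -!leNgt.
by move=> /orP.
Qed.

(** If the quantile falls below [t], there is a rational [q] in between with the same distribution
    function as [t]; for each [q], such points [t] form a null set. *)
Lemma ray_mass_quantileK : {ae lam, forall t, ray_quantile (ray_mass t) = t}.
Proof.
have N0 (q : R) : lam.-negligible [set t | q < t /\ ray_mass t <= ray_mass q].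
  have mN : measurable [set t | q < t /\ ray_mass t <= ray_mass q].
    rewrite [X in measurable X](_ : _ = [set t | q < t] `&` [set t | ray_mass t <= ray_mass q])//.
    apply: measurableI; last exact: measurable_ray_mass_le.
    by rewrite -[X in measurable X]setTI; exact: measurable_fun_ltr.
  eexists; split; [exact: mN| |by []].
  have := lam_ray_mass_le (ray_mass_ge0 q) (ray_mass_le_mass q).
  have -> : [set t | ray_mass t <= ray_mass q] =
      `]-oo, q]%classic `|` [set t | q < t /\ ray_mass t <= ray_mass q].
    apply/seteqP; split => t /=; rewrite in_itv/=.
      by move=> h; have [tq|qt] := leP t q; [left|right].
    by move=> [/le_ray_mass|[]].
  have -> : lam (`]-oo, q]%classic `|` [set t | q < t /\ ray_mass t <= ray_mass q]) =
      (lam `]-oo, q]%classic + lam [set t | q < t /\ ray_mass t <= ray_mass q]%R)%E.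
    apply: measureU => //.
    by apply/seteqP; split => // t /=; rewrite in_itv/= => -[h [/lt_le_trans/(_ h)]]; rewrite ltxx.
  rewrite ray_massE; move: (lam [set t | q < t /\ _]%R) => [x||]//; rewrite -EFinD => -[h].
  by congr _%:E; apply: (@addrI _ (ray_mass q)); rewrite h addr0.
have nq n : {ae lam, forall t, if unpickle n is Some q then
    ~ (ratr q < t /\ ray_mass t <= ray_mass (ratr q)) else True}.
  case: (unpickle n) => [q|]; last exact: nearW.
  by apply: negligibleS (N0 (ratr q)) => t /= /contrapT.
have {}nq := ae_foralln nq.
move: nq ray_mass_in_range; apply: filterS2 => t h tr.
apply/eqP; rewrite eq_le ray_quantile_le// lexx/= leNgt; apply/negP => lt.
have [q] := rat_in_itvoo lt; rewrite in_itv/= => /andP[qt1 qt2].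
have := h (pickle q); rewrite pickleK; apply; split => //.
by rewrite -ray_quantile_le// ltW.
Qed.



End quantile.

Section transport.
Context (R : realType) (lam mu : {measure set R -> \bar R}).
Hypothesis lam_fin : forall t : R, (lam `]-oo, t]%classic < +oo)%E.
Hypothesis lam_atomless : forall t : R, lam [set t] = 0%E.
Hypothesis mu_fin : forall t : R, (mu `]-oo, t]%classic < +oo)%E.
Hypothesis mu_atomless : forall t : R, mu [set t] = 0%E.
Hypothesis same_mass : lam setT = mu setT.

(** The monotone rearrangement of [lam] into [mu]. *)
Definition transport (t : R) : R := ray_quantile mu (ray_mass lam t).

Lemma measurable_transport : measurable_fun setT transport.
Proof.
apply: (@measurableT_comp _ _ _ R R R); first exact: measurable_ray_quantile.
exact: measurable_ray_mass.
Qed.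

Lemma transport_preserves (A : set R) : measurable A -> lam (transport @^-1` A) = mu A.
Proof.
have mt := measurable_transport.
have ray (r : R) : lam (transport @^-1` `]-oo, r]%classic) = mu `]-oo, r]%classic.
  rewrite (ray_massE mu_fin) -(lam_ray_mass_le lam_fin lam_atomless); last 2 first.
  - exact: ray_mass_ge0.
  - by rewrite same_mass; exact: ray_mass_le_mass.
  apply: ae_eq_measure.
  - exact: measurable_preimage.
  - exact: measurable_ray_mass_le.
  have := ray_mass_in_range lam_fin lam_atomless; apply: filterS => t tr.
  have tr' : in_range mu (ray_mass lam t) by move: tr; rewrite /in_range same_mass.
  by rewrite /transport/= in_itv/= ray_quantile_le.
move=> mA.
have [nu nuE] := pushforward_measure lam mt.
by rewrite -nuE; apply: measure_eq_rays => // t; rewrite nuE ray.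
Qed.

Lemma transportK : {ae lam, forall t,
  ray_quantile lam (ray_mass mu (transport t)) = t}.
Proof.
have := ray_mass_in_range lam_fin lam_atomless.
have := ray_mass_quantileK lam_fin lam_atomless.
apply: filterS2 => t tK tr; rewrite /transport ray_mass_ray_quantile//.
by move: tr; rewrite /in_range same_mass.
Qed.

End transport.

(** * Isomorphisms respecting a countable partition *)

Section labelled_coding.
Context d (X : measurableType d) (R : realType) (mu : {measure set X -> \bar R}).
Local Open Scope ereal_scope.

(** What the rearrangement needs: points are coded by reals and recovered almost everywhere, and the
    image measure has no atom and is finite on left rays. *)
Definition coding (l : X -> nat) (phi : X -> R) (om : R -> X) : Prop :=
  [/\ forall i, measurable [set x | l x = i], measurable_fun setT phi, measurable_fun setT om,
      {ae mu, forall x, om (phi x) = x} &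
      (forall r : R, mu (phi @^-1` [set r]) = 0) /\
      (forall t : R, mu (phi @^-1` `]-oo, t]%classic) < +oo)].

Definition is_law (l : X -> nat) (phi : X -> R) (i : nat) (nu : set R -> \bar R) : Prop :=
  forall B, measurable B -> nu B = mu ([set x | l x = i] `&` phi @^-1` B).

Lemma ex_law l phi om i : coding l phi om ->
  exists nu : {measure set R -> \bar R}, [/\ is_law l phi i nu,
    forall t : R, nu `]-oo, t]%classic < +oo & forall t : R, nu [set t] = 0].
Proof.
move=> [ml mphi mom oK [atom fin]].
have [nu nuE] := pushforward_measure (mrestr mu (ml i)) mphi.
have nuE' B : nu B = mu ([set x | l x = i] `&` phi @^-1` B) by rewrite nuE setIC.
exists nu; split; first by move=> B _; exact: nuE'.
  move=> t; rewrite nuE'; apply: le_lt_trans (fin t); apply: le_measure; rewrite ?inE//.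
    by apply: measurableI => //; exact: measurable_preimage.
  exact: measurable_preimage.
move=> t; rewrite nuE'; apply/eqP; rewrite eq_le measure_ge0 andbT -(atom t).
apply: le_measure; rewrite ?inE//.
  by apply: measurableI => //; exact: measurable_preimage.
exact: measurable_preimage.
Qed.

Lemma ae_law l phi i (nu : {measure set R -> \bar R}) (P : R -> Prop) :
  measurable_fun setT phi -> measurable [set x | l x = i] -> is_law l phi i nu ->
  {ae nu, forall t, P t} -> {ae mu, forall x, l x = i -> P (phi x)}.
Proof.
move=> mphi ml nuE [N [mN N0 PN]]; exists ([set x | l x = i] `&` phi @^-1` N); split.
- by apply: measurableI => //; exact: measurable_preimage.
- by rewrite -nuE.
- by move=> x /= /not_implyP[lx nP]; split => //; exact: PN.
Qed.

End labelled_coding.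

Section labelled_isomorphism.
Context d (X : measurableType d) d' (Y : measurableType d') (R : realType).
Variables (mu : {measure set X -> \bar R}) (nu : {measure set Y -> \bar R}).
Variables (lX : X -> nat) (phiX : X -> R) (omX : R -> X).
Variables (lY : Y -> nat) (phiY : Y -> R) (omY : R -> Y).
Hypothesis cX : coding mu lX phiX omX.
Hypothesis cY : coding nu lY phiY omY.
Hypothesis eq_mass : forall i, mu [set x | lX x = i] = nu [set y | lY y = i].
Local Open Scope ereal_scope.

Variables (lawX lawY : nat -> {measure set R -> \bar R}).
Hypothesis lawXP : forall i, [/\ is_law mu lX phiX i (lawX i),
    forall t : R, lawX i `]-oo, t]%classic < +oo & forall t : R, lawX i [set t] = 0].
Hypothesis lawYP : forall i, [/\ is_law nu lY phiY i (lawY i),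
    forall t : R, lawY i `]-oo, t]%classic < +oo & forall t : R, lawY i [set t] = 0].

Definition label_map (x : X) : Y := omY (transport (lawX (lX x)) (lawY (lX x)) (phiX x)).

Let same i : lawX i setT = lawY i setT.
Proof.
have [lx _ _] := lawXP i; have [ly _ _] := lawYP i.
by rewrite lx// ly// !preimage_setT !setIT.
Qed.

Lemma measurable_label_map : measurable_fun setT label_map.
Proof.
have [ml mphi _ _ _] := cX; have [_ _ mom _ _] := cY.
apply: (@measurable_fun_glue _ _ _ _ lX
  (fun i x => omY (transport (lawX i) (lawY i) (phiX x)))) => // i.
have [_ fX aX] := lawXP i; have [_ fY aY] := lawYP i.
have mt : measurable_fun setT (transport (lawX i) (lawY i)) by exact: measurable_transport.
exact: (measurableT_comp mom (measurableT_comp mt mphi)).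
Qed.

Lemma label_map_ae : {ae mu, forall x,
  [/\ lY (label_map x) = lX x,
      phiY (label_map x) = transport (lawX (lX x)) (lawY (lX x)) (phiX x) &
      omX (transport (lawY (lX x)) (lawX (lX x)) (phiY (label_map x))) = x]}.
Proof.
have [ml mphi mom oK _] := cX; have [mlY mphiY momY oKY _] := cY.
(* Almost every real for the law of cell [i] is the code of a point of this cell, since the law is
   an image measure. *)
have ae1 i : {ae lawY i, forall t : R, lY (omY t) = i /\ phiY (omY t) = t}.
  have [lx fX aX] := lawXP i; have [ly fY aY] := lawYP i.
  have mP : measurable [set t : R | lY (omY t) = i /\ phiY (omY t) = t].
    rewrite [X in measurable X](_ : _ = omY @^-1` [set y | lY y = i] `&`
       [set t | phiY (omY t) = t])//.
    apply: measurableI; first exact: measurable_preimage.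
    rewrite [X in measurable X](_ : _ = (fun t => phiY (omY t) - t)%R @^-1` [set 0%R]).
      apply: measurable_preimage => //; apply: measurable_funB => //.
      exact: (measurableT_comp mphiY momY).
    by apply/seteqP; split => t /= h; [rewrite h subrr|apply/eqP; rewrite -subr_eq0; exact/eqP].
  exists (~` [set t : R | lY (omY t) = i /\ phiY (omY t) = t]); split => //.
    exact: measurableC.
  rewrite ly; last exact: measurableC.
  apply: measure_negligible.
    by apply: measurableI => //; apply: measurable_preimage => //; exact: measurableC.
  by apply: negligibleS oKY => y /= [lyi nP] oy; apply: nP; rewrite oy.
have ae2 i : {ae mu, forall x, lX x = i -> [/\ lY (omY (transport (lawX i) (lawY i) (phiX x))) = i,
    phiY (omY (transport (lawX i) (lawY i) (phiX x))) = transport (lawX i) (lawY i) (phiX x) &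
    transport (lawY i) (lawX i) (transport (lawX i) (lawY i) (phiX x)) = phiX x]}.
  have [lx fX aX] := lawXP i; have [ly fY aY] := lawYP i.
  apply: (@ae_law _ _ _ mu lX phiX i (lawX i) (fun t =>
    [/\ lY (omY (transport (lawX i) (lawY i) t)) = i,
     phiY (omY (transport (lawX i) (lawY i) t)) = transport (lawX i) (lawY i) t &
     transport (lawY i) (lawX i) (transport (lawX i) (lawY i) t) = t]) mphi (ml i) lx).
  have tK := transportK fX aX fY aY (same i).
  have mt : measurable_fun setT (transport (lawX i) (lawY i)) by exact: measurable_transport.
  have tp := transport_preserves fX aX fY (same i).
  have := ae_preimage mt tp (ae1 i); move: tK; apply: filterS2 => t t1 [t2 t3].
  by split.
have {}ae2 := ae_foralln ae2.
move: ae2 oK; apply: filterS2 => x /(_ (lX x) erefl)[h1 h2 h3] ox.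
by rewrite /label_map; split => //; rewrite h2 h3.
Qed.

Lemma label_map_preserves (B : set Y) : measurable B -> mu (label_map @^-1` B) = nu B.
Proof.
have [ml mphi mom oK _] := cX; have [mlY mphiY momY oKY _] := cY.
move=> mB; have mfB : measurable (label_map @^-1` B).
  exact: (measurable_preimage measurable_label_map).
rewrite (measure_label mu ml mfB) (measure_label nu mlY mB).
apply: eq_eseriesr => i _.
have [lx fX aX] := lawXP i; have [ly fY aY] := lawYP i.
have mt : measurable_fun setT (transport (lawX i) (lawY i)) by exact: measurable_transport.
transitivity (lawX i (transport (lawX i) (lawY i) @^-1` (omY @^-1` B))).
  rewrite lx; last by do 2 apply: measurable_preimage => //.
  by congr (mu _); apply/seteqP; split => x /= [<- h]; split.
rewrite (transport_preserves fX aX fY (same i)); last exact: measurable_preimage.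
rewrite ly; last exact: measurable_preimage.
apply: ae_eq_measure.
- by apply: measurableI => //; do 2 apply: measurable_preimage => //.
- exact: measurableI.
- by apply: filterS oKY => y /= ->; split => -[].
Qed.

End labelled_isomorphism.

Lemma labelled_isomorphism d (X : measurableType d) d' (Y : measurableType d') (R : realType)
  (mu : {measure set X -> \bar R}) (nu : {measure set Y -> \bar R})
  (lX : X -> nat) (phiX : X -> R) (omX : R -> X)
  (lY : Y -> nat) (phiY : Y -> R) (omY : R -> Y) :
  coding mu lX phiX omX -> coding nu lY phiY omY ->
  (forall i, mu [set x | lX x = i] = nu [set y | lY y = i]) ->
  exists (f : X -> Y) (g : Y -> X),
  [/\ measurable_fun setT f, measurable_fun setT g,
      (forall B, measurable B -> mu (f @^-1` B) = nu B),
      (forall A, measurable A -> nu (g @^-1` A) = mu A) &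
      [/\ {ae mu, forall x, g (f x) = x}, {ae nu, forall y, f (g y) = y},
          {ae mu, forall x, lY (f x) = lX x} & {ae nu, forall y, lX (g y) = lY y}]].
Proof.
move=> cX cY eqm.
have [lawX lawXP] := choice (fun i => ex_law i cX).
have [lawY lawYP] := choice (fun i => ex_law i cY).
have eqm' i := esym (eqm i).
have hX := label_map_ae cX cY eqm lawXP lawYP.
have hY := label_map_ae cY cX eqm' lawYP lawXP.
exists (label_map lX phiX omY lawX lawY), (label_map lY phiY omX lawY lawX); split.
- exact: (measurable_label_map cX cY lawXP lawYP).
- exact: (measurable_label_map cY cX lawYP lawXP).
- exact: (label_map_preserves cX cY eqm lawXP lawYP).
- exact: (label_map_preserves cY cX eqm' lawYP lawXP).
split.
- by apply: filterS hX => x [h1 h2 h3]; rewrite {1}/label_map h1.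
- by apply: filterS hY => x [h1 h2 h3]; rewrite {1}/label_map h1.
- by apply: filterS hX => x [].
- by apply: filterS hY => x [].
Qed.

Section ex_coding.
Context d (X : measurableType d) (R : realType) (mu : {sigma_finite_measure set X -> \bar R}).

Definition squash (y : R) : R := (y * (1 + `|y|)^-1 + 1) / 2.
Definition unsquash (z : R) : R := (2 * z - 1) * `|1 - `|2 * z - 1| |^-1.

Lemma squash_bounds y : 0 < squash y < 1.
Proof.
have y0 : 0 < 1 + `|y| by rewrite ltr_pwDl.
have : `|y * (1 + `|y|)^-1| < 1.
  by rewrite normrM normfV (gtr0_norm y0) ltr_pdivrMr// mul1r ltrDr.
by rewrite /squash ltr_norml; move: (y * _) => p /andP[h1 h2]; apply/andP; split; lra.
Qed.

Lemma squashK y : unsquash (squash y) = y.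
Proof.
have y0 : 0 < 1 + `|y| by rewrite ltr_pwDl.
rewrite /unsquash /squash.
have -> : 2 * ((y * (1 + `|y|)^-1 + 1) / 2) - 1 = y * (1 + `|y|)^-1 by lra.
rewrite normrM normfV (gtr0_norm y0).
have -> : 1 - `|y| / (1 + `|y|) = (1 + `|y|)^-1 by field; rewrite gt_eqF.
by rewrite normfV (gtr0_norm y0) invrK divfK// gt_eqF.
Qed.

Lemma measurable_squash : measurable_fun setT squash.
Proof.
apply: measurable_funM => //; apply: measurable_funD => //; apply: measurable_funM => //.
apply: measurable_fun_inv => [y|]; first by rewrite addr_ge0.
by apply: measurable_funD => //; exact: measurableT_comp.
Qed.

Lemma measurable_unsquash : measurable_fun setT unsquash.
Proof.
have m2 : measurable_fun setT (fun z : R => 2 * z - 1).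
  by apply: measurable_funB => //; exact: measurable_funM.
apply: measurable_funM => //; apply: measurable_fun_inv => [z|]; first exact: normr_ge0.
apply: measurableT_comp => //; apply: measurable_funB => //.
exact: measurableT_comp.
Qed.

(** The integer part of the new code is the rank of the first [W n] containing the point, the
    fractional part is the old code squashed into []0, 1[]. Codes below [t] then lie in a single
    [W n], so left rays get finite mass. *)
Lemma ex_coding (l : X -> nat) (phi : X -> R) (om : R -> X) :
  (forall i, measurable [set x | l x = i]) ->
  measurable_fun setT phi -> measurable_fun setT om ->
  {ae mu, forall x, om (phi x) = x} -> (forall r : R, mu (phi @^-1` [set r]) = 0%E) ->
  exists (phi' : X -> R) (om' : R -> X), coding mu l phi' om'.
Proof.
move=> ml mphi mom oK atom.
have [W [mW Wfin ndW WT]] := sigma_finite_nd mu.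
have exW x : exists n, `[< W n x >].
  by have [n _ Wx] : (\bigcup_n W n) x by [rewrite WT]; exists n; apply/asboolP.
pose k x := ex_minn (exW x).
have kP x n : (k x <= n)%N <-> W n x.
  rewrite /k; case: ex_minnP => m /asboolP Wm mmin; split => [mn|/asboolP/mmin//].
  by move: (ndW _ _ mn); rewrite subsetEset; apply.
have mk n : measurable [set x | k x = n].
  case: n => [|n].
    rewrite [X in measurable X](_ : _ = W 0%N)//; apply/seteqP; split => x /=.
      by move=> kx; apply/kP; rewrite kx.
    by move=> /kP; rewrite leqn0 => /eqP.
  rewrite [X in measurable X](_ : _ = W n.+1 `\` W n); first exact: measurableD.
  apply/seteqP; split => x /=.
    by move=> kx; split; [apply/kP; rewrite kx|move=> /kP; rewrite kx ltnn].
  move=> [/kP k1 k2]; apply/eqP; rewrite eqn_leq k1 ltnNge; apply/negP => /kP; exact: k2.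
pose phi' x := (k x)%:R + squash (phi x).
pose om' (r : R) := om (unsquash (r - (Num.truncn r)%:R)).
have tk x : Num.truncn (phi' x) = k x.
  apply: truncn_def; have /andP[s0 s1] := squash_bounds (phi x).
  by rewrite /phi' lerDl ltW//= -natr1 ltrD2l.
have uk x : unsquash (phi' x - (Num.truncn (phi' x))%:R) = phi x.
  by rewrite tk /phi' addrC addKr squashK.
exists phi', om'; split => //.
- apply: (@measurable_fun_glue _ _ _ R k (fun n x => n%:R + squash (phi x))) => // n.
  by apply: measurable_funD => //; exact: (measurableT_comp measurable_squash mphi).
- apply: (@measurable_fun_glue _ _ R X (fun r => Num.truncn r)
    (fun n r => om (unsquash (r - n%:R)))) => n.
    exact: measurable_truncn_eq.
  apply: (measurableT_comp mom); apply: (measurableT_comp measurable_unsquash).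
  exact: measurable_funB.
- by apply: filterS oK => x ox; rewrite /om' uk.
have mphi' : measurable_fun setT phi'.
  apply: (@measurable_fun_glue _ _ _ R k (fun n x => n%:R + squash (phi x))) => // n.
  by apply: measurable_funD => //; exact: (measurableT_comp measurable_squash mphi).
split => [r|t].
  apply/eqP; rewrite eq_le measure_ge0 andbT -(atom (unsquash (r - (Num.truncn r)%:R))).
  apply: le_measure; rewrite ?inE.
  - exact: measurable_preimage.
  - exact: measurable_preimage.
  - by move=> x /= <-; rewrite uk.
apply: le_lt_trans (Wfin (Num.truncn t)); apply: le_measure; rewrite ?inE//.
  exact: measurable_preimage.
move=> x /=; rewrite in_itv/= => xt; apply/kP.
have /andP[s0 s1] := squash_bounds (phi x).
have kt : (k x)%:R <= t by apply: le_trans xt; rewrite /phi' lerDl ltW.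
by rewrite truncn_ge_nat// (le_trans _ kt).
Qed.

(** A fibre of an injective coding has at most one point, and nonatomicity would split a fibre of
    positive measure into two nonempty sets. Reals that code nothing are decoded to [x0]. *)
Lemma standard_borel_code (x0 : X) : @standard_borel d X R -> nonatomic mu ->
  exists (phi : X -> R) (om : R -> X), [/\ measurable_fun setT phi, measurable_fun setT om,
    (forall x, om (phi x) = x) & forall r : R, mu (phi @^-1` [set r]) = 0%E].
Proof.
move=> [phi [phi_inj [mphi phi_img]]] na.
have sing (r : R) : mu (phi @^-1` [set r]) = 0%E.
  apply: contrapT => /eqP n0.
  have mr : measurable (phi @^-1` [set r]) by exact: measurable_preimage.
  have gt0 : (0 < mu (phi @^-1` [set r]))%E by rewrite lt0e n0 measure_ge0.
  have [B [mB BA B0 AB0]] := na _ mr gt0.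
  have [x Bx] : B !=set0.
    by apply/set0P/negP => /eqP B00; move: B0; rewrite B00 measure0 ltxx.
  have [y [Ay nBy]] : phi @^-1` [set r] `\` B !=set0.
    by apply/set0P/negP => /eqP B00; move: AB0; rewrite B00 measure0 ltxx.
  by apply: nBy; have -> : y = x by apply: phi_inj; rewrite (BA _ Bx) Ay.
pose om (r : R) : X := xget x0 [set x | phi x = r].
have omK x : om (phi x) = x.
  by rewrite /om; case: xgetP => [y _ /= /phi_inj//|/(_ x)/= h]; case: h.
exists phi, om; split => // _ A mA; rewrite setTI.
rewrite [X in measurable X](_ : _ = phi @` A `|`
    (~` (phi @` setT) `&` [set _ | A x0])).
  apply: measurableU; first exact: phi_img.
  apply: measurableI; first by apply: measurableC; exact: phi_img.
  have [Ax|Ax] := pselect (A x0).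
    by rewrite [X in measurable X](_ : _ = setT)//; apply/seteqP; split.
  by rewrite [X in measurable X](_ : _ = set0)//; apply/seteqP; split.
apply/seteqP; split => r /=.
  have [[x _ <-]|nr] := pselect ((phi @` setT) r); first by rewrite omK; left; exists x.
  move=> Ar; right; split => //; move: Ar; rewrite /om; case: xgetP => // y _ /= yr.
  by case: nr; exists y.
move=> [[x Ax <-]|[nr Ax]]; first by rewrite omK.
by rewrite /om; case: xgetP => // y _ /= yr; case: nr; exists y.
Qed.

End ex_coding.

(** * Towers over the odometer *)

Section levels.
Context (R : realType).

Definition fr (y : R) : R := y - (Num.truncn y)%:R.

Lemma truncn_level (b : R) j : 0 <= b < 1 -> Num.truncn (b + j%:R) = j.
Proof.
move=> /andP[b0 b1]; apply: truncn_def.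
by rewrite lerDr b0/= -natr1 addrC ltrD2l.
Qed.

Lemma fr_level (b : R) j : 0 <= b < 1 -> fr (b + j%:R) = b.
Proof. by move=> b01; rewrite /fr truncn_level// addrK. Qed.

Lemma fr_bounds (y : R) : 0 <= y -> 0 <= fr y < 1.
Proof.
move=> y0; rewrite /fr subr_ge0 truncn_le y0/= ltrBlDr addrC natr1 truncnS_gt//.
Qed.

Lemma frK (y : R) : fr y + (Num.truncn y)%:R = y.
Proof. by rewrite /fr subrK. Qed.

Lemma measurable_truncn n : measurable [set y : R | Num.truncn y = n].
Proof. exact: measurable_truncn_eq. Qed.

Lemma measurable_fr : measurable_fun setT fr.
Proof.
apply: (@measurable_fun_glue _ _ R R (fun y => Num.truncn y) (fun n y => y - n%:R)) => n.
  exact: measurable_truncn.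
exact: measurable_funB.
Qed.

Local Open Scope ereal_scope.

Lemma ge0_integral_levels (f : R -> \bar R) : measurable_fun setT f -> (forall y, 0 <= f y) ->
  \int[leb]_(y in `[0%R, +oo[) f y = \sum_(j <oo) \int[leb]_(b in `[0%R, 1%R[) f (b + j%:R)%R.
Proof.
move=> mf f0.
have -> : `[0%R, +oo[%classic = \bigcup_j `[j%:R, j.+1%:R : R[%classic.
  apply/seteqP; split => [y|y [j _]]; rewrite /= !in_itv/=.
    rewrite andbT => y0; exists (Num.truncn y) => //; rewrite /= in_itv/=.
    by rewrite truncn_le y0 truncnS_gt.
  by move=> /andP[jy _]; rewrite andbT (le_trans _ jy).
have tr : trivIset setT (fun j => `[j%:R, j.+1%:R : R[%classic).
  move=> i j _ _ [y []]; rewrite /= !in_itv/= => /andP[i1 i2] /andP[j1 j2].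
  have := le_lt_trans i1 j2; have := le_lt_trans j1 i2; rewrite !ltr_nat !ltnS => h1 h2.
  by apply/eqP; rewrite eqn_leq h1 h2.
rewrite ge0_integral_bigcup//; last exact: measurable_funTS.
apply: eq_eseriesr => j _.
rewrite (@integral_itv_affine _ 1%R j%:R 0%R 1%R)//; last 2 first.
- by rewrite mulr0 add0r.
- by rewrite mulr1 -natr1 addrC.
by rewrite mul1e; apply: eq_integral => b _; rewrite mul1r.
Qed.

End levels.

Section tower.
Context (R : realType) (rho : nat -> R -> R) (H : R -> nat).
Hypothesis mrho : forall j, measurable_fun setT (rho j).
Hypothesis mH : forall n, measurable [set b | H b = n].
Hypothesis H0 : forall b, (0 < H b)%N.
Hypothesis rho_gt0 : forall j b, (j < H b)%N -> 0 < rho j b.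
Hypothesis rho_eq0 : forall j b, (H b <= j)%N -> rho j b = 0.
Hypothesis rho_top : forall b, 0 <= b < 1 ->
  rho (H b).-1 b = rho 0%N (odo b) * odo_slope b.

Lemma rho_ge0 j b : 0 <= rho j b.
Proof.
by case: (ltnP j (H b)) => h; [exact/ltW/rho_gt0|rewrite rho_eq0].
Qed.

(* The tower over [0, 1[ is unfolded in the half line: the point of level [j]
   above [b] is [b + j]. *)
Definition tower_density (y : R) : R :=
  if 0 <= y then rho (Num.truncn y) (fr y) else 0.

Definition tower_map (y : R) : R :=
  if ((Num.truncn y).+1 < H (fr y))%N then y + 1 else odo (fr y).

Definition tower_inv (y : R) : R :=
  if Num.truncn y is 0%N then odo_inv (fr y) + (H (odo_inv (fr y))).-1%:R else y - 1.

(** The derivative at the arrival point. On level [0] it is [1], because [rho_top] makes the return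
    to the base preserve the densities. *)
Definition tower_der (y : R) : R :=
  if Num.truncn y is j.+1 then rho j (fr y) / rho j.+1 (fr y) else 1.

Lemma tower_density_ge0 y : 0 <= tower_density y.
Proof. by rewrite /tower_density; case: ifPn => // _; exact: rho_ge0. Qed.

Lemma tower_der_ge0 y : 0 <= tower_der y.
Proof.
by rewrite /tower_der; case: (Num.truncn y) => // j; rewrite divr_ge0// rho_ge0.
Qed.

Lemma measurable_tower_density : measurable_fun setT tower_density.
Proof.
apply: measurable_fun_ifT => //; first exact: measurable_fun_ler.
apply: (@measurable_fun_glue _ _ R R (fun y => Num.truncn y) (fun n y => rho n (fr y))) => n.
  exact: measurable_truncn.
exact: (measurableT_comp (mrho n) (@measurable_fr R)).
Qed.

Lemma measurable_tower_der : measurable_fun setT tower_der.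
Proof.
apply: (@measurable_fun_glue _ _ R R (fun y => Num.truncn y)
  (fun n y => if n is j.+1 then rho j (fr y) / rho j.+1 (fr y) else 1)) => n.
  exact: measurable_truncn.
case: n => [|n]; first exact: measurable_cst.
apply: measurable_funM; first exact: (measurableT_comp (mrho n) (@measurable_fr R)).
apply: measurable_fun_inv => [y|]; first exact: rho_ge0.
exact: (measurableT_comp (mrho n.+1) (@measurable_fr R)).
Qed.

Lemma measurable_tower_map : measurable_fun setT tower_map.
Proof.
apply: (@measurable_fun_glue _ _ R R (fun y => Num.truncn y)
  (fun n y => if (n.+1 < H (fr y))%N then y + 1 else odo (fr y))) => n.
  exact: measurable_truncn.
apply: (@measurable_fun_glue _ _ R R (fun y => H (fr y))
  (fun m y => if (n.+1 < m)%N then y + 1 else odo (fr y))) => m.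
  have -> : [set y : R | H (fr y) = m] = @fr R @^-1` [set b | H b = m] by [].
  by apply: measurable_preimage => //; exact: measurable_fr.
case: (_ < _)%N; first exact: measurable_funD.
exact: (measurableT_comp (@measurable_odo R) (@measurable_fr R)).
Qed.

Lemma measurable_tower_inv : measurable_fun setT tower_inv.
Proof.
apply: (@measurable_fun_glue _ _ R R (fun y => Num.truncn y)
  (fun n y => if n is 0%N then odo_inv (fr y) + (H (odo_inv (fr y))).-1%:R else y - 1)) => n.
  exact: measurable_truncn.
case: n => [|n]; last exact: measurable_funB.
have mo : measurable_fun setT (fun y : R => odo_inv (fr y)).
  exact: (measurableT_comp (@measurable_odo_inv R) (@measurable_fr R)).
apply: (@measurable_fun_glue _ _ R R (fun y => H (odo_inv (fr y)))
  (fun m y => odo_inv (fr y) + m.-1%:R)) => m; last exact: measurable_funD.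
have -> : [set y : R | H (odo_inv (fr y)) = m] = (fun y => odo_inv (fr y)) @^-1` [set b | H b = m] by [].
exact: measurable_preimage.
Qed.

Definition in_tower (y : R) : Prop := 0 <= y /\ (Num.truncn y < H (fr y))%N.

Lemma tower_density_gt0 y : in_tower y -> 0 < tower_density y.
Proof. by move=> [y0 yH]; rewrite /tower_density y0 rho_gt0. Qed.

Lemma tower_density_eq0 y : ~ in_tower y -> tower_density y = 0.
Proof.
rewrite /tower_density; case: ifPn => // y0 nt; apply: rho_eq0.
by rewrite leqNgt; apply/negP => h; apply: nt.
Qed.

Lemma in_tower_level b j : 0 <= b < 1 -> in_tower (b + j%:R) <-> (j < H b)%N.
Proof.
move=> b01; rewrite /in_tower truncn_level// fr_level//; split => [[]//|jH]; split => //.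
by move: b01 => /andP[b0 _]; rewrite addr_ge0.
Qed.

Lemma tower_map_level b j : 0 <= b < 1 ->
  tower_map (b + j%:R) = if (j.+1 < H b)%N then b + j.+1%:R else odo b.
Proof. by move=> b01; rewrite /tower_map truncn_level// fr_level// -addrA natr1. Qed.

Lemma tower_der_level b j : 0 <= b < 1 ->
  tower_der (b + j%:R) = if j is i.+1 then rho i b / rho i.+1 b else 1.
Proof. by move=> b01; rewrite /tower_der truncn_level// fr_level. Qed.

Lemma tower_der_gt0 y : in_tower y -> 0 < tower_der y.
Proof.
move=> [y0]; rewrite /tower_der; case: (Num.truncn y) => // j jH.
by rewrite divr_gt0// rho_gt0// ltnW.
Qed.

Lemma in_towerE y : in_tower y -> exists b j, [/\ 0 <= b < 1, (j < H b)%N & y = b + j%:R].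
Proof.
by move=> [y0 yH]; exists (fr y), (Num.truncn y); split; rewrite ?fr_bounds ?frK.
Qed.

Lemma tower_mapK y : in_tower y -> tower_inv (tower_map y) = y.
Proof.
move=> /in_towerE[b [j [b01 jH ->]]]; rewrite tower_map_level//.
have [jH'|Hj] := ltnP.
  by rewrite /tower_inv truncn_level// -natr1 addrA addrK.
have [c0 c1 _ cK] := odo_bounds b01.
have o01 : 0 <= odo b < 1 by rewrite ltW.
rewrite -[odo b]addr0 /tower_inv (truncn_level 0 o01) (fr_level 0 o01) cK.
by rewrite (_ : H b = j.+1)//; apply/eqP; rewrite eqn_leq Hj jH.
Qed.

(** The point [0] is excluded since the odometer never takes this value. *)
Lemma tower_invK y : in_tower y -> y != 0 -> tower_map (tower_inv y) = y /\ in_tower (tower_inv y).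
Proof.
move=> /in_towerE[b [j [b01 jH ->]]] n0; have /andP[b0 b1] := b01.
rewrite /tower_inv truncn_level// fr_level//; case: j jH n0 => [|j] jH n0.
  rewrite addr0 in n0 *; have b01' : 0 < b < 1 by rewrite b1 andbT lt_neqAle eq_sym n0.
  have [c01 cK] := odo_invK b01'; rewrite tower_map_level// prednK// ltnn cK; split => //.
  by apply/in_tower_level => //; rewrite prednK.
rewrite -natr1 addrA addrK tower_map_level// jH -natr1 addrA; split => //.
exact/in_tower_level/ltnW.
Qed.

Local Open Scope ereal_scope.

Definition tower_measure : set R -> \bar R :=
  @with_density _ R R leb _ measurable_tower_density tower_density_ge0.
HB.instance Definition _ := Measure.on tower_measure.

Lemma ge0_integral_tower_density (f : R -> \bar R) : measurable_fun setT f ->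
  (forall y, 0 <= f y) ->
  \int[tower_measure]_y f y = \int[leb]_y (f y * (tower_density y)%:E).
Proof.
exact: (@ge0_integral_with_density _ R R (@leb R) _ measurable_tower_density tower_density_ge0).
Qed.

Lemma ge0_integral_tower (f : R -> \bar R) : measurable_fun setT f -> (forall y, 0 <= f y) ->
  \int[tower_measure]_y f y =
  \sum_(j <oo) \int[leb]_(b in `[0%R, 1%R[) (f (b + j%:R)%R * (rho j b)%:E).
Proof.
move=> mf f0; rewrite ge0_integral_tower_density//.
have m1 : measurable_fun setT (fun y => f y * (tower_density y)%:E).
  by apply: emeasurable_funM => //; apply/measurable_EFinP; exact: measurable_tower_density.
transitivity (\int[leb]_(y in `[0%R, +oo[) (f y * (tower_density y)%:E)).
  rewrite [RHS]integral_mkcond; apply: eq_integral => y _.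
  rewrite /patch; case: ifPn => //; rewrite notin_setE/= in_itv/= andbT => /negP y0.
  by rewrite /tower_density (negbTE y0) mule0.
have fd0 y : 0 <= f y * (tower_density y)%:E.
  by rewrite mule_ge0// lee_fin tower_density_ge0.
rewrite (ge0_integral_levels m1 fd0).
apply: eq_eseriesr => j _; apply: eq_integral => b; rewrite inE/= in_itv/= => b01.
rewrite /tower_density truncn_level// fr_level// ifT//.
by move: b01 => /andP[b0 _]; rewrite addr_ge0.
Qed.

(** Going up, the derivative is the quotient of two densities and cancels the second one; from the
    top, it is the change of variables of the odometer together with [rho_top]. *)
Lemma tower_change_of_variables (h : R -> \bar R) : measurable_fun setT h -> (forall y, 0 <= h y) ->
  \int[tower_measure]_y h (tower_map y) = \int[tower_measure]_y (h y * (tower_der y)%:E).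
Proof.
move=> mh h0.
have mder : measurable_fun setT (fun y => h y * (tower_der y)%:E).
  by apply: emeasurable_funM => //; apply/measurable_EFinP; exact: measurable_tower_der.
rewrite ge0_integral_tower//; last exact: (measurableT_comp mh measurable_tower_map).
rewrite ge0_integral_tower//; last first.
  by move=> y; rewrite mule_ge0// lee_fin tower_der_ge0.
(* [A j] is the part of level [j] that goes up, [B j] the part where [j] is the top level, which
   returns to the base. *)
pose A j b := if (j.+1 < H b)%N then h (b + j.+1%:R)%R * (rho j b)%:E else 0.
pose g b := h (odo b) * (rho (H b).-1 b)%:E.
pose B j b := if (H b == j.+1)%N then g b else 0.
have mA j : measurable_fun setT (A j).
  apply: (@measurable_fun_glue _ _ R (\bar R) H
    (fun m b => if (j.+1 < m)%N then h (b + j.+1%:R)%R * (rho j b)%:E else 0)) => // m.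
  case: (_ < _)%N; last exact: measurable_cst.
  apply: emeasurable_funM; last exact/measurable_EFinP.
  by apply: (measurableT_comp mh); exact: measurable_funD.
have mg : measurable_fun setT g.
  apply: emeasurable_funM; first exact: (measurableT_comp mh (@measurable_odo R)).
  apply/measurable_EFinP.
  by apply: (@measurable_fun_glue _ _ R R H (fun m b => rho m.-1 b)).
have mB j : measurable_fun setT (B j).
  apply: (@measurable_fun_glue _ _ R (\bar R) H
    (fun m b => if (m == j.+1)%N then g b else 0)) => // m.
  by case: (_ == _)%N => //; exact: measurable_cst.
have A0 j b : 0 <= A j b.
  by rewrite /A; case: ifPn => // _; rewrite mule_ge0// lee_fin rho_ge0.
have g0 b : 0 <= g b by rewrite mule_ge0// lee_fin rho_ge0.
have B0 j b : 0 <= B j b by rewrite /B; case: ifPn.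
transitivity (\sum_(j <oo) \int[leb]_(b in `[0%R, 1%R[) A j b +
              \sum_(j <oo) \int[leb]_(b in `[0%R, 1%R[) B j b).
  rewrite -nneseriesD; last 2 first.
  - by move=> j _ _; exact: integral_ge0.
  - by move=> j _ _; exact: integral_ge0.
  apply: eq_eseriesr => j _; rewrite -ge0_integralD//; last 2 first.
  - exact: measurable_funTS.
  - exact: measurable_funTS.
  apply: eq_integral => b; rewrite inE/= in_itv/= => b01; rewrite tower_map_level// /A /B /g.
  have [jH|Hj] := ltnP; first by rewrite gtn_eqF// adde0.
  have [->|n] := eqVneq (H b) j.+1; first by rewrite add0e.
  by rewrite add0e rho_eq0 ?mule0// -ltnS ltn_neqAle n.
rewrite [RHS]nneseries_recl//; last by move=> j _; apply: integral_ge0 => b _; rewrite !mule_ge0// lee_fin ?rho_ge0 ?tower_der_ge0.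
rewrite addeC; congr (_ + _).
  transitivity (\int[leb]_(b in `[0%R, 1%R[) g b).
    pose F j : set R := `[0%R, 1%R[%classic `&` [set b | H b = j.+1].
    have -> : \int[leb]_(b in `[0%R, 1%R[) g b = \int[leb]_(b in \bigcup_j F j) g b.
      congr (integral _ _ _); apply/seteqP; split => [b b01|b [j _ []]//].
      by exists (H b).-1 => //; split => //=; rewrite prednK.
    rewrite ge0_integral_bigcup//; last 3 first.
    - by move=> j; exact: measurableI.
    - exact: measurable_funTS.
    - by move=> i j _ _ [b [[_ /= h1] [_ /=]]]; rewrite h1 => -[].
    apply: eq_eseriesr => j _; rewrite /F integral_mkcondr; apply: eq_integral => b _.
    rewrite /B /patch; congr (if _ then _ else _).
    by apply/eqP/idP; rewrite inE.
  rewrite (eq_integral (fun b => (fun c => h c * (rho 0%N c)%:E) (odo b) * (odo_slope b)%:E)); last first.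
    by move=> b; rewrite inE/= in_itv/= => b01; rewrite /g rho_top// EFinM muleA.
  rewrite (@odo_change_of_variables _ (fun c => h c * (rho 0%N c)%:E)); last first.
  - by move=> c; rewrite mule_ge0// lee_fin rho_ge0.
  - by apply: emeasurable_funM => //; exact/measurable_EFinP.
  apply: eq_integral => b; rewrite inE/= in_itv/= => b01.
  by rewrite tower_der_level// mule1 addr0.
rewrite -(@nneseries_addn _ (fun j => \int[leb]_(b in `[0%R, 1%R[)
   (h (b + j%:R)%R * (tower_der (b + j%:R))%:E * (rho j b)%:E)) 1); last first.
  by move=> j; apply: integral_ge0 => b _; rewrite !mule_ge0// lee_fin ?rho_ge0 ?tower_der_ge0.
apply: eq_eseriesr => j _; rewrite addn1; apply: eq_integral => b; rewrite inE/= in_itv/= => b01.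
rewrite tower_der_level// -muleA -EFinM /A; case: ltnP => jH.
  by rewrite divfK// gt_eqF// rho_gt0.
by rewrite [rho j.+1 b]rho_eq0// mulr0 mule0.
Qed.

End tower.

(** * From almost everywhere inverse maps to bijections *)

Section patch.
Context d (X : measurableType d) (R : realType) (mu : {measure set X -> \bar R}).
Variables (T1 S1 : X -> X).
Hypotheses (mT1 : measurable_fun setT T1) (mS1 : measurable_fun setT S1).
Hypothesis nT1 : forall N, measurable N -> mu N = 0%E -> mu (T1 @^-1` N) = 0%E.
Hypothesis nS1 : forall N, measurable N -> mu N = 0%E -> mu (S1 @^-1` N) = 0%E.
Hypothesis aeST : {ae mu, forall x, S1 (T1 x) = x}.
Hypothesis aeTS : {ae mu, forall x, T1 (S1 x) = x}.

Let act (w : seq bool) (x : X) : X := foldl (fun x b => if b then T1 x else S1 x) x w.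

Let measurable_act w : measurable_fun setT (act w).
Proof.
elim: w => [|b w IH]; first exact: measurable_id.
by case: b; [exact: (measurableT_comp IH mT1)|exact: (measurableT_comp IH mS1)].
Qed.

Let null_act w N : measurable N -> mu N = 0%E -> mu (act w @^-1` N) = 0%E.
Proof.
move=> mN N0; elim: w => [|[] w IH]//.
- rewrite (_ : act _ @^-1` N = T1 @^-1` (act w @^-1` N))//.
  by apply: nT1 => //; exact: measurable_preimage.
- rewrite (_ : act _ @^-1` N = S1 @^-1` (act w @^-1` N))//.
  by apply: nS1 => //; exact: measurable_preimage.
Qed.

(** [nonsingular_inv] demands a bijection everywhere. The points all of whose images under words in
    [T1] and [S1] avoid the bad null set form a conull set, stable under both maps, as there are
    countably many words; outside it both maps become the identity. *)
Lemma exact_bijection : exists T S : X -> X,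
  [/\ nonsingular_inv mu T, cancel T S, cancel S T & measurable_fun setT S] /\
  {ae mu, forall x, T x = T1 x} /\ {ae mu, forall x, S x = S1 x}.
Proof.
have [N [mN N0 NG]] : mu.-negligible (~` [set x | S1 (T1 x) = x /\ T1 (S1 x) = x]).
  by move: aeST aeTS; apply: filterS2.
have GN x : ~ N x -> S1 (T1 x) = x /\ T1 (S1 x) = x.
  by move=> nNx; apply: contrapT => h; apply/nNx/NG.
pose X0 := [set x | forall w, ~ N (act w x)].
pose word n : seq bool := odflt [::] (unpickle n).
have X0C : ~` X0 = \bigcup_n act (word n) @^-1` N.
  apply/seteqP; split => [x /existsNP[w /contrapT Nw]|x [n _ Nn] h]; last exact: h Nn.
  by exists (pickle w) => //; rewrite /word pickleK.
have mX0C : measurable (~` X0).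
  by rewrite X0C; apply: bigcupT_measurable => n; exact: measurable_preimage.
have mX0 : measurable X0 by rewrite -[X0]setCK; exact: measurableC.
have X00 : mu.-negligible (~` X0).
  rewrite X0C; apply: negligible_bigcup => n.
  exists (act (word n) @^-1` N); split => //; last exact: null_act.
  exact: measurable_preimage.
have X0T x : X0 x -> X0 (T1 x) by move=> h w; exact: (h (true :: w)).
have X0S x : X0 x -> X0 (S1 x) by move=> h w; exact: (h (false :: w)).
have X0G x : X0 x -> S1 (T1 x) = x /\ T1 (S1 x) = x by move=> h; apply/GN/(h [::]).
pose patch (f : X -> X) x := if `[< X0 x >] then f x else x.
have patchE f x : X0 x -> patch f x = f x by move=> h; rewrite /patch asboolT.
have patchN f x : ~ X0 x -> patch f x = x by move=> h; rewrite /patch asboolF.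
have mpatch f : measurable_fun setT f -> measurable_fun setT (patch f).
  move=> mf.
  have -> : patch f = fun x => if nat_of_bool `[< X0 x >] is 0%N then x else f x.
    by apply/funext => x; rewrite /patch; case: asboolP.
  apply: (@measurable_fun_glue _ _ X X (fun x => nat_of_bool `[< X0 x >])
    (fun n x => if n is 0%N then x else f x)) => [[|[|n]]|[|n]] //.
  - rewrite [X in measurable X](_ : _ = ~` X0)//.
    by apply/seteqP; split => x /=; case: asboolP.
  - rewrite [X in measurable X](_ : _ = X0)//.
    by apply/seteqP; split => x /=; case: asboolP.
  - rewrite [X in measurable X](_ : _ = set0)//.
    by apply/seteqP; split => x /=; case: asboolP.
have aeP (f : X -> X) : {ae mu, forall x, patch f x = f x}.
  by apply: negligibleS X00 => x /= h X0x; apply: h; exact: patchE.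
have nul f A : measurable_fun setT f -> measurable A ->
    (forall N, measurable N -> mu N = 0%E -> mu (f @^-1` N) = 0%E) ->
    mu A = 0%E -> mu (patch f @^-1` A) = 0%E.
  move=> mf mA nf A0; rewrite -(nf _ mA A0); apply: ae_eq_measure.
  - by apply: measurable_preimage => //; exact: mpatch.
  - exact: measurable_preimage.
  - by apply: filterS (aeP f) => x /= ->.
have KTS : cancel (patch T1) (patch S1).
  move=> x; have [Xx|nXx] := pselect (X0 x); last by rewrite !(patchN _ _ nXx).
  by rewrite (patchE _ _ Xx) patchE; [have [] := X0G _ Xx|exact: X0T].
have KST : cancel (patch S1) (patch T1).
  move=> x; have [Xx|nXx] := pselect (X0 x); last by rewrite !(patchN _ _ nXx).
  by rewrite (patchE _ _ Xx) patchE; [have [] := X0G _ Xx|exact: X0S].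
exists (patch T1), (patch S1); split; last by split; exact: aeP.
split => //; last exact: mpatch.
exists (patch S1); split => //; [exact: mpatch|exact: mpatch|].
move=> A mA; split => h; last exact: nul.
rewrite (_ : A = patch S1 @^-1` (patch T1 @^-1` A)).
  by apply: nul => //; apply: measurable_preimage => //; exact: mpatch.
by apply/seteqP; split => x /=; rewrite KST.
Qed.

End patch.

Section cov.
Context d (X : measurableType d) d' (Y : measurableType d') (R : realType).
Variables (mu : {measure set X -> \bar R}) (nu : {measure set Y -> \bar R}).
Local Open Scope ereal_scope.

Lemma ge0_integral_transfer (f : X -> Y) (h : Y -> \bar R) : measurable_fun setT f ->
  (forall B, measurable B -> mu (f @^-1` B) = nu B) ->
  measurable_fun setT h -> (forall y, 0 <= h y) ->
  \int[mu]_x h (f x) = \int[nu]_y h y.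
Proof.
move=> mf fmu mh h0.
have E : forall A, measurable A ->
    \int[mu]_(x in f @^-1` A) (cst 1%R x)%:E = \int[nu]_(y in A) (cst 1%R y)%:E.
  move=> A mA; rewrite !(integral_cst _ _ 1)//; last exact: measurable_preimage.
  by rewrite !mul1e fmu.
have := @ge0_change_of_variables _ _ _ _ _ mu nu f (cst 1%R) (cst 1%R) h mf
  (measurable_cst _) (fun=> ler01) (measurable_cst _) (fun=> ler01) E mh h0.
rewrite (eq_integral _ _ (fun x _ => mule1 (h (f x)))) => ->.
by apply: eq_integral => y _; rewrite mule1.
Qed.

End cov.

Section null_of_integral0.
Context d (X : measurableType d) (R : realType) (m : {measure set X -> \bar R}).

Lemma null_of_integral0 (A : set X) (f : X -> R) : measurable A -> measurable_fun setT f ->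
  (forall x, A x -> 0 < f x) -> (\int[m]_(x in A) (f x)%:E = 0)%E -> m A = 0%E.
Proof.
move=> mA mf f0 i0.
have : (\int[m]_(x in A) `|(f x)%:E| = 0)%E.
  rewrite -[RHS]i0; apply: eq_integral => x; rewrite inE => Ax.
  by rewrite gee0_abs// lee_fin ltW// f0.
have mfA : measurable_fun A (EFin \o f) by apply/measurable_EFinP; exact: measurable_funTS.
move=> /(ae_eq_integral_abs m mA mfA) h.
apply: (measure_negligible mA); apply: negligibleS h => x /= Ax h.
by have := f0 _ Ax; have [->] := h Ax; rewrite ltxx.
Qed.

End null_of_integral0.

(** * The transformation defined by a tower, and its ergodicity *)

Section transfer.
Context d (X : measurableType d) (R : realType) (mu : {sigma_finite_measure set X -> \bar R}).
Variables (rho : nat -> R -> R) (H : R -> nat).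
Hypothesis mrho : forall j, measurable_fun setT (rho j).
Hypothesis mH : forall n, measurable [set b | H b = n].
Hypothesis H0 : forall b, (0 < H b)%N.
Hypothesis rho_gt0 : forall j b, (j < H b)%N -> 0 < rho j b.
Hypothesis rho_eq0 : forall j b, (H b <= j)%N -> rho j b = 0.
Hypothesis rho_top : forall b, 0 <= b < 1 ->
  rho (H b).-1 b = rho 0%N (odo b) * odo_slope b.
Local Open Scope ereal_scope.
Notation nu := (tower_measure mrho rho_gt0 rho_eq0).
Notation That := (tower_map H).
Notation Tinv := (tower_inv H).
Notation der := (tower_der rho).

Variables (th : X -> R) (th' : R -> X).
Hypotheses (mth : measurable_fun setT th) (mth' : measurable_fun setT th').
Hypothesis thP : forall B, measurable B -> mu (th @^-1` B) = nu B.
Hypothesis th'P : forall A, measurable A -> nu (th' @^-1` A) = mu A.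
Hypothesis thK : {ae mu, forall x, th' (th x) = x}.
Hypothesis th'K : {ae nu, forall y, th (th' y) = y}.

Let mThat : measurable_fun setT That.
Proof. exact: measurable_tower_map. Qed.

Let mTinv : measurable_fun setT Tinv.
Proof. exact: measurable_tower_inv. Qed.

Let mder : measurable_fun setT der.
Proof. exact: (measurable_tower_der mrho rho_gt0 rho_eq0). Qed.

Let mdens := measurable_tower_density mrho.

Let der_ge0 y : (0 <= der y)%R.
Proof. exact: (tower_der_ge0 rho_gt0 rho_eq0). Qed.

Let dens_gt0 y : in_tower H y <-> (0 < tower_density rho y)%R.
Proof.
split => [h|h]; first exact: (tower_density_gt0 rho_gt0).
by apply: contrapT => nt; move: h; rewrite (tower_density_eq0 rho_eq0)// ltxx.
Qed.

Let m_in_tower : measurable [set y | in_tower H y].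
Proof.
rewrite [X in measurable X](_ : _ = [set y | 0 < tower_density rho y]%R).
  by rewrite -[X in measurable X]setTI; exact: measurable_fun_ltr.
by apply/seteqP; split => y /dens_gt0.
Qed.

Let nuE (A : set R) : nu A = \int[leb]_(y in A) (tower_density rho y)%:E.
Proof. by []. Qed.

(** The density is positive exactly on the tower, so that [nu] and Lebesgue measure have the same
    null sets there. *)
Lemma ae_tower_leb (P : R -> Prop) : {ae nu, forall y, P y} ->
  {ae leb, forall y, in_tower H y -> P y}.
Proof.
move=> [N [mN N0 PN]]; exists (N `&` [set y | in_tower H y]); split.
- exact: measurableI.
- have mD : measurable (N `&` [set y | in_tower H y]) by exact: measurableI.
  apply: (@null_of_integral0 _ _ _ leb _ (tower_density rho)) => //.
  + by move=> y [_ /dens_gt0].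
  + apply/eqP; rewrite eq_le; apply/andP; split; last first.
      by apply: integral_ge0 => y _; rewrite lee_fin (tower_density_ge0 rho_gt0 rho_eq0).
    rewrite -N0 nuE; apply: ge0_subset_integral => //.
    * by apply/measurable_EFinP; exact: measurable_funTS.
    * by move=> y _; rewrite lee_fin (tower_density_ge0 rho_gt0 rho_eq0).
- by move=> y /= /not_implyP[yt nP]; split => //; exact: PN.
Qed.

Lemma ae_leb_tower (P : R -> Prop) : {ae leb, forall y, in_tower H y -> P y} ->
  {ae nu, forall y, in_tower H y /\ P y}.
Proof.
move=> [N [mN N0 PN]]; exists (N `|` ~` [set y | in_tower H y]); split.
- by apply: measurableU => //; exact: measurableC.
- rewrite nuE; have mC := measurableC m_in_tower.
  rewrite integral_mkcond.
  rewrite (ae_eq_integral (cst 0)) ?integral0//.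
    apply/(measurable_restrictT _ _).1; first exact: measurableU.
    by apply/measurable_EFinP; exact: measurable_funTS.
  exists N; split => // y /= /not_implyP[_ h]; apply: contrapT => nN; apply: h.
  rewrite /patch; case: ifPn => //; rewrite inE/= => -[//|nt].
  by rewrite (tower_density_eq0 rho_eq0).
- move=> y /= h; have [yt|] := pselect (in_tower H y); last by right.
  by left; apply: PN => /= hP; apply: h; split => //; exact: hP.
Qed.

Let ae_in_tower : {ae nu, forall y, in_tower H y}.
Proof.
have : {ae nu, forall y, in_tower H y /\ True} by apply: ae_leb_tower; exact: nearW.
by apply: filterS => y [].
Qed.

Let nThat N : measurable N -> nu N = 0 -> nu (That @^-1` N) = 0.
Proof.
move=> mN N0; have mTN : measurable (That @^-1` N) by exact: measurable_preimage.
have mi : measurable_fun setT (fun y => (\1_N y : R)%:E).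
  by apply/measurable_EFinP; exact: measurable_indic.
rewrite -[That @^-1` N]setIT -integral_indic//.
rewrite (@tower_change_of_variables _ _ _ mrho mH H0 rho_gt0 rho_eq0 rho_top
  (fun y => (\1_N y : R)%:E))//.
rewrite (ae_eq_integral (cst 0)) ?integral0//.
  by apply: emeasurable_funM => //; exact/measurable_EFinP.
exists N; split => // y /= /not_implyP[_ h]; apply: contrapT => nN; apply: h.
by rewrite indicE memNset// mul0e.
Qed.

(** The change of variables turns the integral of the derivative over the preimage into the measure
    of a part of [N]; the derivative being positive on the tower, the preimage is null. *)
Let nTinv N : measurable N -> nu N = 0 -> nu (Tinv @^-1` N) = 0.
Proof.
move=> mN N0; have mTN : measurable (Tinv @^-1` N) by exact: measurable_preimage.
pose A := Tinv @^-1` N `&` [set y | in_tower H y].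
have mA : measurable A by exact: measurableI.
have mi : measurable_fun setT (fun y => (\1_A y : R)%:E).
  by apply/measurable_EFinP; exact: measurable_indic.
have := @tower_change_of_variables _ _ _ mrho mH H0 rho_gt0 rho_eq0 rho_top
  (fun y => (\1_A y : R)%:E) mi (fun y => _).
move=> /(_ ltac:(by move=> y; rewrite lee_fin)).
rewrite [LHS](ae_eq_integral (cst 0)) ?integral0//; last 2 first.
- exact: (measurableT_comp mi mThat).
- have aeN : {ae nu, forall y, ~ N y}.
    by exists N; split => // y /= /contrapT.
  move: aeN ae_in_tower; apply: filterS2 => y nN yt _.
  rewrite indicE memNset// => -[/= + _]; rewrite (tower_mapK yt)//.
move=> h; have A0 : nu A = 0.
  apply: (@null_of_integral0 _ _ _ nu _ der) => //.
    by move=> y [_ yt]; exact: (tower_der_gt0 rho_gt0).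
  rewrite integral_mkcond [RHS]h; apply: eq_integral => y _.
  by rewrite /patch indicE; case: ifPn; rewrite ?mul1e ?mul0e.
rewrite -A0; apply: ae_eq_measure => //.
by apply: filterS ae_in_tower => y yt; split => [|[]].
Qed.


Let T1 x := th' (That (th x)).
Let S1 x := th' (Tinv (th x)).

Let mT1 : measurable_fun setT T1.
Proof. exact: (measurableT_comp mth' (measurableT_comp mThat mth)). Qed.

Let mS1 : measurable_fun setT S1.
Proof. exact: (measurableT_comp mth' (measurableT_comp mTinv mth)). Qed.

Let ae_th (P : R -> Prop) : {ae nu, forall y, P y} -> {ae mu, forall x, P (th x)}.
Proof. exact: ae_preimage. Qed.

Let ae_th' (P : X -> Prop) : {ae mu, forall x, P x} -> {ae nu, forall y, P (th' y)}.
Proof. exact: ae_preimage. Qed.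

Let ae_That (P : R -> Prop) : {ae nu, forall y, P y} -> {ae nu, forall y, P (That y)}.
Proof.
move=> [N [mN N0 PN]]; exists (That @^-1` N); split.
- exact: measurable_preimage.
- exact: nThat.
- by move=> y /= nP; exact: PN.
Qed.

Let ae_Tinv (P : R -> Prop) : {ae nu, forall y, P y} -> {ae nu, forall y, P (Tinv y)}.
Proof.
move=> [N [mN N0 PN]]; exists (Tinv @^-1` N); split.
- exact: measurable_preimage.
- exact: nTinv.
- by move=> y /= nP; exact: PN.
Qed.

Let aeS1T1 : {ae mu, forall x, S1 (T1 x) = x}.
Proof.
have := ae_th ae_in_tower; have := ae_th (ae_That th'K).
move: thK; apply: filterS3 => x e1 e2 xt.
by rewrite /S1 /T1 e2 (tower_mapK xt).
Qed.

Let ae_neq0 : {ae nu, forall y, y != 0%R}.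
Proof.
have : {ae leb, forall y : R, in_tower H y -> y != 0%R}.
  exists [set 0%R]; split => //; first exact: lebesgue_measure_set1.
  by move=> y /= /not_implyP[_ /negP]; rewrite negbK => /eqP.
by move=> /ae_leb_tower; apply: filterS => y [].
Qed.

Let aeT1S1 : {ae mu, forall x, T1 (S1 x) = x}.
Proof.
have h1 : {ae nu, forall y, That (Tinv y) = y}.
  by move: ae_in_tower ae_neq0; apply: filterS2 => y yt y0; have [] := tower_invK H0 yt y0.
have := ae_th h1; have := ae_th (ae_Tinv th'K).
move: thK; apply: filterS3 => x e1 e2 e3.
by rewrite /S1 /T1 e2 e3.
Qed.

(** The tower map and its inverse are conjugated by [th], then corrected on a null set; the
    derivative is carried along because [th] preserves the measures. *)
Lemma tower_transformation : exists T S : X -> X,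
  [/\ nonsingular_inv mu T, cancel T S, cancel S T & measurable_fun setT S] /\
  [/\ is_RN mu (fun A => mu (T @^-1` A)) (fun x => der (th x)),
      {ae mu, forall x, T x = th' (That (th x))} &
      {ae mu, forall x, th (S x) = Tinv (th x)}].
Proof.
have [T [S [[nT TS ST mS] [TT1 SS1]]]] : exists T S : X -> X,
  [/\ nonsingular_inv mu T, cancel T S, cancel S T & measurable_fun setT S] /\
  {ae mu, forall x, T x = T1 x} /\ {ae mu, forall x, S x = S1 x}.
  apply: (exact_bijection mT1 mS1 _ _ aeS1T1 aeT1S1) => N mN N0.
    rewrite (_ : T1 @^-1` N = th @^-1` (That @^-1` (th' @^-1` N)))//.
    have m1 : measurable (th' @^-1` N) by exact: measurable_preimage.
    apply: etrans (thP (measurable_preimage mThat m1)) _.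
    by apply: nThat => //; apply: etrans (th'P mN) N0.
  rewrite (_ : S1 @^-1` N = th @^-1` (Tinv @^-1` (th' @^-1` N)))//.
  have m1 : measurable (th' @^-1` N) by exact: measurable_preimage.
  apply: etrans (thP (measurable_preimage mTinv m1)) _.
  by apply: nTinv => //; apply: etrans (th'P mN) N0.
exists T, S; split => //; split => //; last first.
  by move: SS1 (ae_th (ae_Tinv th'K)); apply: filterS2 => x ->.
split => [| |A mA].
- exact: (measurableT_comp mder mth).
- by move=> x; exact: der_ge0.
have mT : measurable_fun setT T by have [? []] := nT.
have m1 : measurable (th' @^-1` A) by exact: measurable_preimage.
have mi : measurable_fun setT (fun y => (\1_(th' @^-1` A) y : R)%:E).
  by apply/measurable_EFinP; exact: measurable_indic.
have mi2 : measurable_fun setT (fun y => (\1_(th' @^-1` A) y : R)%:E * (der y)%:E).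
  by apply: emeasurable_funM => //; exact/measurable_EFinP.
transitivity (mu (T1 @^-1` A)).
  apply: ae_eq_measure; [exact: measurable_preimage|exact: measurable_preimage|].
  by apply: filterS TT1 => x /= ->.
transitivity (\int[nu]_y (\1_(th' @^-1` A) (That y) : R)%:E).
  have mB : measurable (That @^-1` (th' @^-1` A)) by exact: measurable_preimage.
  rewrite (_ : T1 @^-1` A = th @^-1` (That @^-1` (th' @^-1` A)))//.
  apply: etrans (thP mB) _.
  by rewrite -[X in nu X]setIT -integral_indic.
rewrite (@tower_change_of_variables _ _ _ mrho mH H0 rho_gt0 rho_eq0 rho_top
  (fun y => (\1_(th' @^-1` A) y : R)%:E))//.
rewrite -(ge0_integral_transfer mth thP mi2); last first.
  by move=> y; rewrite mule_ge0// lee_fin.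
rewrite [RHS]integral_mkcond; apply: ae_eq_integral => //.
- exact: (measurableT_comp mi2 mth).
- apply/(measurable_restrictT _ _).1 => //; apply/measurable_EFinP/measurable_funTS.
  exact: (measurableT_comp mder mth).
move: thK; apply: filterS => x e _; rewrite /patch indicE.
have -> : (th x \in th' @^-1` A) = (x \in A).
  by apply/idP/idP; rewrite !inE/= e.
by case: ifPn => _; rewrite ?mul1e ?mul0e.
Qed.

Hypothesis muT : mu setT = +oo.
Variable T : X -> X.
Hypothesis aT : Aut2 mu T.
Hypothesis T_RN : is_RN mu (fun A => mu (T @^-1` A)) (fun x => der (th x)).
Hypothesis T_map : {ae mu, forall x, T x = th' (That (th x))}.

Let ae_levels (P : R -> Prop) : {ae leb, forall y, in_tower H y -> P y} <->
  {ae leb, forall b : R, (0 <= b < 1)%R -> forall j, (j < H b)%N -> P (b + j%:R)%R}.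
Proof.
split => h.
  have {}h : {ae leb, forall b : R, forall j, in_tower H (b + j%:R)%R -> P (b + j%:R)%R}.
    apply: ae_foralln => j; have := ae_affine j%:R ltr01 h.
    by apply: filterS => b; rewrite mul1r.
  by apply: filterS h => b h b01 j jH; apply: h; exact/in_tower_level.
have {}h : {ae leb, forall y : R, forall i : nat, (0 <= y - i%:R < 1)%R ->
    forall j, (j < H (y - i%:R)%R)%N -> P (y - i%:R + j%:R)%R}.
  apply: ae_foralln => i; have := ae_affine (- i%:R)%R ltr01 h.
  by apply: filterS => b; rewrite mul1r.
apply: filterS h => y h [y0 yH].
by have := h (Num.truncn y) (fr_bounds y0) _ yH; rewrite subrK.
Qed.

Let Tprime_der : {ae mu, forall x, Tprime mu T x = der (th x)}.
Proof.
have [m1 p1 e1] := Tprime_RN muT aT; have [m2 p2 e2] := T_RN.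
by apply: ae_eq_density => // A mA; rewrite -e1// -e2.
Qed.

(** The trace of [E] on level [0]. The shift by [ln (rho 0)] replaces the density of the base by
    that of Lebesgue measure, with respect to which the odometer is studied. *)
Let base (E : set (X * R)) : set (R * R) :=
  (fun p => (th' p.1, p.2 - ln (rho 0%N p.1))%R) @^-1` E.

Let level_shift (E : set (X * R)) : maharam mu T @^-1` E = E ->
  {ae leb, forall b : R, (0 <= b < 1)%R -> forall j, (j < H b)%N -> forall y,
    E (th' (b + j%:R), y)%R <-> E (th' (That (b + j%:R)), y + ln (der (That (b + j%:R))))%R}.
Proof.
move=> EE; apply/(ae_levels (fun z => forall y, E (th' z, y) <-> E (th' (That z), y + ln (der (That z)))%R)).
apply: ae_tower_leb.
have h1 : {ae mu, forall x, forall y, E (x, y) <->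
    E (th' (That (th x)), y + ln (der (th (th' (That (th x))))))%R}.
  have h2 : {ae mu, forall x, Tprime mu T (T x) = der (th (T x)) /\ (0 < Tprime mu T (T x))%R}.
    apply: (@ae_comp_nonsingular _ _ _ mu T
      (fun z => Tprime mu T z = der (th z) /\ (0 < Tprime mu T z)%R) aT.1).
    by move: Tprime_der (Tprime_gt0 muT aT); apply: filterS2 => z.
  have := h2; have := dmuTE muT aT; move: T_map.
  apply: filterS3 => x TE dE [T'E T'0] y.
  rewrite -{1}EE /maharam/= dE lnV ?posrE// T'E.
  by rewrite opprK TE.
move: (ae_th' h1) th'K (ae_That th'K); apply: filterS3 => z hz e1 e2 y.
by rewrite hz e1 e2.
Qed.

(** The logarithms of the derivatives telescope along the levels, leaving [ln (rho j)]; at the top,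
    [rho_top] turns the shift into that of the odometer. *)
Let level_chain (E : set (X * R)) : maharam mu T @^-1` E = E ->
  {ae leb, forall b : R, (0 <= b < 1)%R ->
    (forall j, (j < H b)%N -> forall y,
      base E (b, y) <-> E (th' (b + j%:R), y - ln (rho j b))%R) /\
    (forall y, base E (b, y) <-> base E (odo b, y - ln (odo_slope b))%R)}.
Proof.
move=> EE; apply: filterS (level_shift EE) => b hb b01.
have chain j : (j < H b)%N -> forall y,
    base E (b, y) <-> E (th' (b + j%:R), y - ln (rho j b))%R.
  elim: j => [|j IH] jH y; first by rewrite /base/= addr0.
  rewrite (IH (ltnW jH)) (hb b01 j (ltnW jH)) tower_map_level// jH tower_der_level//.
  rewrite ln_div ?posrE ?rho_gt0//; last exact: ltnW.
  by rewrite addrA subrK.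
split=> // y.
have topH : ((H b).-1 < H b)%N by rewrite prednK.
rewrite (chain _ topH) (hb b01 _ topH) tower_map_level// prednK// ltnn.
have [c0 c1 s0 _] := odo_bounds b01.
have c01 : (0 <= odo b < 1)%R by rewrite ltW.
have d1 : der (odo b) = 1%R by rewrite -[odo b]addr0 (tower_der_level rho 0 c01).
rewrite d1 ln1 addr0 rho_top// lnM ?posrE ?rho_gt0// /base/=.
by rewrite opprD addrA addrAC.
Qed.

Let measurable_base (E : set (X * R)) : measurable E -> measurable (base E).
Proof.
move=> mE; apply: measurable_preimage => //; apply: measurable_fun_pair.
  exact: (measurableT_comp mth' measurable_fst).
apply: measurable_funB => //; apply: measurableT_comp (@measurable_ln R) _.
exact: (measurableT_comp (mrho 0) measurable_fst).
Qed.

(** Almost every fibre of [E], at whatever level, is a translate of a fibre of [base E], and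
    translations keep null sets null. *)
Let base_null (E : set (X * R)) : measurable E -> maharam mu T @^-1` E = E ->
  (@leb R \x @exp_measure R) (base E `&` (`[0%R, 1%R[ `*` setT)) = 0 ->
  (mu \x @exp_measure R) E = 0.
Proof.
move=> mE EE b0.
have mS : measurable (`[0%R, 1%R[ `*` setT : set (R * R)) by exact: measurableX.
have mB : measurable (base E `&` (`[0%R, 1%R[ `*` setT)).
  by apply: measurableI => //; exact: measurable_base.
have ms := measurable_fun_xsection (@exp_measure R) mB.
have mx := measurable_fun_xsection (@exp_measure R) mE.
have h1 : {ae leb, forall b : R, (0 <= b < 1)%R -> exp_measure (xsection (base E) b) = 0}.
  have i0 : \int[leb]_b `|(exp_measure \o xsection (base E `&` (`[0%R, 1%R[ `*` setT))) b| = 0.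
    by rewrite -[RHS]b0; apply: eq_integral => b _; rewrite gee0_abs.
  move/(ae_eq_integral_abs leb measurableT ms): i0.
  apply: filterS => b h b01; have := h Logic.I; rewrite /= => <-.
  congr exp_measure; apply/seteqP; split => y; rewrite /xsection/= !inE/= in_itv/=.
    by move=> h'; split.
  by move=> [].
have h2 : {ae leb, forall b : R, (0 <= b < 1)%R -> forall j, (j < H b)%N ->
    exp_measure (xsection E (th' (b + j%:R)%R)) = 0}.
  move: h1 (level_chain EE); apply: filterS2 => b e0 chain b01 j jH.
  have := e0 b01; have -> : xsection (base E) b =
      (fun y => y - ln (rho j b))%R @^-1` xsection E (th' (b + j%:R)%R).
    apply/seteqP; split => y; rewrite /xsection/= !inE; by have /chain[/(_ j jH y)[]] := b01.
  rewrite exp_measure_shift; last exact: measurable_xsection.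
  by move=> /eqP; rewrite mule_eq0 eqe gt_eqF ?expR_gt0//= => /eqP.
have h3 : {ae mu, forall x, exp_measure (xsection E x) = 0}.
  have := ae_th (ae_leb_tower ((ae_levels
    (fun z => exp_measure (xsection E (th' z)) = 0)).2 h2)).
  by move: thK; apply: filterS2 => x -> [].
rewrite /product_measure1 (ae_eq_integral (cst 0)) ?integral0//.
by apply: filterS h3 => x.
Qed.

Lemma tower_ergodic : ergodic_III1 mu T.
Proof.
apply/(ergodic_III1E aT) => E mE EE.
have mE' := measurableC mE.
have EE' : maharam mu T @^-1` (~` E) = ~` E by rewrite -[in RHS]EE.
have inv : odo_invariant (base E).
  split; first exact: measurable_base.
  by apply: filterS (level_chain EE) => b h b01 y; have [_] := h b01; exact.
have [h|h] := odo_invariant_null inv; [left|right]; first exact: base_null.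
by apply: base_null.
Qed.

End transfer.

(** * A tower close to a given transformation *)

Section with_density_sigma_finite.
Context d (X : measurableType d) (R : realType) (mu : {sigma_finite_measure set X -> \bar R}).
Variable w : X -> R.
Hypotheses (mw : measurable_fun setT w) (w0 : forall x, 0 <= w x).
Local Open Scope ereal_scope.

Lemma with_density_sigma_finite : sigma_finite setT (with_density mu mw w0).
Proof.
have [W [mW Wfin ndW WT]] := sigma_finite_nd mu.
pose V n := W n `&` [set x | (w x <= n%:R)%R].
have mV n : measurable (V n).
  by apply: measurableI => //; rewrite -[X in measurable X]setTI; exact: measurable_fun_ler.
exists V.
  apply/seteqP; split => // x _.
  have [n _ Wx] : (\bigcup_n W n) x by rewrite WT.
  exists (maxn n (Num.truncn (w x)).+1) => //; split.
    by move: (ndW _ _ (leq_maxl n (Num.truncn (w x)).+1)); rewrite subsetEset; apply.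
  apply: le_trans (ltW (truncnS_gt _)) _; rewrite ler_nat; exact: leq_maxr.
move=> n; split => //; rewrite /with_density.
have Vfin : mu (V n) < +oo.
  by apply: le_lt_trans (Wfin n); apply: le_measure; rewrite ?inE//; exact: subIsetl.
apply: (@le_lt_trans _ _ (\int[mu]_(x in V n) (cst n%:R%:E x))).
  apply: ge0_le_integral => //.
  - by move=> x _; rewrite lee_fin.
  - by apply/measurable_EFinP; exact: measurable_funTS.
  - by move=> x [_ /= wn]; rewrite lee_fin.
rewrite integral_cst//; apply: lte_mul_pinfty => //.
Qed.

End with_density_sigma_finite.

Section infinite_base.
Context (R : realType).
Local Open Scope ereal_scope.

Definition inv_density (b : R) : R := (if 0 < b < 1 then b^-1 else 0)%R.

Lemma inv_density_ge0 b : (0 <= inv_density b)%R.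
Proof. by rewrite /inv_density; case: ifPn => // /andP[b0 _]; rewrite invr_ge0 ltW. Qed.

Lemma measurable_inv_density : measurable_fun setT inv_density.
Proof.
have -> : inv_density = (fun b => if 0 < b < 1 then `|b|^-1 else 0)%R.
  by apply/funext => b; rewrite /inv_density; case: ifPn => // /andP[b0 _]; rewrite gtr0_norm.
apply: measurable_fun_ifT => //.
  by apply: measurable_and => //; exact: measurable_fun_ltr.
apply: measurable_fun_inv => [b|]; first exact: normr_ge0.
exact: normr_measurable.
Qed.

(* Any infinite nonatomic measure with the null sets of Lebesgue measure would do. *)
Definition base_measure : set R -> \bar R :=
  @with_density _ R R leb _ measurable_inv_density inv_density_ge0.
HB.instance Definition _ := Measure.on base_measure.

Lemma base_measure_sigma_finite : sigma_finite setT base_measure.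
Proof. exact: (@with_density_sigma_finite _ R R (@leb R)). Qed.
HB.instance Definition _ :=
  @Measure_isSigmaFinite.Build _ _ _ base_measure base_measure_sigma_finite.

Lemma ge0_integral_base (h : R -> \bar R) : measurable_fun setT h -> (forall x, 0 <= h x) ->
  \int[base_measure]_b h b = \int[leb]_(b in `[0%R, 1%R[) (h b * (inv_density b)%:E).
Proof.
move=> mh h0.
transitivity (\int[leb]_b (h b * (inv_density b)%:E)).
  exact: (@ge0_integral_with_density _ R R (@leb R) _ measurable_inv_density inv_density_ge0).
rewrite [RHS]integral_mkcond; apply: eq_integral => b _.
rewrite /patch; case: ifPn => //; rewrite notin_setE/= in_itv/= => b01.
rewrite /inv_density ifF ?mule0//; apply/negbTE/negP => /andP[b0 b1].
by apply: b01; rewrite b1 ltW.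
Qed.

(** Scaling preserves [b^-1 db], so [[0, 1/2[] has the same mass as [[0, 1[]; the positive mass of
    [[1/2, 1[] then excludes a finite value. *)
Lemma base_measureT : base_measure setT = +oo.
Proof.
pose f b := (if (0 < b)%R then `|b|^-1 else 0%R : R)%:E.
have mf : measurable_fun setT f.
  apply/measurable_EFinP; apply: measurable_fun_ifT => //.
    exact: measurable_fun_ltr.
  apply: measurable_fun_inv => [b|]; first exact: normr_ge0.
  exact: normr_measurable.
have f0 b : 0 <= f b by rewrite lee_fin; case: ifPn => // _; rewrite invr_ge0.
pose I := \int[leb]_(b in `[0%R, 1%R[) f b.
have -> : base_measure setT = I.
  rewrite -[LHS]mul1e -(integral_cst _ measurableT 1) ge0_integral_base//.
  apply: eq_integral => b; rewrite inE/= in_itv/= => /andP[b0 b1].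
  rewrite mul1e /f /inv_density b1 andbT; case: ifPn => // b0'.
  by rewrite ger0_norm.
have half : \int[leb]_(b in `[0%R, 2^-1%R[) f b = I.
  rewrite (@integral_itv_affine _ 2^-1 0 0 1)//; [|lra..].
  rewrite -ge0_integralZl//; last 1 first.
  - by apply: measurable_funTS; apply: (measurableT_comp mf); apply: measurable_funD => //; exact: measurable_funM.
  apply: eq_integral => b _; rewrite /f addr0 pmulr_rgt0//.
  case: ifPn => b0; last by rewrite mule0.
  by rewrite -EFinM normrM gtr0_norm// invfM invrK mulrA mulVf// mul1r.
have split : I = I + \int[leb]_(b in `[2^-1%R, 1%R[) f b.
  by rewrite -[in RHS]half -integral_itv_cat//; lra.
have ge : (2^-1 : R)%:E <= \int[leb]_(b in `[2^-1%R, 1%R[) f b.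
  apply: (@le_trans _ _ (\int[leb]_(b in `[2^-1%R, 1%R[) cst 1 b)).
    have lI : leb (`[2^-1%R, 1%R[%classic : set R) = (2^-1)%:E.
      rewrite /leb lebesgue_measure_itv/= lte_fin ifT; last lra.
      by rewrite -EFinB; congr _%:E; lra.
    by rewrite (integral_cst _ _ 1)// mul1e [X in _ <= X]lI.
  apply: ge0_le_integral => //; first exact: measurable_funTS.
  move=> b; rewrite /= in_itv/= => /andP[b2 b1]; rewrite /f lee_fin.
  have b0 : (0 < b)%R by apply: lt_le_trans b2; rewrite invr_gt0.
  by rewrite b0 gtr0_norm// invf_ge1// ltW.
have I0 : 0 <= I by exact: integral_ge0.
case: (I) I0 split => [i||]//= i0 split.
have : i%:E + (2^-1)%:E <= i%:E by rewrite [X in _ <= X]split leeD2l.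
by rewrite -EFinD lee_fin gerDl leNgt invr_gt0 ltr0n.
Qed.

End infinite_base.

Lemma measurable_glue_set d (T : measurableType d) (N : T -> nat) (P : nat -> T -> Prop) :
  (forall n, measurable [set x | N x = n]) -> (forall n, measurable [set x | P n x]) ->
  measurable [set x | P (N x) x].
Proof.
move=> mN mP; rewrite [X in measurable X](_ : _ = \bigcup_n ([set x | N x = n] `&` [set x | P n x])).
  by apply: bigcupT_measurable => n; exact: measurableI.
by apply/seteqP; split => [x Px|x [n _ [/= <-]]]//; exists (N x).
Qed.

Lemma slope_n_gt0 (R : realType) n (b : R) : 0 < slope_n n b.
Proof. by elim: n b => [|n IH] b //=; case: ifPn => // _; case: ifPn => // _; rewrite divr_gt0. Qed.

Lemma odo_inv_itv (R : realType) (c : R) : 0 <= c < 1 -> 0 <= odo_inv c < 1.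
Proof.
move=> /andP[]; rewrite le_eqVlt => /orP[/eqP <-|c0] c1; last by have [] := @odo_invK R c; rewrite ?c0.
have -> : odo_inv 0 = 2^-1 :> R.
  rewrite /odo_inv /odo_depth normr0 invr0 truncn0 /= ifT ?invr_gt0//.
  by rewrite mulr0 add0r.
by apply/andP; split; lra.
Qed.

(** * Densities of the levels and spacers *)

Section concrete.
Context d (X : measurableType d) (R : realType) (mu : {sigma_finite_measure set X -> \bar R}).
Hypothesis muT : mu setT = +oo%E.
Variable T0 : X -> X.
Hypothesis aT0 : Aut2 mu T0.
Variables (N : nat) (eps : R).
Hypotheses (N0 : (0 < N)%N) (eps0 : 0 < eps).
Variable pi : R -> X.
Hypothesis mpi : measurable_fun setT pi.
Hypothesis piP : forall A, measurable A -> @base_measure R (pi @^-1` A) = mu A.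

(** Modified on a null set to be positive everywhere, as the densities of the levels must be. *)
Definition pos_Tprime (x : X) : R := if 0 < Tprime mu T0 x then Tprime mu T0 x else 1.

Notation w := pos_Tprime.

Lemma pos_Tprime_gt0 x : 0 < w x.
Proof. by rewrite /w; case: ifPn. Qed.

Lemma pos_TprimeE : {ae mu, forall x, Tprime mu T0 x = w x}.
Proof. by apply: filterS (Tprime_gt0 muT aT0) => x T'0; rewrite /w T'0. Qed.

Lemma measurable_pos_Tprime : measurable_fun setT w.
Proof.
have mT' := measurable_Tprime muT aT0.
by apply: measurable_fun_ifT => //; exact: measurable_fun_ltr.
Qed.

Definition kap (j : nat) (b : R) : X := iter j T0 (pi b).

Lemma measurable_kap j : measurable_fun setT (kap j).
Proof.
have [_ _ mT0 _] := inv_mapP aT0.1.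
by elim: j => [//|j IH]; exact: (measurableT_comp mT0 IH).
Qed.

(* The normalization makes every level a copy of [mu] scaled by [1 / N], through
   [kap j], and the derivative between consecutive levels that of [T0]. *)
Fixpoint lev (j : nat) (b : R) : R :=
  if j is i.+1 then lev i b / w (kap i.+1 b)
  else (if 0 < b then `|b|^-1 else 1) / N%:R.

Lemma lev_gt0 j b : 0 < lev j b.
Proof.
elim: j => [|j IH] /=; last by rewrite divr_gt0// pos_Tprime_gt0.
rewrite divr_gt0 ?ltr0n//; case: ifPn => // b0.
by rewrite invr_gt0 normr_gt0 gt_eqF.
Qed.

Lemma measurable_lev j : measurable_fun setT (lev j).
Proof.
elim: j => [|j IH] /=.
  apply: measurable_funM => //; apply: measurable_fun_ifT => //.
    exact: measurable_fun_ltr.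
  by apply: measurable_fun_inv => [b|]; [exact: normr_ge0|exact: normr_measurable].
apply: measurable_funM => //; apply: measurable_fun_inv => [b|].
  exact/ltW/pos_Tprime_gt0.
exact: (measurableT_comp measurable_pos_Tprime (measurable_kap j.+1)).
Qed.

Definition spacer_start (b : R) : R := Num.sqrt (lev N.-1 b).
Definition spacer_end (b : R) : R := Num.sqrt (lev 0 (odo b) * odo_slope b).
(* The square roots of the spacer densities are interpolated linearly: with [M]
   spacers of total increment [D] they cost [D ^+ 2 / M <= eps ^+ 2]. *)
Definition spacers (b : R) : nat :=
  (Num.truncn ((spacer_end b - spacer_start b) ^+ 2 / eps ^+ 2)).+1.
Definition spacer_step (b : R) : R := (spacer_end b - spacer_start b) / (spacers b)%:R.
(** With [k.+1] the last spacer has root exactly [spacer_end], the value required by the return to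
    the base. *)
Definition spacer_root (k : nat) (b : R) : R := spacer_start b + k.+1%:R * spacer_step b.

Definition rho (j : nat) (b : R) : R :=
  if (j < N)%N then lev j b
  else if (j < N + spacers b)%N then spacer_root (j - N) b ^+ 2 else 0.

Definition height (b : R) : nat := (N + spacers b)%N.

Let start_gt0 b : 0 < spacer_start b.
Proof. by rewrite /spacer_start sqrtr_gt0 lev_gt0. Qed.

Let end_gt0 b : 0 < spacer_end b.
Proof. by rewrite /spacer_end sqrtr_gt0 mulr_gt0 ?lev_gt0// slope_n_gt0. Qed.

Lemma spacer_root_gt0 k b : (k < spacers b)%N -> 0 < spacer_root k b.
Proof.
move=> kM; have s0 := start_gt0 b; have e0 := end_gt0 b; rewrite /spacer_root /spacer_step.
have M0 : 0 < (spacers b)%:R :> R by rewrite ltr0n.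
rewrite mulrA mulrAC; set t := k.+1%:R / _.
have t0 : 0 <= t by rewrite divr_ge0.
have t1 : t <= 1 by rewrite ler_pdivrMr// mul1r ler_nat.
have t0' : 0 < t by rewrite divr_gt0.
rewrite (_ : _ + _ = spacer_start b * (1 - t) + spacer_end b * t); last by ring.
by apply: ltr_wpDl; [rewrite mulr_ge0 ?subr_ge0// ltW|rewrite mulr_gt0].
Qed.

Lemma measurable_spacer_start : measurable_fun setT spacer_start.
Proof. apply: measurable_fun_sqrt; exact: measurable_lev. Qed.

Lemma measurable_spacer_end : measurable_fun setT spacer_end.
Proof.
apply: measurable_fun_sqrt; apply: measurable_funM; last exact: measurable_odo_slope.
exact: (measurableT_comp (measurable_lev 0) (@measurable_odo R)).
Qed.

Lemma measurable_spacers n : measurable [set b | spacers b = n].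
Proof.
case: n => [|n]; first by rewrite [X in measurable X](_ : _ = set0)//; apply/seteqP; split.
rewrite [X in measurable X](_ : _ = [set b | Num.truncn
    ((spacer_end b - spacer_start b) ^+ 2 / eps ^+ 2) = n]).
  apply: measurable_truncn_eq; apply: measurable_funM => //; apply: measurable_funX.
  by apply: measurable_funB; [exact: measurable_spacer_end|exact: measurable_spacer_start].
by apply/seteqP; split => b /=; rewrite /spacers; [case|move=> ->].
Qed.

Lemma measurable_spacer_root k : measurable_fun setT (spacer_root k).
Proof.
apply: measurable_funD; first exact: measurable_spacer_start.
apply: measurable_funM => //.
apply: (@measurable_fun_glue _ _ R R spacers
  (fun n b => (spacer_end b - spacer_start b) / n%:R)) => n; first exact: measurable_spacers.
apply: measurable_funM => //.
by apply: measurable_funB; [exact: measurable_spacer_end|exact: measurable_spacer_start].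
Qed.

Lemma measurable_rho j : measurable_fun setT (rho j).
Proof.
rewrite /rho; case: (j < N)%N; first exact: measurable_lev.
apply: (@measurable_fun_glue _ _ R R spacers
  (fun n b => if (j < N + n)%N then spacer_root (j - N) b ^+ 2 else 0)) => n.
  exact: measurable_spacers.
by case: (_ < _)%N => //; apply: measurable_funX; exact: measurable_spacer_root.
Qed.

Lemma measurable_height n : measurable [set b | height b = n].
Proof.
have [nN|Nn] := ltnP n N.
  rewrite [X in measurable X](_ : _ = set0)//; apply/seteqP; split => // b /= h.
  by move: nN; rewrite -h /height ltnNge leq_addr.
rewrite [X in measurable X](_ : _ = [set b | spacers b = (n - N)%N]); first exact: measurable_spacers.
apply/seteqP; split => b /=; rewrite /height; first by move=> <-; rewrite addKn.
by move=> ->; rewrite subnKC.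
Qed.

Lemma height_gt0 b : (0 < height b)%N.
Proof. by rewrite /height addnS. Qed.

Lemma rho_height_gt0 j b : (j < height b)%N -> 0 < rho j b.
Proof.
rewrite /rho /height => jH; case: ifPn => [_|]; first exact: lev_gt0.
by rewrite jH -leqNgt => Nj; rewrite exprn_gt0// spacer_root_gt0// ltn_subLR.
Qed.

Lemma rho_height_eq0 j b : (height b <= j)%N -> rho j b = 0.
Proof.
rewrite /rho /height => Hj; rewrite !ifF//; apply/negbTE; rewrite -leqNgt//.
exact: leq_trans (leq_addr _ _) Hj.
Qed.

Lemma rho_height_top b : 0 <= b < 1 -> rho (height b).-1 b = rho 0 (odo b) * odo_slope b.
Proof.
move=> b01; rewrite /rho /height N0 addnS/= leqnn ifF; last by rewrite ltnNge leq_addr.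
rewrite addKn /spacer_root /spacer_step -/(spacers b) mulrC divfK ?pnatr_eq0//.
rewrite addrC subrK sqr_sqrtr// mulr_ge0//; first exact/ltW/lev_gt0.
exact/ltW/slope_n_gt0.
Qed.

Local Open Scope ereal_scope.
Notation nu := (tower_measure measurable_rho rho_height_gt0 rho_height_eq0).

(** By induction: one more level composes with [T0] and divides by its derivative, which cancel in
    the integral. On the base this is the choice of [pi]. *)
Lemma level_integral j (h : X -> \bar R) : measurable_fun setT h -> (forall x, 0 <= h x) ->
  \int[leb]_(b in `[0%R, 1%R[) (h (kap j b) * (lev j b)%:E) = (N%:R^-1)%:E * \int[mu]_x h x.
Proof.
elim: j h => [|j IH] h mh h0.
  have mhp : measurable_fun setT (fun b => h (pi b)) by exact: (measurableT_comp mh mpi).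
  rewrite -(ge0_integral_transfer mpi piP mh h0) ge0_integral_base//.
  rewrite -ge0_integralZl//; last 2 first.
  - apply: measurable_funTS; apply: emeasurable_funM => //.
    by apply/measurable_EFinP; exact: measurable_inv_density.
  - by move=> b _; rewrite mule_ge0// lee_fin inv_density_ge0.
  apply: ge0_ae_eq_integral => //.
  - apply: measurable_funTS; apply: emeasurable_funM => //.
    by apply/measurable_EFinP; exact: (measurable_lev 0).
  - apply: measurable_funTS; apply: measurable_funeM; apply: emeasurable_funM => //.
    by apply/measurable_EFinP; exact: measurable_inv_density.
  - by move=> b _; rewrite mule_ge0// lee_fin ltW// (lev_gt0 0).
  - by move=> b _; rewrite !mule_ge0// lee_fin inv_density_ge0.
  exists [set 0%R]; split => //; first exact: lebesgue_measure_set1.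
  move=> b /= /not_implyP[]; rewrite in_itv/= => /andP[b0 b1] neq.
  apply: contrapT => /eqP bn0; apply: neq.
  have b0' : (0 < b)%R by rewrite lt_neqAle eq_sym bn0.
  by rewrite /inv_density b0' b1 gtr0_norm// muleCA -EFinM mulrC.
have mw := measurable_pos_Tprime.
have mh' : measurable_fun setT (fun x => h x * ((w x)^-1)%:E).
  apply: emeasurable_funM => //; apply/measurable_EFinP; apply: measurable_fun_inv => // x.
  exact/ltW/pos_Tprime_gt0.
have h'0 x : 0 <= h x * ((w x)^-1)%:E.
  by rewrite mule_ge0// lee_fin invr_ge0 ltW// pos_Tprime_gt0.
have [_ _ mT0 _] := inv_mapP aT0.1.
transitivity (\int[leb]_(b in `[0%R, 1%R[)
    ((fun x => h (T0 x) * ((w (T0 x))^-1)%:E) (kap j b) * (lev j b)%:E)).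
  by apply: eq_integral => b _ /=; rewrite -muleA -EFinM mulrC.
rewrite (IH (fun x => h (T0 x) * ((w (T0 x))^-1)%:E)); last 2 first.
- exact: (measurableT_comp mh' mT0).
- by move=> x; exact: h'0.
rewrite (ge0_integral_comp_Tprime muT aT0 mh' h'0); congr (_ * _).
apply: ae_eq_integral => //.
- apply: emeasurable_funM => //; apply/measurable_EFinP; exact: measurable_Tprime.
- apply: filterS pos_TprimeE => x -> _; rewrite -muleA -EFinM mulVf ?mule1//.
  by rewrite gt_eqF// pos_Tprime_gt0.
Qed.

Lemma ge0_integral_rho (f : R -> \bar R) (G : nat -> X -> \bar R) :
  measurable_fun setT f -> (forall y, 0 <= f y) ->
  (forall j, measurable_fun setT (G j)) -> (forall j x, 0 <= G j x) ->
  (forall j b, (j < N)%N -> (0 <= b < 1)%R -> f (b + j%:R)%R = G j (kap j b)) ->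
  \int[nu]_y f y = \sum_(0 <= j < N) (N%:R^-1)%:E * \int[mu]_x G j x +
    \sum_(N <= j <oo) \int[leb]_(b in `[0%R, 1%R[) (f (b + j%:R)%R * (rho j b)%:E).
Proof.
move=> mf f0 mG G0 fG; rewrite ge0_integral_tower// (nneseries_split 0 N); last first.
  move=> j _; apply: integral_ge0 => b _; rewrite mule_ge0// lee_fin.
  exact: (rho_ge0 rho_height_gt0 rho_height_eq0).
rewrite add0n; congr (_ + _); apply: eq_big_nat => j /andP[_ jN].
rewrite -(level_integral j (mG j) (G0 j)); apply: eq_integral => b; rewrite inE/= in_itv/= => b01.
by rewrite fG// /rho jN.
Qed.

Variable l : X -> nat.
Hypothesis ml : forall i, measurable [set x | l x = i].
Hypothesis l0 : mu [set x | l x = 0%N] = +oo.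

Definition tower_label (y : R) : nat :=
  if (Num.truncn y < N)%N then l (kap (Num.truncn y) (fr y)) else 0%N.

Lemma measurable_tower_label i : measurable [set y | tower_label y = i].
Proof.
apply: (@measurable_glue_set _ R (fun y => Num.truncn y)
  (fun n y => (if (n < N)%N then l (kap n (fr y)) else 0%N) = i)) => n.
  exact: measurable_truncn.
case: (n < N)%N.
  rewrite [X in measurable X](_ : _ = (fun y => kap n (fr y)) @^-1` [set x | l x = i])//.
  by apply: measurable_preimage => //; exact: (measurableT_comp (measurable_kap n) (@measurable_fr R)).
have [->|i0] := eqVneq i 0%N; first by rewrite [X in measurable X](_ : _ = setT)//; apply/seteqP; split.
rewrite [X in measurable X](_ : _ = set0)//; apply/seteqP; split => // y /= h.
by move: i0; rewrite h eqxx.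
Qed.

Lemma tower_label_level j b : (0 <= b < 1)%R ->
  tower_label (b + j%:R)%R = if (j < N)%N then l (kap j b) else 0%N.
Proof. by move=> b01; rewrite /tower_label truncn_level// fr_level. Qed.

Let sum_inv (c : \bar R) : 0 <= c -> \sum_(0 <= j < N) (N%:R^-1)%:E * c = c.
Proof.
move=> c0; rewrite -ge0_sume_distrl; last by move=> j _; rewrite lee_fin invr_ge0.
by rewrite sumEFin sumr_const_nat subn0 -[(_^-1 *+ _)%R]mulr_natl mulfV ?mul1e// pnatr_eq0 -lt0n.
Qed.

(** [N] copies of weight [1/N] restore the mass of each cell; the spacers only add to the cell [0],
    already of infinite mass. *)
Lemma label_mass i : mu [set x | l x = i] = nu [set y | tower_label y = i].
Proof.
have ind (A : set X) : measurable A -> mu A = \int[mu]_x (\1_A x)%:E.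
  by move=> mA; rewrite integral_indic// setIT.
pose f (y : R) := (\1_[set y | tower_label y = i] y : R)%:E.
pose G (j : nat) (x : X) := (\1_[set x | l x = i] x : R)%:E.
have mf : measurable_fun setT f.
  by apply/measurable_EFinP/measurable_indic; exact: measurable_tower_label.
have mG (j : nat) : measurable_fun setT (G j).
  by apply/measurable_EFinP/measurable_indic; exact: ml.
have fG j b : (j < N)%N -> (0 <= b < 1)%R -> f (b + j%:R)%R = G j (kap j b).
  move=> jN b01; rewrite /f /G !indicE; congr ((nat_of_bool _)%:R)%:E.
  by apply/idP/idP; rewrite !inE/= tower_label_level// jN.
have f0 y : 0 <= f y by rewrite lee_fin.
have G0 j x : 0 <= G j x by rewrite lee_fin.
have -> : nu [set y | tower_label y = i] = \int[nu]_y f y.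
  by rewrite integral_indic ?setIT//; exact: measurable_tower_label.
have E := @ge0_integral_rho f G mf f0 mG G0 fG.
have GE j : \int[mu]_x G j x = mu [set x | l x = i] by rewrite ind.
rewrite E; under eq_bigr do rewrite GE.
rewrite sum_inv//.
have [->|i0] := eqVneq i 0%N.
  have -> : mu [set x | l x = 0%N] = +oo by exact: l0.
  rewrite addye// gt_eqF//; apply: (@lt_le_trans _ _ 0) => //.
  apply: nneseries_ge0 => j _ _; apply: integral_ge0 => b _; rewrite mule_ge0// lee_fin.
  exact: (rho_ge0 rho_height_gt0 rho_height_eq0).
rewrite eseries0 ?adde0// => j Nj _; apply: integral0_eq => b; rewrite /= in_itv/= => b01.
rewrite /f indicE memNset ?mul0e//= tower_label_level// ltnNge Nj/= => h.
by move: i0; rewrite -h eqxx.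
Qed.



Lemma tower_der_rho j b : (j.+1 < N)%N -> (rho j b / rho j.+1 b = w (kap j.+1 b))%R.
Proof.
move=> jN; rewrite /rho jN (ltnW jN) /= invfM invrK mulrA divff ?mul1r//.
by rewrite gt_eqF// lev_gt0.
Qed.

Lemma sqrt_spacer j b : (N <= j < height b)%N ->
  (Num.sqrt (rho j.-1 b) - Num.sqrt (rho j b) = - spacer_step b)%R.
Proof.
move=> /andP[Nj jH]; have [k jk] : exists k, j = (N + k)%N by exists (j - N)%N; rewrite subnKC.
subst j; have kM : (k < spacers b)%N by move: jH; rewrite /height ltn_add2l.
have root i : (i < spacers b)%N -> Num.sqrt (rho (N + i) b) = spacer_root i b.
  move=> iM; rewrite /rho ifF; last by rewrite ltnNge leq_addr.
  rewrite ltn_add2l iM addKn sqrtr_sqr gtr0_norm//; exact: spacer_root_gt0.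
rewrite root//; case: k kM {Nj jH} => [|k] kM.
  rewrite addn0 /rho prednK// leqnn -/(spacer_start b) /spacer_root mul1r.
  by rewrite opprD addNKr.
rewrite addnS /= root; last exact: ltnW.
by rewrite /spacer_root -[in X in (_ - X)%R]natr1; ring.
Qed.

Lemma spacers_step b : ((spacers b)%:R * spacer_step b ^+ 2 <= eps ^+ 2)%R.
Proof.
have M0 : (0 < (spacers b)%:R :> R)%R by rewrite ltr0n.
rewrite /spacer_step; set D := (spacer_end b - spacer_start b)%R.
have -> : ((spacers b)%:R * (D / (spacers b)%:R) ^+ 2 = D ^+ 2 / (spacers b)%:R)%R.
  by move: (spacers b)%:R%R M0 => M M0; field; rewrite gt_eqF.
rewrite ler_pdivrMr// mulrC -ler_pdivrMr ?exprn_gt0//.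
exact/ltW/truncnS_gt.
Qed.

(** The base, where the derivative is [1], gives the first term; the other levels below [N] repeat
    the error of [T0]. On a spacer, the density turns the squared difference between [1] and the
    root of a quotient into the squared increment of the roots, whose sum is controlled by
    [spacers_step]. *)
Lemma derivative_error (G : nat -> R) : G 0%N = 0%R ->
  \int[nu]_y ((Num.sqrt (tower_der rho y) - 1 - G (tower_label y)) ^+ 2)%:E <=
  (N%:R^-1)%:E * \int[mu]_x (G (l x) ^+ 2)%:E +
  \int[mu]_x ((Num.sqrt (Tprime mu T0 x) - 1 - G (l x)) ^+ 2)%:E + (eps ^+ 2)%:E.
Proof.
move=> Gz.
have mGl : measurable_fun setT (G \o l).
  by apply: (@measurable_fun_glue _ _ X R l (fun n _ => G n)).
have mGt : measurable_fun setT (G \o tower_label).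
  by apply: (@measurable_fun_glue _ _ R R tower_label (fun n _ => G n)) => // n; exact: measurable_tower_label.
pose f y := ((Num.sqrt (tower_der rho y) - 1 - G (tower_label y)) ^+ 2)%:E.
pose g0 x := (G (l x) ^+ 2)%:E.
pose g1 x := ((Num.sqrt (w x) - 1 - G (l x)) ^+ 2)%:E.
pose g (j : nat) := if j is 0%N then g0 else g1.
have mf : measurable_fun setT f.
  apply/measurable_EFinP/measurable_funX/measurable_funB => //; apply: measurable_funB => //.
  apply: measurable_fun_sqrt.
  exact: (measurable_tower_der measurable_rho rho_height_gt0 rho_height_eq0).
have mg0 : measurable_fun setT g0 by apply/measurable_EFinP/measurable_funX.
have mg1 : measurable_fun setT g1.
  apply/measurable_EFinP/measurable_funX/measurable_funB => //; apply: measurable_funB => //.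
  apply: measurable_fun_sqrt; exact: measurable_pos_Tprime.
have mg j : measurable_fun setT (g j) by case: j.
have f_ge0 y : 0 <= f y by rewrite lee_fin sqr_ge0.
have g_ge0 j x : 0 <= g j x by case: j => [|j]; rewrite lee_fin sqr_ge0.
have fg j b : (j < N)%N -> (0 <= b < 1)%R -> f (b + j%:R)%R = g j (kap j b).
  move=> jN b01; rewrite /f tower_label_level// jN tower_der_level//.
  case: j jN => [|j] jN; first by rewrite sqrtr1 subrr sub0r sqrrN.
  by rewrite tower_der_rho.
rewrite (@ge0_integral_rho f g mf f_ge0 mg g_ge0 fg).
have -> : \int[mu]_x ((Num.sqrt (Tprime mu T0 x) - 1 - G (l x)) ^+ 2)%:E = \int[mu]_x g1 x.
  apply: ae_eq_integral => //.
    apply/measurable_EFinP/measurable_funX/measurable_funB => //; apply: measurable_funB => //.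
    apply: measurable_fun_sqrt; exact: measurable_Tprime.
  by apply: filterS pos_TprimeE => x -> _.
have I0 : 0 <= \int[mu]_x g1 x by apply: integral_ge0 => x _; exact: (g_ge0 1%N).
apply: leeD.
  rewrite (big_ltn N0); apply: leeD => //.
  rewrite -[leRHS]sum_inv// [leRHS](big_ltn N0).
  apply: le_trans (leeDr _ _); last by rewrite mule_ge0// lee_fin invr_ge0.
  rewrite le_eqVlt; apply/orP; left; apply/eqP.
  by apply: eq_big_nat => -[].
rewrite -(@nneseries_addn _ (fun j => \int[leb]_(b in `[0%R, 1%R[) (f (b + j%:R)%R * (rho j b)%:E)) N); last first.
  move=> j; apply: integral_ge0 => b _; rewrite mule_ge0// lee_fin.
  exact: (rho_ge0 rho_height_gt0 rho_height_eq0).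
pose s k b := (if (k < spacers b)%N then spacer_step b ^+ 2 else 0)%R.
have ms k : measurable_fun setT (s k).
  apply: (@measurable_fun_glue _ _ R R spacers
    (fun n b => if (k < n)%N then ((spacer_end b - spacer_start b) / n%:R) ^+ 2 else 0)%R) => n.
    exact: measurable_spacers.
  case: (_ < _)%N => //; apply: measurable_funX; apply: measurable_funM => //.
  by apply: measurable_funB; [exact: measurable_spacer_end|exact: measurable_spacer_start].
have s0 k b : (0 <= s k b)%R by rewrite /s; case: ifP => // _; exact: sqr_ge0.
rewrite (eq_eseriesr (g := fun k => \int[leb]_(b in `[0%R, 1%R[) (s k b)%:E)); last first.
  move=> k _; apply: eq_integral => b; rewrite inE/= in_itv/= => b01.
  rewrite /s; case: ifPn => kM; last first.
    rewrite rho_height_eq0 ?mule0//; rewrite -leqNgt in kM.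
    by rewrite /height addnC leq_add2r.
  have jH : (N <= k + N < height b)%N by rewrite leq_addl /height addnC ltn_add2l.
  have j0 : (0 < k + N)%N by rewrite addn_gt0 N0 orbT.
  rewrite /f tower_label_level// ifF; last by rewrite ltnNge leq_addl.
  rewrite Gz subr0 tower_der_level//.
  have := sqrt_spacer jH; case/andP: jH => _ jH.
  case: (k + N)%N j0 jH => // j _ jH /= E.
  have r0 := rho_height_gt0 jH.
  rewrite -EFinM -[in X in (_ * X)%R](sqr_sqrtr (ltW r0)) -exprMn; congr _%:E.
  rewrite mulrBl mul1r -sqrtrM; last first.
    by rewrite divr_ge0//; exact: (rho_ge0 rho_height_gt0 rho_height_eq0).
  by rewrite divfK ?gt_eqF// E sqrrN.
have ms' k : measurable_fun (`[0%R, 1%R[%classic : set R) (fun b => (s k b)%:E).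
  by apply: measurable_funTS; apply/measurable_EFinP.
rewrite -(integral_nneseries leb _ ms')//; last by move=> k b _; rewrite lee_fin.
apply: (@le_trans _ _ (\int[leb]_(b in `[0%R, 1%R[) cst (eps ^+ 2)%:E b)).
  apply: ge0_le_integral => //.
  - by move=> b _; apply: nneseries_ge0 => k _ _; rewrite lee_fin.
  - apply: measurable_funTS; apply: ge0_emeasurable_sum => // [k x _ _|k _]; first by rewrite lee_fin.
    exact/measurable_EFinP.
  move=> b _; rewrite (nneseries_split 0 (spacers b)); last by move=> k _; rewrite lee_fin.
  rewrite add0n eseries0 ?adde0; last by move=> k Mk _; rewrite /s ltnNge Mk.
  rewrite (@eq_big_nat _ _ _ _ _ _ (fun=> (spacer_step b ^+ 2)%:E)).
    by rewrite sumEFin sumr_const_nat subn0 -[(_ *+ _)%R]mulr_natl lee_fin spacers_step.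
  by move=> k /andP[_ kM]; rewrite /s kM.
rewrite (integral_cst leb) //.
have lI : leb (`[0%R, 1%R[%classic : set R) = 1.
  by rewrite /leb lebesgue_measure_itv/= lte_fin ltr01 sube0.
by rewrite [X in _ * X <= _]lI mule1.
Qed.

(** The preimage of a base point is on a top level, always a spacer since [spacers] is positive. *)
Lemma tower_inv_label b : (0 <= b < 1)%R ->
  tower_label (tower_inv height (b + 0%:R))%R = 0%N.
Proof.
move=> b01; rewrite /tower_inv truncn_level// fr_level//.
rewrite tower_label_level; last exact: odo_inv_itv.
by rewrite /height addnS/= ltnNge leq_addr.
Qed.

(** [F2] vanishes on the spacers and [F1] on the preimage of the base; the remaining [N - 1] levels
    repeat the coefficient of [T0] with weight [1/N]. The function [phi] will be a positive or
    negative part. *)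
Lemma coefficient_transfer (F1 F2 : nat -> R) (phi : R -> \bar R) :
  F1 0%N = 0%R -> F2 0%N = 0%R -> measurable_fun setT phi -> (forall r, 0 <= phi r) ->
  phi 0%R = 0 ->
  \int[nu]_y phi (Num.sqrt (tower_der rho y) * F1 (tower_label (tower_inv height y)) *
                  F2 (tower_label y))%R =
  (1 - N%:R^-1)%:E * \int[mu]_x phi (Num.sqrt (Tprime mu T0 x) * F1 (l (inv_map T0 x)) *
                                     F2 (l x))%R.
Proof.
move=> F1z F2z mphi phi_ge0 phiz.
have [T0K T0K' mT0 mS0] := inv_mapP aT0.1.
have mFl (F : nat -> R) : measurable_fun setT (F \o l).
  by apply: (@measurable_fun_glue _ _ X R l (fun n _ => F n)).
have mFt (F : nat -> R) : measurable_fun setT (F \o tower_label).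
  by apply: (@measurable_fun_glue _ _ R R tower_label (fun n _ => F n)) => // n; exact: measurable_tower_label.
pose f y := phi (Num.sqrt (tower_der rho y) * F1 (tower_label (tower_inv height y)) *
                  F2 (tower_label y))%R.
pose g1 x := phi (Num.sqrt (w x) * F1 (l (inv_map T0 x)) * F2 (l x))%R.
pose g (j : nat) := if j is 0%N then cst 0 else g1.
have mf : measurable_fun setT f.
  apply: (measurableT_comp mphi); apply: measurable_funM; last exact: mFt.
  apply: measurable_funM.
    apply: measurable_fun_sqrt.
    exact: (measurable_tower_der measurable_rho rho_height_gt0 rho_height_eq0).
  exact: (measurableT_comp (mFt F1) (measurable_tower_inv measurable_height)).
have mg1 : measurable_fun setT g1.
  apply: (measurableT_comp mphi); apply: measurable_funM; last exact: mFl.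
  apply: measurable_funM; first exact: (measurable_fun_sqrt measurable_pos_Tprime).
  exact: (measurableT_comp (mFl F1) mS0).
have mg j : measurable_fun setT (g j) by case: j.
have f_ge0 y : 0 <= f y by exact: phi_ge0.
have g_ge0 j x : 0 <= g j x by case: j => [|j] //; exact: phi_ge0.
have fg j b : (j < N)%N -> (0 <= b < 1)%R -> f (b + j%:R)%R = g j (kap j b).
  move=> jN b01; rewrite /f; case: j jN => [|j] jN.
    by rewrite tower_inv_label// F1z mulr0 mul0r phiz.
  rewrite tower_label_level// jN tower_der_level// tower_der_rho// /g /g1.
  have -> : tower_inv height (b + j.+1%:R)%R = (b + j%:R)%R.
    by rewrite /tower_inv truncn_level// -natr1 addrA addrK.
  by rewrite tower_label_level// (ltnW jN) [kap j.+1 b]/kap/= T0K.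
rewrite (@ge0_integral_rho f g mf f_ge0 mg g_ge0 fg) eseries0 ?adde0; last first.
  move=> j Nj _; apply: integral0_eq => b; rewrite /= in_itv/= => b01.
  by rewrite /f tower_label_level// ltnNge Nj/= F2z mulr0 phiz mul0e.
have -> : \int[mu]_x phi (Num.sqrt (Tprime mu T0 x) * F1 (l (inv_map T0 x)) * F2 (l x))%R =
    \int[mu]_x g1 x.
  apply: ae_eq_integral => //.
    apply: (measurableT_comp mphi); apply: measurable_funM; last exact: mFl.
    apply: measurable_funM; first exact: (measurable_fun_sqrt (measurable_Tprime muT aT0)).
    exact: (measurableT_comp (mFl F1) mS0).
  by apply: filterS pos_TprimeE => x -> _.
have I0 : 0 <= \int[mu]_x g1 x by apply: integral_ge0 => x _; exact: phi_ge0.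
rewrite (big_ltn N0) integral0 mule0 add0e.
rewrite (@eq_big_nat _ _ _ _ _ _ (fun=> (N%:R^-1)%:E * \int[mu]_x g1 x)); last by case.
move: (\int[mu]_x g1 x) I0 => I I0.
rewrite -ge0_sume_distrl; last by move=> j _; rewrite lee_fin invr_ge0.
rewrite sumEFin sumr_const_nat -[(_^-1 *+ _)%R]mulr_natl; congr (_%:E * _).
have N0' : (N%:R != 0 :> R)%R by rewrite pnatr_eq0 -lt0n.
by rewrite natrB// mulrBl divff// mul1r.
Qed.

End concrete.

Lemma with_density_null d (X : measurableType d) (R : realType) (mu : {measure set X -> \bar R})
    (w : X -> R) (mw : measurable_fun setT w) (w0 : forall x, 0 <= w x) (A : set X) :
  measurable A -> mu A = 0%E -> with_density mu mw w0 A = 0%E.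
Proof.
move=> mA A0; rewrite /with_density null_set_integral//.
by apply/measurable_EFinP; exact: measurable_funTS.
Qed.

Section tower_sigma_finite.
Context (R : realType) (rho : nat -> R -> R) (H : R -> nat).
Variables (mrho : forall j, measurable_fun setT (rho j))
  (rho_gt0 : forall j b, (j < H b)%N -> 0 < rho j b)
  (rho_eq0 : forall j b, (H b <= j)%N -> rho j b = 0).

Lemma tower_measure_sigma_finite :
  sigma_finite setT (tower_measure mrho rho_gt0 rho_eq0).
Proof. exact: (@with_density_sigma_finite _ R R (@leb R)). Qed.

HB.instance Definition _ := @Measure_isSigmaFinite.Build _ _ _
  (tower_measure mrho rho_gt0 rho_eq0) tower_measure_sigma_finite.

End tower_sigma_finite.

Section inverse.
Context d (X : measurableType d) (R : realType) (mu : {sigma_finite_measure set X -> \bar R}).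

Lemma inv_mapE (T S : X -> X) : nonsingular_inv mu T -> cancel S T -> inv_map T =1 S.
Proof.
by move=> nT ST x; have [TK _ _ _] := inv_mapP nT; rewrite -[in LHS](ST x) TK.
Qed.

Lemma nonsingular_inv_sym (T S : X -> X) : nonsingular_inv mu T -> cancel T S -> cancel S T ->
  nonsingular_inv mu S.
Proof.
move=> nT TS ST; have [_ _ mT mS'] := inv_mapP nT.
have ES : inv_map T = S by apply/funext => x; exact: inv_mapE.
have mS : measurable_fun setT S by rewrite -ES.
exists T; split => // A mA; have [S' [_ _ _ _ nsT]] := nT.
have mSA : measurable (S @^-1` A) by exact: measurable_preimage.
rewrite -(nsT _ mSA) (_ : T @^-1` _ = A)//.
by apply/seteqP; split => x /=; rewrite TS.
Qed.

Lemma TprimeE (T : X -> X) (v : X -> R) : is_RN mu (fun A => mu (T @^-1` A)) v ->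
  is_RN mu (fun A => mu (T @^-1` A)) (Tprime mu T) /\ {ae mu, forall x, Tprime mu T x = v x}.
Proof.
move=> RNv; have RNT : is_RN mu (fun A => mu (T @^-1` A)) (Tprime mu T).
  by rewrite /Tprime /RNderiv; case: xgetP => [y ->//|/(_ v)].
split=> //; case: RNT => m1 p1 e1; case: RNv => m2 p2 e2.
by apply: ae_eq_density => // A mA; rewrite -e1// -e2.
Qed.

End inverse.

Section concrete_transformation.
Context d (X : measurableType d) (R : realType) (mu : {sigma_finite_measure set X -> \bar R}).
Hypotheses (sbX : @standard_borel d X R) (na : nonatomic mu) (muT : mu setT = +oo%E).
Local Open Scope ereal_scope.

Lemma ex_point : exists x : X, True.
Proof.
apply: contrapT => nx; have T0 : [set: X] = set0 by apply/seteqP; split => // x _; apply: nx; exists x.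
by move: muT; rewrite T0 measure0.
Qed.

(** Isomorphism of two infinite atomless spaces, each regarded as a single cell. *)
Lemma ex_base_map : exists2 pi : R -> X, measurable_fun setT pi &
  forall A, measurable A -> @base_measure R (pi @^-1` A) = mu A.
Proof.
have [x0 _] := ex_point.
have [phi [om [mphi mom phiK atom]]] := standard_borel_code x0 sbX na.
have ml (Y : Type) (i : nat) : [set y : Y | 0%N = i] = if i == 0%N then setT else set0.
  by apply/seteqP; split => y; case: i.
have [phi' [om' cX]] : exists phi' om', coding mu (fun=> 0%N) phi' om'.
  apply: (@ex_coding _ _ _ _ _ phi om) => //; last exact: aeW.
  by move=> i; rewrite ml; case: ifP.
have [phiB [omB cB]] : exists phi' om', coding (@base_measure R) (fun=> 0%N) phi' om'.
  apply: (@ex_coding _ _ _ _ _ id id) => //; last 2 first.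
  - exact: aeW.
  - move=> r.
    exact: (@with_density_null _ R R (@leb R) _ (@measurable_inv_density R)
      (@inv_density_ge0 R) [set r] (measurable_set1 r) (lebesgue_measure_set1 r)).
  by move=> i; rewrite ml; case: ifP.
have [|f [g [mf mg fP gP _]]] := labelled_isomorphism cB cX.
  move=> i; rewrite !ml; case: ifP => _; last by rewrite !measure0.
  by apply: etrans (@base_measureT R) _; exact/esym.
by exists f.
Qed.

Variables (T0 : X -> X) (aT0 : Aut2 mu T0) (N : nat) (eps : R) (l : X -> nat).
Hypotheses (N0 : (0 < N)%N) (eps0 : (0 < eps)%R).
Hypothesis ml : forall i, measurable [set x | l x = i].
Hypothesis l0 : mu [set x | l x = 0%N] = +oo.

Lemma tower_approximation : exists T : X -> X, [/\ Aut2 mu T, ergodic_III1 mu T,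
  (forall G : nat -> R, G 0%N = 0%R ->
    \int[mu]_x ((Num.sqrt (Tprime mu T x) - 1 - G (l x)) ^+ 2)%:E <=
    (N%:R^-1)%:E * \int[mu]_x (G (l x) ^+ 2)%:E +
    \int[mu]_x ((Num.sqrt (Tprime mu T0 x) - 1 - G (l x)) ^+ 2)%:E + (eps ^+ 2)%:E) &
  (forall (F1 F2 : nat -> R) (phi : R -> \bar R), F1 0%N = 0%R -> F2 0%N = 0%R ->
    measurable_fun setT phi -> (forall r, 0 <= phi r) -> phi 0%R = 0 ->
    \int[mu]_x phi (Num.sqrt (Tprime mu T x) * F1 (l (inv_map T x)) * F2 (l x))%R =
    (1 - N%:R^-1)%:E *
    \int[mu]_x phi (Num.sqrt (Tprime mu T0 x) * F1 (l (inv_map T0 x)) * F2 (l x))%R)].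
Proof.
have [x0 _] := ex_point; have [pi mpi piP] := ex_base_map.
pose nu := tower_measure (measurable_rho muT aT0 N eps mpi) (@rho_height_gt0 _ X R mu T0 N eps N0 pi)
  (@rho_height_eq0 _ X R mu T0 N eps pi).
pose lab := tower_label T0 N pi l.
have mlab i : measurable [set y : R | lab y = i] by exact: (measurable_tower_label aT0).
have [th [th' [mth mth' thP th'P [thK th'K thl _]]]] : exists (th : X -> R) (th' : R -> X),
  [/\ measurable_fun setT th, measurable_fun setT th',
      (forall B, measurable B -> mu (th @^-1` B) = nu B),
      (forall A, measurable A -> nu (th' @^-1` A) = mu A) &
      [/\ {ae mu, forall x, th' (th x) = x}, {ae nu, forall y, th (th' y) = y},
          {ae mu, forall x, lab (th x) = l x} & {ae nu, forall y, l (th' y) = lab y}]].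
  have [phi [om [mphi mom phiK atom]]] := standard_borel_code x0 sbX na.
  have [phiX [omX cX]] : exists phi' om', coding mu l phi' om'.
    by apply: (@ex_coding _ _ _ _ _ phi om) => //; exact: aeW.
  have [phiN [omN cN]] : exists phi' om', coding nu lab phi' om'.
    apply: (@ex_coding _ _ _ _ _ id id) => //; first exact: aeW.
    move=> r; exact: (@with_density_null _ R R (@leb R) _ _ _ [set r] (measurable_set1 r)
      (lebesgue_measure_set1 r)).
  by apply: (labelled_isomorphism cX cN) => i; exact: label_mass.
have [T [S [[nT TS ST mS] [T_RN T_map thS]]]] := tower_transformation
  (measurable_height muT aT0 N eps mpi) (height_gt0 mu T0 N eps pi)
  (@rho_height_top _ X R mu T0 N eps N0 pi) mth mth' thP th'P thK th'K.
set der := tower_der _ in T_RN.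
have [RNT T'E] := TprimeE T_RN.
have [mT' _ _] := RNT; have [md _ _] := T_RN.
have mder : measurable_fun setT der.
  exact: (measurable_tower_der (measurable_rho muT aT0 N eps mpi) (@rho_height_gt0 _ X R mu T0 N eps N0 pi)
    (@rho_height_eq0 _ X R mu T0 N eps pi)).
have mGl (G : nat -> R) : measurable_fun setT (G \o l).
  by apply: (@measurable_fun_glue _ _ X R l (fun n _ => G n)).
have mGt (G : nat -> R) : measurable_fun setT (G \o lab).
  by apply: (@measurable_fun_glue _ _ R R lab (fun n _ => G n)).
have errE (G : nat -> R) :
  \int[mu]_x ((Num.sqrt (Tprime mu T x) - 1 - G (l x)) ^+ 2)%:E =
  \int[nu]_y ((Num.sqrt (der y) - 1 - G (lab y)) ^+ 2)%:E.
  pose h y := ((Num.sqrt (der y) - 1 - G (lab y)) ^+ 2)%:E.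
  have mh : measurable_fun setT h.
    apply/measurable_EFinP/measurable_funX/measurable_funB => //; last exact: mGt.
    by apply: measurable_funB => //; exact: measurable_fun_sqrt.
  rewrite -[RHS](ge0_integral_transfer mth thP mh); last by move=> y; rewrite lee_fin sqr_ge0.
  apply: ae_eq_integral => //.
  - apply/measurable_EFinP/measurable_funX/measurable_funB => //; last exact: mGl.
    by apply: measurable_funB => //; exact: measurable_fun_sqrt.
  - exact: (measurableT_comp mh mth).
  by move: T'E thl; apply: filterS2 => x e1 e2 _; rewrite /h e1 e2.
have err (G : nat -> R) : G 0%N = 0%R ->
    \int[mu]_x ((Num.sqrt (Tprime mu T x) - 1 - G (l x)) ^+ 2)%:E <=
    (N%:R^-1)%:E * \int[mu]_x (G (l x) ^+ 2)%:E +
    \int[mu]_x ((Num.sqrt (Tprime mu T0 x) - 1 - G (l x)) ^+ 2)%:E + (eps ^+ 2)%:E.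
  by move=> Gz; rewrite errE; exact: derivative_error.
have aT : Aut2 mu T.
  split => //; split; first by apply: measurable_funB => //; exact: measurable_fun_sqrt.
  (* For [G = 0] the error bound is the square integrability asked by [Aut2]. *)
  have := err (fun=> 0%R) erefl.
  have s0 (t : X -> X) : \int[mu]_x ((Num.sqrt (Tprime mu t x) - 1 - 0) ^+ 2)%:E =
      \int[mu]_x ((Num.sqrt (Tprime mu t x) - 1) ^+ 2)%:E.
    by apply: eq_integral => x _; rewrite subr0.
  have z0 : \int[mu]_x (0 ^+ 2 : R)%:E = 0 by apply: integral0_eq => x _; rewrite expr0n.
  rewrite !s0 [X in _ * X]z0.
  rewrite mule0 add0e => /le_lt_trans; apply.
  by have [_ [_ fin]] := aT0; rewrite lte_add_pinfty// ltry.
exists T; split => //.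
  exact: (tower_ergodic (measurable_height muT aT0 N eps mpi) (height_gt0 mu T0 N eps pi)
    (@rho_height_top _ X R mu T0 N eps N0 pi) mth mth' thP th'P thK th'K muT aT T_RN T_map).
move=> F1 F2 phi F1z F2z mphi phi0 phiz.
rewrite -[RHS](coefficient_transfer muT aT0 eps N0 mpi piP ml F1z F2z mphi phi0 phiz).
pose h y := phi (Num.sqrt (der y) * F1 (lab (tower_inv (height mu T0 N eps pi) y)) * F2 (lab y))%R.
have mh : measurable_fun setT h.
  apply: (measurableT_comp mphi); apply: measurable_funM; last exact: mGt.
  apply: measurable_funM; first exact: measurable_fun_sqrt.
  exact: (measurableT_comp (mGt F1) (measurable_tower_inv (measurable_height muT aT0 N eps mpi))).
transitivity (\int[nu]_y h y); last by [].
rewrite -[RHS](ge0_integral_transfer mth thP mh); last by move=> y; exact: phi0.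
apply: ae_eq_integral => //.
- apply: (measurableT_comp mphi); apply: measurable_funM; last exact: mGl.
  apply: measurable_funM; first exact: measurable_fun_sqrt.
  rewrite (_ : (fun x => _) = (F1 \o l) \o S); first exact: (measurableT_comp (mGl F1) mS).
  by apply/funext => x /=; rewrite (inv_mapE nT ST).
- exact: (measurableT_comp mh mth).
have thlS := ae_comp_nonsingular (nonsingular_inv_sym nT TS ST) thl.
have thSl : {ae mu, forall x, l (S x) = lab (tower_inv (height mu T0 N eps pi) (th x))}.
  by move: thS thlS; apply: filterS2 => x <- <-.
move: T'E thl thSl; apply: filterS3 => x e1 e2 e3 _.
by rewrite /h e1 e2 (inv_mapE nT ST) e3.
Qed.

End concrete_transformation.

(** * Density *)

Section L2_norm.
Context d (X : measurableType d) (R : realType) (mu : {sigma_finite_measure set X -> \bar R}).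
Local Open Scope ereal_scope.

(** A norm bound stated on squares, to avoid roots of possibly infinite integrals. *)
Definition L2_le (f : X -> R) (a : R) : Prop :=
  measurable_fun setT f /\ \int[mu]_x (f x ^+ 2)%:E <= (a ^+ 2)%:E.

Lemma L2_le_L2 f a : L2_le f a -> L2 mu f.
Proof. by move=> [mf fa]; split => //; apply: le_lt_trans fa _; exact: ltry. Qed.

Lemma L2_ex_le f : L2 mu f -> exists2 a : R, (1 <= a)%R & L2_le f a.
Proof.
move=> [mf ffin]; have f0 : 0 <= \int[mu]_x (f x ^+ 2)%:E.
  by apply: integral_ge0 => x _; rewrite lee_fin sqr_ge0.
have ff : \int[mu]_x (f x ^+ 2)%:E \is a fin_num by rewrite ge0_fin_numE.
exists (1 + fine (\int[mu]_x (f x ^+ 2)%:E))%R; first by rewrite lerDl fine_ge0.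
split => //; rewrite -[leLHS](fineK ff) lee_fin; have := fine_ge0 f0.
move: (fine _) => s s0; rewrite sqrrD expr1n mul1r -addrA addrC; nra.
Qed.

Lemma L2_le_trans f a b : (0 <= a)%R -> (a <= b)%R -> L2_le f a -> L2_le f b.
Proof.
move=> a0 ab [mf fa]; split => //; apply: le_trans fa _.
by rewrite lee_fin ler_sqr// nnegrE (le_trans a0).
Qed.

Lemma L2_leN f a : L2_le f a -> L2_le (fun x => - f x)%R a.
Proof.
by move=> [mf fa]; split; [exact: measurableT_comp|under eq_integral do rewrite sqrrN].
Qed.

(** Minkowski's inequality, from a pointwise bound with weights [1 + b / a] and [1 + a / b], chosen
    to add up to [(a + b) ^+ 2]. *)
Lemma L2_leD f g a b : (0 < a)%R -> (0 < b)%R -> L2_le f a -> L2_le g b ->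
  L2_le (fun x => f x + g x)%R (a + b).
Proof.
move=> a0 b0 [mf fa] [mg gb]; split; first exact: measurable_funD.
have mf2 : measurable_fun setT (fun x => (f x ^+ 2)%:E).
  by apply/measurable_EFinP; exact: measurable_funX.
have mg2 : measurable_fun setT (fun x => (g x ^+ 2)%:E).
  by apply/measurable_EFinP; exact: measurable_funX.
have c0 : (0 <= 1 + b / a)%R by rewrite addr_ge0// divr_ge0// ltW.
have c1 : (0 <= 1 + a / b)%R by rewrite addr_ge0// divr_ge0// ltW.
apply: (@le_trans _ _ (\int[mu]_x ((1 + b / a)%:E * (f x ^+ 2)%:E + (1 + a / b)%:E * (g x ^+ 2)%:E))).
  apply: ge0_le_integral => //.
  - by move=> x _; rewrite lee_fin sqr_ge0.
  - by apply/measurable_EFinP; apply: measurable_funX; exact: measurable_funD.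
  - by apply: emeasurable_funD; exact: measurable_funeM.
  move=> x _; rewrite -!EFinM -EFinD lee_fin.
  rewrite -subr_ge0 (_ : _ - _ = (b * f x - a * g x) ^+ 2 / (a * b))%R.
    by rewrite divr_ge0 ?sqr_ge0// mulr_ge0// ltW.
  by field; rewrite !gt_eqF.
rewrite ge0_integralD//; last 4 first.
- by move=> x _; rewrite mule_ge0// lee_fin sqr_ge0.
- exact: measurable_funeM.
- by move=> x _; rewrite mule_ge0// lee_fin sqr_ge0.
- exact: measurable_funeM.
rewrite !ge0_integralZl//; try by move=> x _; rewrite lee_fin sqr_ge0.
apply: le_trans (leeD (lee_wpmul2l _ fa) (lee_wpmul2l _ gb)) _; rewrite ?lee_fin//.
rewrite (_ : (1 + b / a) * a ^+ 2 + (1 + a / b) * b ^+ 2 = (a + b) ^+ 2)%R//.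
by field; rewrite !gt_eqF.
Qed.

Lemma L2_leB f g a b : (0 < a)%R -> (0 < b)%R -> L2_le f a -> L2_le g b ->
  L2_le (fun x => f x - g x)%R (a + b).
Proof. by move=> a0 b0 fa /L2_leN gb; exact: L2_leD. Qed.

Lemma L2_le_mul f g a b : (0 < a)%R -> (0 < b)%R -> L2_le f a -> L2_le g b ->
  mu.-integrable setT (EFin \o (fun x => f x * g x)%R) /\
  (`|\int[mu]_x (f x * g x)| <= a * b)%R.
Proof.
move=> a0 b0 [mf fa] [mg gb].
have mfg : measurable_fun setT (fun x => f x * g x)%R by exact: measurable_funM.
have le : \int[mu]_x `|f x * g x|%:E <= (a * b)%:E.
  apply: le_trans (integral_norm_mul_le mu mf mg (divr_gt0 b0 a0)) _.
  apply: le_trans (leeD (lee_wpmul2l _ fa) (lee_wpmul2l _ gb)) _.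
  - by rewrite lee_fin !divr_ge0// ltW.
  - by rewrite lee_fin divr_ge0// invr_ge0 divr_ge0// ltW.
  rewrite -!EFinM -EFinD lee_fin le_eqVlt; apply/orP; left; apply/eqP.
  by field; rewrite !gt_eqF.
have ifg : mu.-integrable setT (EFin \o (fun x => f x * g x)%R).
  apply/integrableP; split; first exact/measurable_EFinP.
  by apply: le_lt_trans le _; exact: ltry.
split => //; apply: le_trans (le_normr_Rintegral measurableT ifg) _.
have fin : \int[mu]_x `|f x * g x|%:E \is a fin_num.
  rewrite ge0_fin_numE; first by apply: le_lt_trans le _; exact: ltry.
  by apply: integral_ge0 => x _; rewrite lee_fin.
by rewrite -lee_fin /Rintegral fineK.
Qed.

Lemma L2_norm_close f g e : (0 < e)%R -> L2 mu f -> L2 mu g ->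
  L2_le (fun x => f x - g x)%R e ->
  (`|Num.sqrt (fine (\int[mu]_x (f x ^+ 2)%:E)) -
     Num.sqrt (fine (\int[mu]_x (g x ^+ 2)%:E))| <= 2 * e)%R.
Proof.
move=> e0.
have one u v : L2 mu u -> L2 mu v -> L2_le (fun x => u x - v x)%R e ->
    (Num.sqrt (fine (\int[mu]_x (u x ^+ 2)%:E)) <=
     Num.sqrt (fine (\int[mu]_x (v x ^+ 2)%:E)) + 2 * e)%R.
  move=> [mu_ ufin] [mv vfin] uve.
  have pos w : 0 <= \int[mu]_x (w x ^+ 2 : R)%:E.
    by apply: integral_ge0 => x _; rewrite lee_fin sqr_ge0.
  set s := Num.sqrt (fine (\int[mu]_x (v x ^+ 2)%:E)).
  have s0 : (0 <= s)%R by exact: sqrtr_ge0.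
  (* [s] may be [0] while [L2_leD] wants positive bounds; this is the origin of the factor [2]. *)
  have vs : L2_le v (s + e).
    split => //; rewrite -[leLHS]fineK ?ge0_fin_numE// lee_fin.
    rewrite -[leLHS]sqr_sqrtr ?fine_ge0// -/s ler_sqr ?nnegrE ?addr_ge0// ?ltW//.
    by rewrite ltrDl.
  have := L2_leD e0 (ltr_wpDl s0 e0) uve vs.
  rewrite (_ : (fun x => _) = u); last by apply/funext => x; rewrite subrK.
  move=> [_ us]; have {}us : (fine (\int[mu]_x (u x ^+ 2)%:E) <= (s + 2 * e) ^+ 2)%R.
    rewrite -lee_fin fineK ?ge0_fin_numE//; apply: le_trans us _.
    by rewrite lee_fin (_ : e + (s + e) = s + 2 * e)%R//; ring.
  have se : (0 <= s + 2 * e)%R by rewrite addr_ge0// mulr_ge0// ltW.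
  by rewrite -[leRHS](ger0_norm se) -sqrtr_sqr ler_sqrt// sqr_ge0.
move=> Lf Lg fg; have gf : L2_le (fun x => g x - f x)%R e.
  have := L2_leN fg; rewrite (_ : (fun x => _) = (fun x => g x - f x)%R)//.
  by apply/funext => x; rewrite opprB.
move: (one _ _ Lf Lg fg) (one _ _ Lg Lf gf).
move: (Num.sqrt _) (Num.sqrt _) => s t st ts.
by rewrite ler_norml; apply/andP; split; lra.
Qed.

End L2_norm.

Section koopman.
Context d (X : measurableType d) (R : realType) (mu : {sigma_finite_measure set X -> \bar R}).
Hypothesis muT : mu setT = +oo%E.
Local Open Scope ereal_scope.
Notation L2_le := (L2_le mu).

Definition UT (T : X -> X) (f : X -> R) (x : X) : R :=
  (Num.sqrt (Tprime mu T x) * f (inv_map T x))%R.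

Lemma L2_le_UT T f a : Aut2 mu T -> L2_le f a -> L2_le (UT T f) a.
Proof.
move=> aT [mf fa]; have [TS ST mT mS] := inv_mapP aT.1.
have mfS : measurable_fun setT (f \o inv_map T) by exact: measurableT_comp.
split; first by apply: measurable_funM => //; exact/measurable_fun_sqrt/measurable_Tprime.
rewrite (eq_integral (fun x => ((f \o inv_map T) x ^+ 2)%:E * (Tprime mu T x)%:E)); last first.
  by move=> x _; rewrite /UT exprMn sqr_sqrtr ?Tprime_ge0// mulrC EFinM.
rewrite -(ge0_integral_comp_Tprime muT (h := fun x => ((f \o inv_map T) x ^+ 2)%:E))//.
- by under eq_integral do rewrite /= TS.
- by apply/measurable_EFinP; exact: measurable_funX.
- by move=> x; rewrite lee_fin sqr_ge0.
Qed.

(** [U_T] is isometric, so the bound does not depend on [T]. *)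
Lemma UT_coef_close T f g f' g' a b e : Aut2 mu T -> (0 < a)%R -> (0 < b)%R -> (0 < e)%R ->
  L2_le f' a -> L2_le g b -> L2_le (fun x => f x - f' x)%R e ->
  L2_le (fun x => g x - g' x)%R e ->
  (`|UT_coef mu T f g - UT_coef mu T f' g'| <= e * b + a * e)%R.
Proof.
move=> aT a0 b0 e0 f'a gb ffe gge.
have [i1 le1] := L2_le_mul e0 b0 (L2_le_UT aT ffe) gb.
have [i2 le2] := L2_le_mul a0 e0 (L2_le_UT aT f'a) gge.
have fD : L2_le f (e + a).
  by have := L2_leD e0 a0 ffe f'a; rewrite (_ : (fun x => _) = f)//; apply/funext => x; rewrite subrK.
have gD : L2_le g' (b + e).
  have := L2_leB b0 e0 gb gge; rewrite (_ : (fun x => _) = g')//.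
  by apply/funext => x; rewrite opprB addrC subrK.
have [i3 _] := L2_le_mul (addr_gt0 e0 a0) b0 (L2_le_UT aT fD) gb.
have [i4 _] := L2_le_mul a0 (addr_gt0 b0 e0) (L2_le_UT aT f'a) gD.
have -> : (UT_coef mu T f g - UT_coef mu T f' g' =
    \int[mu]_x (UT T (fun x => f x - f' x) x * g x) + \int[mu]_x (UT T f' x * (g x - g' x)))%R.
  rewrite -RintegralD// (_ : UT_coef mu T f g = \int[mu]_x (UT T f x * g x))%R//.
  rewrite (_ : UT_coef mu T f' g' = \int[mu]_x (UT T f' x * g' x))%R// -RintegralB//.
  by apply: eq_Rintegral => x _; rewrite /UT; ring.
exact: le_trans (ler_normD _ _) (lerD le1 le2).
Qed.

End koopman.

Section step_approximation.
Context d (X : measurableType d) (R : realType) (mu : {sigma_finite_measure set X -> \bar R}).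
Local Open Scope ereal_scope.

Definition finite_labels (l : X -> nat) : Prop :=
  (forall i, measurable [set x | l x = i]) /\ mu [set x | l x <> 0%N] < +oo.

Definition approximates (l : X -> nat) (e : R) (g : X -> R) : Prop :=
  exists2 F : nat -> R, F 0%N = 0%R & L2_le mu (fun x => g x - F (l x))%R e.

Lemma L2_tail (g : X -> R) (e : R) (W : (set X)^nat) : L2 mu g -> (0 < e)%R ->
  (forall n, measurable (W n)) -> nondecreasing_seq W -> \bigcup_n W n = setT ->
  exists n, \int[mu]_(x in ~` W n) (g x ^+ 2)%:E < e%:E.
Proof.
move=> [mg gfin] e0 mW ndW WT.
pose m := with_density mu (measurable_funX 2 mg) (fun x => sqr_ge0 (g x)).
have cv : (m \o (fun n => ~` W n)) x @[x --> \oo] --> m (\bigcap_n ~` W n).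
  apply: nonincreasing_cvg_mu => //.
  - apply: le_lt_trans gfin; apply: ge0_subset_integral => //.
    + exact: measurableC.
    + by apply/measurable_EFinP; exact: measurable_funX.
    + by move=> x _; rewrite lee_fin sqr_ge0.
  - by move=> n; exact: measurableC.
  - by apply: bigcapT_measurable => n; exact: measurableC.
  - by move=> n k nk; rewrite subsetEset; apply: subsetC; rewrite -subsetEset; exact: ndW.
have E : m (\bigcap_n ~` W n) = 0 by rewrite -setC_bigcup WT setCT; exact: integral_set0.
rewrite E in cv; have := cv [set y | y < e%:E]; case.
  by apply: open_nbhs_nbhs; split; [exact: open_ereal_lt_ereal|rewrite /= lte_fin].
by move=> n _ /(_ n (leqnn n)) /= h; exists n.
Qed.

Lemma ex_step_approximation (g : X -> R) (e : R) : L2 mu g -> (0 < e)%R ->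
  exists l, finite_labels l /\ approximates l e g.
Proof.
move=> Lg e0; have [mg gfin] := Lg; have [W [mW Wfin ndW WT]] := sigma_finite_nd mu.
have e2 : (0 < e ^+ 2 / 2)%R by rewrite divr_gt0// exprn_gt0.
have [n tail] := L2_tail Lg e2 mW ndW WT.
have [c c0 Wc] : exists2 c : R, (0 < c)%R & mu (W n) <= c%:E.
  have Wn : mu (W n) \is a fin_num by rewrite ge0_fin_numE.
  exists (fine (mu (W n)) + 1)%R; first by rewrite ltr_wpDl ?fine_ge0.
  by rewrite -[leLHS](fineK Wn) lee_fin lerDl.
(* Rounding down to multiples of [h] on [W n] costs at most [h ^+ 2 * c], half of [e ^+ 2]; the tail
   outside [W n] takes the other half. *)
pose h := (e / Num.sqrt (2 * c))%R.
have c2 : (0 < 2 * c)%R by rewrite mulr_gt0.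
have h0 : (0 < h)%R by rewrite divr_gt0// sqrtr_gt0.
have h2 : (h ^+ 2 * c = e ^+ 2 / 2)%R.
  rewrite /h expr_div_n sqr_sqrtr ?ltW//; field; exact: lt0r_neq0.
(* Label [0] is kept for the complement of [W n]; on [W n] even the rounded value [0] gets a
   positive label. *)
pose l x := if x \in W n then (pickle (Num.floor (g x / h))).+1 else 0%N.
pose F k := if k is i.+1 then (if pickle_inv i is Some z then h * (z : int)%:~R else 0)%R else 0%R.
have l0 : [set x | l x = 0%N] = ~` W n.
  by apply/seteqP; split => x /=; rewrite /l; case: ifPn; rewrite ?inE// notin_setE.
have ml i : measurable [set x | l x = i].
  case: i => [|i]; first by rewrite l0; exact: measurableC.
  case E : (@pickle_inv int i) => [z|]; last first.
    rewrite [X in measurable X](_ : _ = set0)//; apply/seteqP; split => // x /=.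
    by rewrite /l; case: ifPn => // _ [ix]; move: E; rewrite -ix pickleK_inv.
  rewrite [X in measurable X](_ : _ = W n `&` [set x | Num.floor (g x / h) = z]).
    apply: measurableI => //.
    rewrite [X in measurable X](_ : _ = [set x | z%:~R * h <= g x]%R `&` [set x | g x < (z + 1)%:~R * h]%R).
      apply: measurableI.
        by rewrite -[X in measurable X]setTI; exact: measurable_fun_ler.
      by rewrite -[X in measurable X]setTI; exact: measurable_fun_ltr.
    apply/seteqP; split => x /=.
      move=> <-; rewrite -ler_pdivlMr// -ltr_pdivrMr//; split; first exact: floor_le.
      by rewrite floorD1_gt.
    rewrite -ler_pdivlMr// -ltr_pdivrMr// => -[z1 z2]; apply: floor_def.
    by rewrite z1.
  apply/seteqP; split => x /=; rewrite /l; case: ifPn; rewrite ?inE ?notin_setE//.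
    move=> Wx [ix]; split => //; move: E; rewrite -ix pickleK_inv; by case.
  - move=> Wx [_ gz]; congr (_.+1); rewrite gz.
    by have := @pickle_invK int i; rewrite /ocancel E/=.
  - by move=> nW [].
exists l; split.
  split => //; apply: le_lt_trans (Wfin n); apply: le_measure; rewrite ?inE//.
    rewrite (_ : [set x | l x <> 0%N] = ~` [set x | l x = 0%N])//; exact: measurableC.
  by move=> x /= lx; apply: contrapT => nW; apply: lx; suff : [set x | l x = 0%N] x by []; rewrite l0.
exists F => //.
have mFl : measurable_fun setT (F \o l).
  by apply: (@measurable_fun_glue _ _ X R l (fun n _ => F n)).
have md : measurable_fun setT (fun x => g x - F (l x))%R by exact: measurable_funB.
have md2 : measurable_fun setT (fun x => ((g x - F (l x)) ^+ 2)%:E).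
  by apply/measurable_EFinP; exact: measurable_funX.
split => //; rewrite -[X in integral _ X _](setUv (W n)).
rewrite ge0_integral_setU//; last 4 first.
- exact: measurableC.
- exact: measurable_funTS.
- by move=> x _; rewrite lee_fin sqr_ge0.
- by rewrite /disj_set setICr.
have -> : (e ^+ 2)%:E = (e ^+ 2 / 2)%:E + (e ^+ 2 / 2)%:E.
  by rewrite -EFinD -splitr.
apply: leeD; last first.
  apply: le_trans (ltW tail); rewrite le_eqVlt; apply/orP; left; apply/eqP.
  apply: eq_integral => x; rewrite inE /= => nW.
  by rewrite /l memNset//= subr0.
apply: (@le_trans _ _ (\int[mu]_(x in W n) cst (h ^+ 2)%:E x)).
  apply: ge0_le_integral => //.
  - by move=> x _; rewrite lee_fin sqr_ge0.
  - exact: measurable_funTS.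
  move=> x Wx; rewrite lee_fin /l mem_set//= pickleK_inv.
  have gE : g x = (h * (g x / h))%R by rewrite mulrC divfK// gt_eqF.
  rewrite {1}gE -mulrBr exprMn ler_piMr ?sqr_ge0//.
  have := floor_le (g x / h); have := floorD1_gt (g x / h)%R.
  rewrite intrD; move: (g x / h)%R (_%:~R) => u v uv vu.
  by rewrite expr_le1// ?subr_ge0// lerBlDl ltW// addrC.
rewrite integral_cst// -h2 EFinM; apply: (lee_wpmul2l _ Wc).
by rewrite lee_fin sqr_ge0.
Qed.

(** The common refinement: pairs of labels are coded by positive integers, except [(0, 0)], sent to
    [0]. *)
Lemma ex_common_approximation (gs : seq (X -> R)) (e : R) : (0 < e)%R ->
  (forall g, List.In g gs -> L2 mu g) ->
  exists l, finite_labels l /\ forall g, List.In g gs -> approximates l e g.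
Proof.
move=> e0; elim: gs => [_|g gs IH Lgs].
  exists (fun=> 0%N); split => //; split.
    by move=> [|i]; [rewrite [X in measurable X](_ : _ = setT)|rewrite [X in measurable X](_ : _ = set0)] => //; apply/seteqP; split.
  by rewrite [X in mu X](_ : _ = set0) ?measure0//; apply/seteqP; split.
have [|l2 [[ml2 fl2] al2]] := IH; first by move=> f fgs; apply: Lgs; right.
have [|l1 [[ml1 fl1] al1]] := ex_step_approximation _ e0 (g := g); first by apply: Lgs; left.
pose l x := if (l1 x == 0%N) && (l2 x == 0%N) then 0%N else (pickle (l1 x, l2 x)).+1.
have lP x : unpickle (l x).-1 = Some (l1 x, l2 x) \/ (l x = 0%N /\ l1 x = 0%N /\ l2 x = 0%N).
  rewrite /l; case: ifPn => [/andP[/eqP -> /eqP ->]|_]; first by right.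
  by left; rewrite /= pickleK.
have lift (p : nat * nat -> nat) (f : X -> R) : p (0, 0)%N = 0%N ->
    approximates (fun x => p (l1 x, l2 x)) e f -> approximates l e f.
  move=> p0 [F F0 FE].
  exists (fun k => if k is i.+1 then (if unpickle i is Some q then F (p q) else 0)%R else 0%R) => //.
  rewrite [X in L2_le _ X _](_ : _ = fun x => f x - F (p (l1 x, l2 x)))%R//.
  apply/funext => x; congr (_ - _)%R; rewrite /l.
  by case: ifPn => [/andP[/eqP -> /eqP ->]|_]; rewrite ?p0 ?F0//= pickleK.
exists l; split; last first.
  move=> f [<-|fgs]; first exact: (lift fst).
  by apply: (lift snd) => //; exact: al2.
split.
  move=> i; apply: (@measurable_glue_set _ X l1 (fun n x =>
    (if (n == 0%N) && (l2 x == 0%N) then 0%N else (pickle (n, l2 x)).+1) = i)) => // n.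
  apply: (@measurable_glue_set _ X l2 (fun k x =>
    (if (n == 0%N) && (k == 0%N) then 0%N else (pickle (n, k)).+1) = i)) => // k.
  case: (eqVneq (if (n == 0%N) && (k == 0%N) then 0%N else (pickle (n, k)).+1) i) => h.
    by rewrite [X in measurable X](_ : _ = setT)//; apply/seteqP; split.
  by rewrite [X in measurable X](_ : _ = set0)//; apply/seteqP; split => // x /= E; move: h; rewrite E eqxx.
have mC (q : X -> nat) : (forall i, measurable [set x | q x = i]) -> measurable [set x | q x <> 0%N].
  by move=> mq; rewrite (_ : [set x | q x <> 0%N] = ~` [set x | q x = 0%N])//; exact: measurableC.
apply: (@le_lt_trans _ _ (mu ([set x | l1 x <> 0%N] `|` [set x | l2 x <> 0%N]))); last first.
  apply: le_lt_trans (measureU2 _ (mC _ ml1) (mC _ ml2)) _.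
  exact: lte_add_pinfty.
apply: le_measure; rewrite ?inE.
- rewrite [X in measurable X](_ : _ = [set x | l1 x <> 0%N] `|` [set x | l2 x <> 0%N]).
    by apply: measurableU; exact: mC.
  apply/seteqP; split => x /=; rewrite /l.
    case: ifPn => // h _; move: h; rewrite negb_and => /orP[/eqP|/eqP]; by [left|right].
  by case: ifPn => // /andP[/eqP -> /eqP ->] [].
- by apply: measurableU; exact: mC.
move=> x /=; rewrite /l; case: ifPn => // h _; move: h.
by rewrite negb_and => /orP[/eqP|/eqP]; [left|right].
Qed.

End step_approximation.

Section density.
Context d (X : measurableType d) (R : realType) (mu : {sigma_finite_measure set X -> \bar R}).
Hypotheses (sbX : @standard_borel d X R) (na : nonatomic mu) (muT : mu setT = +oo%E).
Local Open Scope ereal_scope.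
Notation L2_le := (L2_le mu).

Let deriv (T : X -> X) (x : X) : R := (Num.sqrt (Tprime mu T x) - 1)%R.

Lemma ex_tower_close (T0 : X -> X) (gs : seq (X -> R)) (K e : R) : Aut2 mu T0 ->
  (1 <= K)%R -> (0 < e <= 1)%R -> (forall g, List.In g gs -> L2_le g K) ->
  L2_le (deriv T0) K ->
  exists T, [/\ Aut2 mu T, ergodic_III1 mu T,
    L2_le (fun x => deriv T x - deriv T0 x)%R (3 * e) &
    forall f g, List.In f gs -> List.In g gs ->
      (`|UT_coef mu T f g - UT_coef mu T0 f g| <= (4 * K + 3) * e)%R].
Proof.
move=> aT0 K1 /andP[e0 e1] gsK D0K.
have K0 : (0 < K)%R by exact: lt_le_trans ltr01 K1.
have [l [[ml lfin] al]] := @ex_common_approximation _ X R mu (deriv T0 :: gs) e e0 (fun g =>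
  fun h => match h with or_introl E => eq_ind _ (L2 mu) (L2_le_L2 D0K) _ E
                      | or_intror h => L2_le_L2 (gsK g h) end).
have l0 : mu [set x | l x = 0%N] = +oo.
  apply/eqP; apply: contraLR isT; rewrite -ltey => l0fin; apply/negP => _.
  suff : mu setT < +oo by rewrite muT ltxx.
  have mC : measurable [set x | l x <> 0%N].
    by rewrite (_ : [set x | l x <> 0%N] = ~` [set x | l x = 0%N])//; exact: measurableC.
  apply: le_lt_trans (lte_add_pinfty l0fin lfin).
  rewrite [X in mu X](_ : _ = [set x | l x = 0%N] `|` [set x | l x <> 0%N]); first exact: measureU2.
  by apply/seteqP; split => // x _; have [lx|/eqP lx] := eqVneq (l x) 0%N; [left|right].
(* The step functions have norm at most [K + 1], so both errors of order [1/N] become at most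
   [e ^+ 2]. *)
pose N := (Num.truncn ((K + 1) ^+ 2 / e ^+ 2)).+1.
have NK : ((K + 1) ^+ 2 / N%:R <= e ^+ 2)%R.
  rewrite ler_pdivrMr// mulrC -ler_pdivrMr ?exprn_gt0//; exact/ltW/truncnS_gt.
have K1_gt0 : (0 < K + 1)%R by rewrite addr_gt0.
have near_le (f : X -> R) (F : nat -> R) : L2_le f K -> L2_le (fun x => f x - F (l x))%R e ->
    L2_le (F \o l) (K + 1).
  move=> fK fF; have := L2_leB K0 e0 fK fF; rewrite (_ : (fun x => _) = F \o l).
    by apply: L2_le_trans; [rewrite addr_ge0// ltW|rewrite lerD2l].
  by apply/funext => x /=; rewrite opprB addrC subrK.
have [T [aT eT err coef]] := tower_approximation sbX na muT aT0 (N := N) isT e0 ml l0.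
exists T; split => //.
  have [|G G0 DG] := al (deriv T0); first by left.
  have GK := near_le _ _ D0K DG.
  (* Each of the three terms of the error is at most [e ^+ 2], and their sum is at most
     [(2 * e) ^+ 2]. *)
  have TG : L2_le (fun x => deriv T x - G (l x))%R (2 * e).
    split.
      apply: measurable_funB; last by have [] := GK.
      by have [_ []] := aT.
    apply: le_trans (err _ G0) _.
    have h1 : (N%:R^-1)%:E * \int[mu]_x (G (l x) ^+ 2)%:E <= (e ^+ 2)%:E.
      apply: (@le_trans _ _ ((N%:R^-1)%:E * ((K + 1) ^+ 2)%:E)).
        by apply: lee_wpmul2l; [rewrite lee_fin invr_ge0|have [] := GK].
      by rewrite -EFinM lee_fin mulrC.
    have h2 := DG.2.
    apply: le_trans (leeD (leeD h1 h2) (lexx _)) _.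
    rewrite -!EFinD lee_fin exprMn; have := sqr_ge0 e; move: (e ^+ 2)%R => q q0; lra.
  have := L2_leB (mulr_gt0 (ltr0n R 2) e0) e0 TG DG.
  rewrite (_ : (fun x => _) = (fun x => deriv T x - deriv T0 x)%R).
    by rewrite (_ : 2 * e + e = 3 * e)%R//; ring.
  by apply/funext => x; rewrite opprB addrA subrK.
move=> f g fgs ggs.
have [|F F0 fF] := al f; first by right.
have [|G G0 gG] := al g; first by right.
have FK := near_le _ _ (gsK f fgs) fF; have GK := near_le _ _ (gsK g ggs) gG.
have cT := UT_coef_close muT aT K1_gt0 K0 e0 FK (gsK g ggs) fF gG.
have cT0 := UT_coef_close muT aT0 K1_gt0 K0 e0 FK (gsK g ggs) fF gG.
have [i0 b0] := L2_le_mul K1_gt0 K1_gt0 (L2_le_UT muT aT0 FK) GK.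
(* [coef] treats nonnegative functions vanishing at [0]; it is applied to the positive and to the
   negative part. *)
have cN : UT_coef mu T (F \o l) (G \o l) = ((1 - N%:R^-1) * UT_coef mu T0 (F \o l) (G \o l))%R.
  pose k t x := (Num.sqrt (Tprime mu t x) * (F \o l) (inv_map t x) * (G \o l) x)%:E.
  have mp : measurable_fun setT (fun r : R => maxe r%:E 0).
    by apply: measurable_maxe => //; exact/measurable_EFinP.
  have mn : measurable_fun setT (fun r : R => maxe (- r%:E) 0).
    apply: measurable_maxe => //; apply: measurableT_comp => //; exact/measurable_EFinP.
  have Ep : \int[mu]_x (k T)^\+ x = (1 - N%:R^-1)%:E * \int[mu]_x (k T0)^\+ x.
    have p0 (r : R) : 0 <= maxe r%:E 0 by rewrite le_max lexx orbT.
    rewrite funepos.unlock.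
    exact: (coef F G (fun r => maxe r%:E 0) F0 G0 mp p0 (maxxx _)).
  have En : \int[mu]_x (k T)^\- x = (1 - N%:R^-1)%:E * \int[mu]_x (k T0)^\- x.
    have p0 (r : R) : 0 <= maxe (- r%:E) 0 by rewrite le_max lexx orbT.
    have z0 : maxe (- 0%:E) 0 = 0 :> \bar R by rewrite oppe0 maxxx.
    rewrite funeneg.unlock.
    exact: (coef F G (fun r => maxe (- r%:E) 0) F0 G0 mn p0 z0).
  have -> : UT_coef mu T (F \o l) (G \o l) = fine (\int[mu]_x k T x) by [].
  have -> : UT_coef mu T0 (F \o l) (G \o l) = fine (\int[mu]_x k T0 x) by [].
  rewrite integralE Ep En [in RHS]integralE -muleBr//; last exact: integrable_add_def i0.
  rewrite fineM// -integralE; exact: integrable_fin_num i0.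
have {}cN : (`|UT_coef mu T (F \o l) (G \o l) - UT_coef mu T0 (F \o l) (G \o l)| <= e ^+ 2)%R.
  rewrite cN mulrBl mul1r addrAC subrr add0r normrN normrM ger0_norm ?invr_ge0//.
  apply: le_trans NK; rewrite mulrC ler_wpM2r ?invr_ge0//.
apply: le_trans (ler_distD (UT_coef mu T (F \o l) (G \o l)) _ _) _.
apply: le_trans (lerD (lexx _) (ler_distD (UT_coef mu T0 (F \o l) (G \o l)) _ _)) _.
rewrite [(`|UT_coef mu T0 (F \o l) _ - _|)%R]distrC.
(* Twice [e * K + (K + 1) * e], plus [e ^+ 2], itself at most [e]. *)
apply: le_trans (lerD cT (lerD cN cT0)) _.
have : (e ^+ 2 <= e)%R by rewrite expr2 ler_piMl// ltW.
move: (e ^+ 2)%R => q qe; lra.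
Qed.

Definition index_functions (i : d2_index mu) : seq (X -> R) :=
  match i with
  | inl fg => [:: (sval fg).1; (sval fg).2]
  | inr h => [:: sval h]
  end.

Lemma index_functions_L2 i g : List.In g (index_functions i) -> L2 mu g.
Proof.
case: i => [[[f1 f2] /= [L1 L2']]|[h Lh]] /=; first by case=> [<-|[<-|[]]].
by case=> [<-|[]].
Qed.

Lemma ex_common_bound (gs : seq (X -> R)) : (forall g, List.In g gs -> L2 mu g) ->
  exists2 K : R, (1 <= K)%R & forall g, List.In g gs -> L2_le g K.
Proof.
elim: gs => [_|g gs IH Lgs]; first by exists 1%R.
have [|K K1 KP] := IH; first by move=> f fgs; apply: Lgs; right.
have [|a a1 aP] := @L2_ex_le _ _ _ mu g; first by apply: Lgs; left.
exists (K + a)%R; first by rewrite ler_wpDr// (le_trans ler01).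
move=> f [<-|fgs].
  by apply: L2_le_trans aP; [exact: le_trans a1|rewrite lerDr (le_trans ler01)].
by apply: L2_le_trans (KP _ fgs); [exact: le_trans K1|rewrite lerDl (le_trans ler01)].
Qed.

Lemma ex_tower_near (T0 : X -> X) (s : seq (d2_index mu)) (e : R) : Aut2 mu T0 -> (0 < e)%R ->
  exists T, [/\ Aut2 mu T, ergodic_III1 mu T &
    forall i, List.In i s -> (`|d2_map mu T i - d2_map mu T0 i| < e)%R].
Proof.
move=> aT0 e0; pose gs := flatten (map index_functions s).
have gsP i g : List.In i s -> List.In g (index_functions i) -> List.In g gs.
  rewrite /gs; elim: s {gs} => //= j s IH [<-|/IH h] gi; apply/List.in_app_iff; first by left.
  by right; exact: h.
have gsL g : List.In g (deriv T0 :: gs) -> L2 mu g.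
  case=> [<-|]; first exact: aT0.2.
  rewrite /gs; elim: s {gs gsP} => //= j s IH /List.in_app_iff[|//].
  exact: index_functions_L2.
have [K K1 KP] := ex_common_bound gsL.
have K0 : (0 < K)%R by exact: lt_le_trans ltr01 K1.
(* The coefficients need [(4 * K + 3) * c] and the norms [2 * (3 * c)]; both are strictly below
   [(4 * K + 7) * c]. *)
pose c := (Order.min 1 (e / (4 * K + 7)))%R.
have p0 : (0 < 4 * K + 7)%R by rewrite addr_gt0// mulr_gt0.
have c0 : (0 < c)%R by rewrite lt_min ltr01 divr_gt0.
have ce : ((4 * K + 7) * c <= e)%R by rewrite mulrC -ler_pdivlMr// ge_min lexx orbT.
have [|||T [aT eT DT coef]] := @ex_tower_close T0 gs K c aT0 K1.
- by rewrite c0 ge_min lexx.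
- by move=> g ggs; apply: KP; right.
- by apply: KP; left.
exists T; split => // i si; apply: lt_le_trans ce.
have Kc : (0 < K * c)%R by rewrite mulr_gt0.
case: i si => [[[f g] [/= Lf Lg]]|[h Lh]] si /=.
  apply: le_lt_trans (coef f g _ _) _; [apply: (gsP _ _ si); by left|apply: (gsP _ _ si); by right; left|].
  by rewrite ltr_pM2r// ltrD2l ltr_nat.
have LD : L2 mu (fun x => deriv T x - h x)%R.
  have [a a1 aP] := L2_ex_le aT.2; have [b b1 bP] := L2_ex_le Lh.
  by apply: L2_le_L2 (L2_leB _ _ aP bP); apply: lt_le_trans ltr01 _.
have LD0 : L2 mu (fun x => deriv T0 x - h x)%R.
  have [a a1 aP] := L2_ex_le aT0.2; have [b b1 bP] := L2_ex_le Lh.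
  by apply: L2_le_L2 (L2_leB _ _ aP bP); apply: lt_le_trans ltr01 _.
have c3 : (0 < 3 * c)%R by rewrite mulr_gt0.
have := L2_norm_close c3 LD LD0; rewrite (_ : (fun x => _) = (fun x => deriv T x - deriv T0 x)%R).
  move=> /(_ DT) h1; apply: le_lt_trans h1 _; lra.
by apply/funext => x; rewrite opprB addrA subrK.
Qed.

Lemma dense_Erg_III1 : dense (Erg_III1_2 mu).
Proof.
move=> O [T0 OT0] oO.
pose B (k : seq (d2_index mu) * R) : set (aut2_top mu) :=
  [set T | forall i, List.In i k.1 -> (`|d2_map mu (sval T) i - d2_map mu (sval T0) i| < k.2)%R].
(* Finitely many indices and one precision describe a basis of neighbourhoods of [T0], the topology
   being induced from pointwise convergence; [cvF] shows that every neighbourhood contains such a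
   set. *)
pose F := filter_from [set k : seq (d2_index mu) * R | (0 < k.2)%R] B.
have FF : Filter F.
  apply: filter_from_filter; first by exists ([::], 1%R) => /=.
  move=> [s1 e1] [s2 e2] /= h1 h2; exists (s1 ++ s2, Order.min e1 e2); first by rewrite /= lt_min h1.
  move=> T BT; split => i si; have := BT i; rewrite /= lt_min.
    by case/(_ (proj2 (List.in_app_iff _ _ _) (or_introl si)))/andP.
  by case/(_ (proj2 (List.in_app_iff _ _ _) (or_intror si)))/andP.
have cvF : F --> T0.
  have cvm : (fun T : aut2_top mu => d2_map mu (sval T)) @ F --> (d2_map mu (sval T0) : {ptws d2_index mu -> R}).
    apply/cvg_sup => i A [_ [[C oC <-] /= Ci] CA].
    have [e /= e0 eC] := open_nbhs_nbhs (conj oC Ci).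
    exists ([:: i], e) => //= T BT; apply: CA; apply: eC => /=.
    by rewrite distrC; apply: BT; left.
  move=> A; rewrite nbhsE => -[_ [[C oC <-] CT0] CA].
  exact: (@filterS _ F FF _ _ CA (cvm C (open_nbhs_nbhs (conj oC CT0)))).
have [[s e] /= e0 BO] := cvF O (open_nbhs_nbhs (conj oO OT0)).
have [T [aT eT close]] := ex_tower_near s (svalP T0) e0.
by exists (exist _ T aT); split => //; exact: BO.
Qed.

End density.

Theorem theorem5p3 (d : measure_display) (X : measurableType d) (R : realType)
  (mu : {measure set X -> \bar R}) :
  @standard_borel d X R -> sigma_finite setT mu -> nonatomic mu ->
  mu setT = +oo%E ->
  Gdelta (Erg_III1_2 mu) /\ dense (Erg_III1_2 mu).
Proof.
(* The measure is repacked with its sigma-finiteness around the same function [f], so that both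
   conclusions speak of the given measure. *)
case: mu => f cf sbX sf na muT.
pose mu : {measure set X -> \bar R} := Measure.Pack cf.
pose m : {sigma_finite_measure set X -> \bar R} :=
  HB.pack (f : set X -> \bar R) mu (@Measure_isSigmaFinite.Build _ _ _ mu sf).
split; [exact: (@Gdelta_Erg_III1 _ _ _ m)|exact: (@dense_Erg_III1 _ _ _ m)].
Qed.
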